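(* Let $X=(X(k,l))_{k,l\ge0}$ be a family of sets, let $P$ be a TRAP and let $\phi=(\phi(k,l))_{k,l\in\mathbb N_0}$ be a family of maps $\phi(k,l):X(k,l)\to P(k,l)$. Then there exists a unique TRAP morphism $\Phi:\mathrm{solCGr}(X)\to P$ sending $x$ to $\phi(x)$ for any $x\in X$ (where $x$ is identified with a one-vertex graph as in the context). If moreover $P$ is unitary, this morphism $\Phi$ is uniquely extended as a unitary TRAP morphism from $\mathrm{CGr}(X)$ to $P$. In other words, $\mathrm{solCGr}(X)$ (resp. $\mathrm{CGr}(X)$) is the free TRAP (resp. the free unitary TRAP, i.e. the free wheeled PROP) generated by $X$.
   Context: Notation: $\mathbb{N}_0=\{0,1,2,\dots\}$, $[k]=\{1,\dots,k\}$, $\mathfrak S_k$ is the symmetric group on $[k]$. TRAP. A TRAP is a family $P=(P(k,l))_{k,l\ge 0}$ of sets with: (1) for all $k,l\in\mathbb N_0$, a left action of $\mathfrak S_l$ and a right action of $\mathfrak S_k$ on $P(k,l)$ which commute (this is called an $\mathfrak S\times\mathfrak S^{op}$-module). (2) Maps $*:P(k,l)\times P(k',l')\to P(k+k',l+l')$ (horizontal concatenation) such that: $*$ is associative; there is $I_0\in P(0,0)$ with $I_0*p=p*I_0=p$; $(\sigma\cdot p\cdot\tau)*(\sigma'\cdot p'\cdot\tau')=(\sigma\otimes\sigma')\cdot(p*p')\cdot(\tau\otimes\tau')$, where for $\alpha\in\mathfrak S_m,\beta\in\mathfrak S_n$, $(\alpha\otimes\beta)(i)=\alpha(i)$ if $i\le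 m$ and $\beta(i-m)+m$ if $i>m$; and $c_{l,l'}\cdot(p*p')=(p'*p)\cdot c_{k,k'}$ for $p\in P(k,l)$, $p'\in P(k',l')$, where $c_{m,n}\in\mathfrak S_{m+n}$, $c_{m,n}(i)=i+n$ if $i\le m$ and $i-m$ if $i>m$. (3) For $k,l\ge1$, $i\in[k]$, $j\in[l]$, maps $t_{i,j}:P(k,l)\to P(k-1,l-1)$ (partial trace maps) such that: (a) for $k,l\ge2$, $i\in[k]$, $j\in[l]$, $i'\in[k-1]$, $j'\in[l-1]$: $t_{i',j'}\circ t_{i,j}$ equals $t_{i-1,j-1}\circ t_{i',j'}$ if $i'<i,j'<j$; $t_{i,j-1}\circ t_{i'+1,j'}$ if $i'\ge i,j'<j$; $t_{i-1,j}\circ t_{i',j'+1}$ if $i'<i,j'\ge j$; $t_{i,j}\circ t_{i'+1,j'+1}$ if $i'\ge i,j'\ge j$. (b) $t_{i,j}(\sigma\cdot p\cdot\tau)=\sigma_j\cdot t_{\tau(i),\sigma^{-1}(j)}(p)\cdot\tau_{\tau(i)}$, where for $\alpha\in\mathfrak S_n$ and $q\in[n]$, $\alpha_q\in\mathfrak S_{n-1}$ is the permutation whose word is obtained from the word $\alpha(1)\dots\alpha(n)$ by deleting the letter $q$ and subtracting $1$ from all letters $>q$. (c) for $p\in P(k,l)$, $p'\in P(k',l')$ ($k,l,k',l'\ge0$), $i\in[k+k']$, $j\in[l+l']$: $t_{i,j}(p*p')=t_{i,j}(p)*p'$ if $i\le k,j\le l$, and $t_{i,j}(p*p')=p*t_{i-k,j-l}(p')$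 if $i>k,j>l$. The TRAP is unitary (equivalently, a wheeled PROP) if there is $I\in P(1,1)$ such that for all $k,l\ge0$ and $p\in P(k,l)$: $t_{1,j}(I*p)=(1,2,\dots,j-1)\cdot p$ for $2\le j\le l+1$; $t_{i,1}(I*p)=p\cdot(1,2,\dots,i-1)^{-1}$ for $2\le i\le k+1$; $t_{k+1,j}(p*I)=(j,j+1,\dots,l)^{-1}\cdot p$ for $1\le j\le l$; $t_{i,l+1}(p*I)=p\cdot(i,i+1,\dots,k)$ for $1\le i\le k$ (here $(a,\dots,b)$ denotes a cycle). A morphism of TRAPs $\phi:P\to Q$ is a family of maps $P(k,l)\to Q(k,l)$ commuting with the symmetric group actions, with $\phi(I_0)=I_0$, $\phi(p*q)=\phi(p)*\phi(q)$ and $\phi\circ t_{i,j}=t_{i,j}\circ\phi$. Between unitary TRAPs it is unitary if it maps the unit $I_P$ to the unit $I_Q$. Graphs. A graph $G$ consists of finite (possibly empty) sets $V(G)$ (vertices), $E(G)$ (internal edges), $I(G)$ (input edges), $O(G)$ (output edges), $IO(G)$ (input-output edges), $L(G)$ (loops, i.e. edges with no endpoints), a source map $s:E(G)\sqcup O(G)\to V(G)$, a target map $t:E(G)\sqcup I(G)\to V(G)$, and bijections $\alpha:I(G)\sqcup IO(G)\to[i(G)]$, $\beta:O(G)\sqcup IO(G)\to[o(G)]$, where $i(G)=|I(G)|+|IO(G)|$, $o(G)=|O(G)|+|IO(G)|$. The incoming (outgoing) edges of a vertex $v$ are the elements of $t^{-1}(v)$ (of $s^{-1}(v)$), their number is $i(v)$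 (resp. $o(v)$). It is corolla ordered if for each vertex $v$ the incoming edges and the outgoing edges are each totally ordered. It is $X$-decorated if it has a map $d_G$ on $V(G)$ with $d_G(v)\in X(i(v),o(v))$. It is solar if $IO(G)=L(G)=\emptyset$. Isomorphisms are families of bijections between the six sets respecting $s,t,\alpha,\beta$, orders and decorations. $\mathrm{CGr}(X)(k,l)$ is the set of isomorphism classes of $X$-decorated corolla ordered graphs with $i(G)=k$, $o(G)=l$, and $\mathrm{solCGr}(X)(k,l)$ the subset of solar ones. TRAP structure. For $\tau\in\mathfrak S_l$, $\sigma\in\mathfrak S_k$, $\tau\cdot G\cdot\sigma$ is $G$ with $\alpha,\beta$ replaced by $\sigma^{-1}\circ\alpha$, $\tau\circ\beta$. $G*G'$ is the disjoint union, the input (output) labels of $G'$ being shifted by $i(G)$ (by $o(G)$); $I_0$ is the empty graph. For $t_{i,j}(G)$: let $e=\alpha^{-1}(i)$, $f=\beta^{-1}(j)$; remove $e$ and $f$ and add one new edge $g$: if $e\in I(G),f\in O(G)$, $g$ is internal with source $s(f)$ and target $t(e)$; if $e\in IO(G),f\in O(G)$, $g$ is an output edge with source $s(f)$ and output label $\beta(e)$; if $e\in I(G),f\in IO(G)$, $g$ is an input edge with target $t(e)$ and input label $\alpha(f)$; if $e\ne f$ are both in $IO(G)$, $g$ is an input-output edge with input label $\alpha(f)$ and output label $\beta(e)$; if $e=f\in IO(G)$, $g$ is a loop. Then all input labels $>i$ and output labels $>j$ are decreased by $1$; $g$ takes the position of $f$ among outgoing edges of $s(f)$ and of $e$ among incoming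 edges of $t(e)$. With this, $\mathrm{CGr}(X)$ is a unitary TRAP with unit the vertexless graph $I$ with a single input-output edge, and $\mathrm{solCGr}(X)$ is a sub-TRAP. Identification: $x\in X(k,l)$ is identified with the graph in $\mathrm{solCGr}(X)(k,l)$ with one vertex decorated by $x$, $k$ incoming (input) edges and $l$ outgoing (output) edges, totally ordered at the vertex according to their indices. *)

(* Defs.v *)
From mathcomp Require Import all_boot all_fingroup.
From mathcomp Require Import boolp.

Set Implicit Arguments.
Unset Strict Implicit.
Unset Printing Implicit Defensive.

(* Labels, inputs and outputs are numbered from 0: the label called [i] in
   {1, ..., k} in the mathematical text is the element [i - 1] of ['I_k]. *)

(** * Permutations *)

(* The product of [{perm T}] composes from left to right,
   [(s * t) x = t (s x)]; [pcomp s t] is the composite "s after t". *)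
Definition pcomp n (s t : 'S_n) : 'S_n := (t * s)%g.

Definition ptensor_fun m n (a : 'S_m) (b : 'S_n) (i : 'I_(m + n)) : 'I_(m + n) :=
  match split i with inl i1 => lshift n (a i1) | inr i2 => rshift m (b i2) end.

Lemma ptensor_inj m n (a : 'S_m) (b : 'S_n) : injective (ptensor_fun a b).
Proof.
apply: (can_inj (g := ptensor_fun a^-1 b^-1)) => i; rewrite /ptensor_fun.
case: (splitP i) => i' Ei.
  have -> : split (lshift n (a i')) = inl (a i') by exact: (unsplitK (inl _)).
  by apply: val_inj; rewrite /= permK Ei.
have -> : split (rshift m (b i')) = inr (b i') by exact: (unsplitK (inr _)).
by apply: val_inj; rewrite /= permK Ei.
Qed.

Definition ptensor m n (a : 'S_m) (b : 'S_n) : 'S_(m + n) := perm (@ptensor_inj m n a b).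

(* The block permutation c_{m,n}: i |-> i + n on the first m letters and
   i |-> i - m on the last n ones. *)
Definition pswap_fun m n (i : 'I_(m + n)) : 'I_(m + n) :=
  cast_ord (addnC n m)
    match split i with inl i1 => rshift n i1 | inr i2 => lshift m i2 end.

Lemma pswap_inj m n : injective (@pswap_fun m n).
Proof.
move=> i1 i2 /cast_ord_inj; case: (splitP i1) => a Ea; case: (splitP i2) => b Eb.
- by move/(congr1 val)/eqP; rewrite /= eqn_add2l => /eqP E; apply/val_inj; rewrite /= Ea Eb E.
- by move/(congr1 val)=> /= E; have := ltn_ord b; rewrite -E ltnNge leq_addr.
- by move/(congr1 val)=> /= E; have := ltn_ord a; rewrite E ltnNge leq_addr.
- by move/(congr1 val)=> /= E; apply/val_inj; rewrite /= Ea Eb E.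
Qed.

Definition pswap m n : 'S_(m + n) := perm (@pswap_inj m n).

(* [relabel im], for a proof [im] of [i != m], is the label [m] decreased by 1
   if it is larger than [i]. *)
Definition relabel k (i m : 'I_k.+1) (im : i != m) : 'I_k := s2val (unlift_some im).

Lemma lift_relabel k (i m : 'I_k.+1) (im : i != m) : lift i (relabel im) = m.
Proof. by rewrite /relabel; case: unlift_some => j /= ->. Qed.

Lemma pdel_neq n (a : 'S_n.+1) (q : 'I_n.+1) (m : 'I_n) : q != a (lift (a^-1%g q) m).
Proof. by rewrite -{1}(permKV a q) (inj_eq perm_inj) neq_lift. Qed.

Definition pdel_fun n (a : 'S_n.+1) (q : 'I_n.+1) (m : 'I_n) : 'I_n :=
  relabel (pdel_neq a q m).

Lemma pdel_inj n (a : 'S_n.+1) (q : 'I_n.+1) : injective (pdel_fun a q).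
Proof.
move=> m1 m2 /(congr1 (lift q)); rewrite !lift_relabel.
by move/perm_inj/lift_inj.
Qed.

(* The permutation whose word is the word of [a] without the letter [q] (found
   at the position [a^-1 q]), the letters larger than [q] being decreased. *)
Definition pdel n (a : 'S_n.+1) (q : 'I_n.+1) : 'S_n := perm (@pdel_inj n a q).

(* The cycle (a, a + 1, ..., b), for [a <= b < n]. *)
Definition segment n (a b : nat) : seq 'I_n :=
  [seq i : 'I_n <- enum 'I_n | a <= val i <= b].

Lemma next_segment_inj n a b : injective (next (segment n a b)).
Proof. exact: can_inj (prev_next (filter_uniq _ (enum_uniq _))). Qed.

Definition pcycle n (a b : nat) : 'S_n := perm (@next_segment_inj n a b).

(** * TRAPs *)

Record trap_ops := TrapOps {
  trap_sort :> nat -> nat -> Type;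
  lact : forall k l, 'S_l -> trap_sort k l -> trap_sort k l;
  ract : forall k l, trap_sort k l -> 'S_k -> trap_sort k l;
  hcat : forall k l k' l',
    trap_sort k l -> trap_sort k' l' -> trap_sort (k + k') (l + l');
  hunit : trap_sort 0 0;
  ptr : forall k l, 'I_k.+1 -> 'I_l.+1 -> trap_sort k.+1 l.+1 -> trap_sort k l
}.

Definition castP (P : nat -> nat -> Type) k k' l l' (ek : k = k') (el : l = l')
    (p : P k l) : P k' l' :=
  match ek in _ = k0, el in _ = l0 return P k0 l0 with erefl, erefl => p end.

Record is_trap (P : trap_ops) : Prop := IsTrap {
  lact1 : forall k l (p : P k l), lact 1%g p = p;
  lactM : forall k l (s s' : 'S_l) (p : P k l), lact s (lact s' p) = lact (pcomp s s') p;
  ract1 : forall k l (p : P k l), ract p 1%g = p;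
  ractM : forall k l (t t' : 'S_k) (p : P k l), ract (ract p t) t' = ract p (pcomp t t');
  lract : forall k l (s : 'S_l) (t : 'S_k) (p : P k l),
    lact s (ract p t) = ract (lact s p) t;

  hcatA : forall k l k' l' k'' l'' (p : P k l) (p' : P k' l') (p'' : P k'' l''),
    castP (addnA k k' k'') (addnA l l' l'') (hcat p (hcat p' p'')) = hcat (hcat p p') p'';
  hcat0p : forall k l (p : P k l), hcat (hunit P) p = p;
  hcatp0 : forall k l (p : P k l), castP (addn0 k) (addn0 l) (hcat p (hunit P)) = p;
  hcat_act : forall k l k' l' (s : 'S_l) (t : 'S_k) (s' : 'S_l') (t' : 'S_k')
      (p : P k l) (p' : P k' l'),
    hcat (lact s (ract p t)) (lact s' (ract p' t')) =
    lact (ptensor s s') (ract (hcat p p') (ptensor t t'));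
  hcatC : forall k l k' l' (p : P k l) (p' : P k' l'),
    lact (pswap l l') (hcat p p') =
    ract (castP (addnC k' k) (addnC l' l) (hcat p' p)) (pswap k k');

  ptr_ptr_ltlt : forall k l (p : P k.+2 l.+2)
      (i : 'I_k.+2) (j : 'I_l.+2) (i' : 'I_k.+1) (j' : 'I_l.+1),
    i' < i -> j' < j ->
    ptr i' j' (ptr i j p) = ptr (inord i.-1) (inord j.-1) (ptr (inord i') (inord j') p);
  ptr_ptr_gelt : forall k l (p : P k.+2 l.+2)
      (i : 'I_k.+2) (j : 'I_l.+2) (i' : 'I_k.+1) (j' : 'I_l.+1),
    i' >= i -> j' < j ->
    ptr i' j' (ptr i j p) = ptr (inord i) (inord j.-1) (ptr (inord i'.+1) (inord j') p);
  ptr_ptr_ltge : forall k l (p : P k.+2 l.+2)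
      (i : 'I_k.+2) (j : 'I_l.+2) (i' : 'I_k.+1) (j' : 'I_l.+1),
    i' < i -> j' >= j ->
    ptr i' j' (ptr i j p) = ptr (inord i.-1) (inord j) (ptr (inord i') (inord j'.+1) p);
  ptr_ptr_gege : forall k l (p : P k.+2 l.+2)
      (i : 'I_k.+2) (j : 'I_l.+2) (i' : 'I_k.+1) (j' : 'I_l.+1),
    i' >= i -> j' >= j ->
    ptr i' j' (ptr i j p) = ptr (inord i) (inord j) (ptr (inord i'.+1) (inord j'.+1) p);

  ptr_act : forall k l (s : 'S_l.+1) (t : 'S_k.+1) (p : P k.+1 l.+1)
      (i : 'I_k.+1) (j : 'I_l.+1),
    ptr i j (lact s (ract p t)) =
    lact (pdel s j) (ract (ptr (t i) (s^-1%g j) p) (pdel t (t i)));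

  ptr_hcatl : forall k l k' l' (p : P k.+1 l.+1) (p' : P k' l')
      (i : 'I_k.+1) (j : 'I_l.+1),
    @ptr P (k + k') (l + l') (lshift k' i) (lshift l' j) (hcat p p') = hcat (ptr i j p) p';
  ptr_hcatr : forall k l k' l' (p : P k l) (p' : P k'.+1 l'.+1)
      (i : 'I_k'.+1) (j : 'I_l'.+1),
    @ptr P (k + k') (l + l')
      (cast_ord (addnS k k') (rshift k i)) (cast_ord (addnS l l') (rshift l j))
      (castP (addnS k k') (addnS l l') (hcat p p')) =
    hcat p (ptr i j p')
}.

Record is_trap_unit (P : trap_ops) (I : P 1 1) : Prop := IsTrapUnit {
  ptr_unitl_out : forall k l (p : P k l) (j : 'I_l),
    @ptr P k l ord0 (lift ord0 j) (hcat I p) = lact (pcycle l 0 j) p;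
  ptr_unitl_in : forall k l (p : P k l) (i : 'I_k),
    @ptr P k l (lift ord0 i) ord0 (hcat I p) = ract p (pcycle k 0 i)^-1%g;
  ptr_unitr_out : forall k l (p : P k l) (j : 'I_l),
    ptr ord_max (widen_ord (leqnSn l) j) (castP (addn1 k) (addn1 l) (hcat p I)) =
    lact (pcycle l j l.-1)^-1%g p;
  ptr_unitr_in : forall k l (p : P k l) (i : 'I_k),
    ptr (widen_ord (leqnSn k) i) ord_max (castP (addn1 k) (addn1 l) (hcat p I)) =
    ract p (pcycle k i k.-1)
}.

Record trap_morphism (P Q : trap_ops) (f : forall k l, P k l -> Q k l) : Prop :=
  TrapMorphism {
  morph_lact : forall k l (s : 'S_l) (p : P k l), f k l (lact s p) = lact s (f k l p);
  morph_ract : forall k l (t : 'S_k) (p : P k l), f k l (ract p t) = ract (f k l p) t;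
  morph_hunit : f 0 0 (hunit P) = hunit Q;
  morph_hcat : forall k l k' l' (p : P k l) (p' : P k' l'),
    f _ _ (hcat p p') = hcat (f k l p) (f k' l' p');
  morph_ptr : forall k l (i : 'I_k.+1) (j : 'I_l.+1) (p : P k.+1 l.+1),
    f k l (ptr i j p) = ptr i j (f k.+1 l.+1 p)
}.

(* Morphisms between unitary TRAPs with the units [IP] and [IQ]. *)
Definition utrap_morphism (P Q : trap_ops) (IP : P 1 1) (IQ : Q 1 1)
    (f : forall k l, P k l -> Q k l) : Prop :=
  trap_morphism f /\ f 1 1 IP = IQ.

(** * Graphs *)

(* [r] restricts to a total order on each fiber of [f]; its values on pairs
   lying in different fibers are irrelevant. *)
Definition fiber_order (A V : finType) (f : A -> V) (r : rel A) : Prop :=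
  forall v, let D := [pred a | f a == v] in
  [/\ {in D, reflexive r}, {in D &, antisymmetric r},
      {in D & &, transitive r} & {in D &, total r}].

(* [ilab] and [olab] being bijective, [k] and [l] are the numbers
   |I| + |IO| of inputs and |O| + |IO| of outputs.  The orders of the incoming
   and of the outgoing edges of the vertices are the restrictions of
   [ile] and [ole] to the fibers of [tgt] and [src]. *)
Record graph (X : nat -> nat -> Type) (k l : nat) := Graph {
  vert : finType;
  iedge : finType;
  inp : finType;
  outp : finType;
  inout : finType;
  loop : finType;
  src : iedge + outp -> vert;
  tgt : iedge + inp -> vert;
  ilab : inp + inout -> 'I_k;
  olab : outp + inout -> 'I_l;
  ile : rel (iedge + inp)%type;
  ole : rel (iedge + outp)%type;
  deco : vert -> {kl : nat * nat & X kl.1 kl.2};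
  ilab_bij : bijective ilab;
  olab_bij : bijective olab;
  ile_order : fiber_order tgt ile;
  ole_order : fiber_order src ole;
  deco_arity : forall v,
    tag (deco v) = (#|[pred a | tgt a == v]|, #|[pred a | src a == v]|)
}.

Arguments src {X k l} G _ : rename.
Arguments tgt {X k l} G _ : rename.
Arguments ilab {X k l} G _ : rename.
Arguments olab {X k l} G _ : rename.
Arguments ile {X k l} G _ _ : rename.
Arguments ole {X k l} G _ _ : rename.
Arguments deco {X k l} G _ : rename.

Definition sum_map A A' B B' (f : A -> A') (g : B -> B') (x : A + B) : A' + B' :=
  match x with inl a => inl (f a) | inr b => inr (g b) end.

Record graph_iso X k l (G H : graph X k l) := GraphIso {
  isoV : vert G -> vert H;
  isoE : iedge G -> iedge H;
  isoI : inp G -> inp H;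
  isoO : outp G -> outp H;
  isoIO : inout G -> inout H;
  isoL : loop G -> loop H;
  isoV_bij : bijective isoV;
  isoE_bij : bijective isoE;
  isoI_bij : bijective isoI;
  isoO_bij : bijective isoO;
  isoIO_bij : bijective isoIO;
  isoL_bij : bijective isoL;
  iso_src : forall a, src H (sum_map isoE isoO a) = isoV (src G a);
  iso_tgt : forall a, tgt H (sum_map isoE isoI a) = isoV (tgt G a);
  iso_ilab : forall a, ilab H (sum_map isoI isoIO a) = ilab G a;
  iso_olab : forall a, olab H (sum_map isoO isoIO a) = olab G a;
  iso_ile : forall a b, tgt G a = tgt G b ->
    ile H (sum_map isoE isoI a) (sum_map isoE isoI b) = ile G a b;
  iso_ole : forall a b, src G a = src G b ->
    ole H (sum_map isoE isoO a) (sum_map isoE isoO b) = ole G a b;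
  iso_deco : forall v, deco H (isoV v) = deco G v
}.

Definition isomorphic X k l (G H : graph X k l) : Prop := inhabited (graph_iso G H).

Definition solar X k l (G : graph X k l) : bool :=
  (#|inout G| == 0) && (#|loop G| == 0).

(** * Operations on graphs *)

Section Actions.
Variables (X : nat -> nat -> Type) (k l : nat) (G : graph X k l).

Lemma graph_lact_bij (s : 'S_l) : bijective (s \o olab G).
Proof. exact: bij_comp (injF_bij (@perm_inj _ s)) (olab_bij G). Qed.

Definition graph_lact (s : 'S_l) : graph X k l := {|
  vert := vert G; iedge := iedge G; inp := inp G; outp := outp G;
  inout := inout G; loop := loop G;
  src := src G; tgt := tgt G; ilab := ilab G; olab := s \o olab G;
  ile := ile G; ole := ole G; deco := deco G;
  ilab_bij := ilab_bij G; olab_bij := graph_lact_bij s;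
  ile_order := @ile_order _ _ _ G; ole_order := @ole_order _ _ _ G;
  deco_arity := @deco_arity _ _ _ G |}.

Lemma graph_ract_bij (t : 'S_k) : bijective (t^-1%g \o ilab G).
Proof. exact: bij_comp (injF_bij (@perm_inj _ t^-1%g)) (ilab_bij G). Qed.

Definition graph_ract (t : 'S_k) : graph X k l := {|
  vert := vert G; iedge := iedge G; inp := inp G; outp := outp G;
  inout := inout G; loop := loop G;
  src := src G; tgt := tgt G; ilab := t^-1%g \o ilab G; olab := olab G;
  ile := ile G; ole := ole G; deco := deco G;
  ilab_bij := graph_ract_bij t; olab_bij := olab_bij G;
  ile_order := @ile_order _ _ _ G; ole_order := @ole_order _ _ _ G;
  deco_arity := @deco_arity _ _ _ G |}.

End Actions.

Section EdgelessGraphs.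
Variable X : nat -> nat -> Type.

Lemma sum_void_bij (A : finType) n (f : void + A -> 'I_n) :
  injective f -> #|A| = n -> bijective f.
Proof. by move=> f_inj An; apply: inj_card_bij => //; rewrite card_ord card_sum card_void An. Qed.

Lemma void_fiber_order (A : finType) (f : A -> void) (r : rel A) : fiber_order f r.
Proof. by case. Qed.

Definition from_void2 (T : Type) (x : void + void) : T :=
  match x with inl a => of_void T a | inr a => of_void T a end.

Lemma from_void2_bij : bijective (@from_void2 'I_0).
Proof. by exists (fun x : 'I_0 => match notF (ltn_ord x) with end) => [[[]|[]]|[]]. Qed.

Definition graph_void : graph X 0 0 := {|
  vert := void; iedge := void; inp := void; outp := void; inout := void; loop := void;
  src := from_void2 void; tgt := from_void2 void;
  ilab := from_void2 'I_0; olab := from_void2 'I_0;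
  ile := fun _ _ => true; ole := fun _ _ => true; deco := of_void _;
  ilab_bij := from_void2_bij; olab_bij := from_void2_bij;
  ile_order := void_fiber_order _ _; ole_order := void_fiber_order _ _;
  deco_arity := fun v => match v with end |}.

Definition unit_lab (x : void + unit) : 'I_1 := ord0.

Lemma unit_lab_bij : bijective unit_lab.
Proof. by exists (fun=> inr tt) => [[[]|[]]|x]; rewrite ?[x]ord1. Qed.

Definition graph_unit : graph X 1 1 := {|
  vert := void; iedge := void; inp := void; outp := void; inout := unit; loop := void;
  src := from_void2 void; tgt := from_void2 void;
  ilab := unit_lab; olab := unit_lab;
  ile := fun _ _ => true; ole := fun _ _ => true; deco := of_void _;
  ilab_bij := unit_lab_bij; olab_bij := unit_lab_bij;
  ile_order := void_fiber_order _ _; ole_order := void_fiber_order _ _;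
  deco_arity := fun v => match v with end |}.

End EdgelessGraphs.

Section Corolla.
Variables (X : nat -> nat -> Type) (k l : nat).

Definition corolla_end n (x : void + 'I_n) : unit := tt.

Definition corolla_lab n (x : 'I_n + void) : 'I_n :=
  match x with inl i => i | inr a => of_void _ a end.

Definition corolla_le n : rel (void + 'I_n)%type := fun x y =>
  match x, y with inr i, inr j => i <= j | _, _ => false end.

Lemma corolla_lab_bij n : bijective (@corolla_lab n).
Proof. by exists inl => [[]|]. Qed.

Lemma corolla_order n : fiber_order (@corolla_end n) (@corolla_le n).
Proof.
move=> v /=; split.
- by move=> [[]|i] _ /=.
- by move=> [[]|i] [[]|j] _ _ //= ?; congr inr; apply/val_inj/anti_leq.
- by move=> [[]|j] [[]|i] [[]|m] _ _ _ /=; apply: leq_trans.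
- by move=> [[]|j] [[]|i] _ _ /=; apply: leq_total.
Qed.

Lemma corolla_arity (x : X k l) (v : unit) :
  tag (existT (fun kl => X kl.1 kl.2) (k, l) x) =
  (#|[pred a | @corolla_end k a == v]|, #|[pred a | @corolla_end l a == v]|).
Proof.
by case: v; congr pair;
   rewrite (@eq_card _ _ predT) // card_sum card_void card_ord.
Qed.

Definition corolla (x : X k l) : graph X k l := {|
  vert := unit; iedge := void; inp := 'I_k; outp := 'I_l; inout := void; loop := void;
  src := @corolla_end l; tgt := @corolla_end k;
  ilab := @corolla_lab k; olab := @corolla_lab l;
  ile := @corolla_le k; ole := @corolla_le l;
  deco := fun _ => existT (fun kl => X kl.1 kl.2) (k, l) x;
  ilab_bij := @corolla_lab_bij k; olab_bij := @corolla_lab_bij l;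
  ile_order := @corolla_order k; ole_order := @corolla_order l;
  deco_arity := corolla_arity x |}.

End Corolla.

Section DisjointUnion.

Lemma inj_surj_bij (A B : finType) (f : A -> B) :
  injective f -> (forall y, exists x, f x = y) -> bijective f.
Proof.
move=> f_inj f_surj; apply: inj_card_bij => //.
rewrite -(card_codom f_inj); apply/subset_leq_card/subsetP => y _.
by have [x <-] := f_surj y; apply: codom_f.
Qed.

(* The reshuffling underlying the disjoint union of two edge sets that are
   themselves disjoint unions. *)
Definition sum_swap A B A' B' (x : (A + A') + (B + B')) : (A + B) + (A' + B') :=
  match x with
  | inl (inl a) => inl (inl a) | inl (inr a) => inr (inl a)
  | inr (inl b) => inl (inr b) | inr (inr b) => inr (inr b)
  end.

Lemma sum_swap_bij A B A' B' : bijective (@sum_swap A B A' B').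
Proof. by exists (@sum_swap A A' B B') => [[[]|[]]|[[]|[]]]. Qed.

Definition sum_rel A A' (r : rel A) (r' : rel A') : rel (A + A')%type := fun x y =>
  match x, y with
  | inl a, inl b => r a b | inr a, inr b => r' a b | _, _ => false
  end.

Definition sum_lab m n A A' (f : A -> 'I_m) (f' : A' -> 'I_n) (x : A + A') : 'I_(m + n) :=
  match x with inl a => lshift n (f a) | inr a => rshift m (f' a) end.

Lemma sum_lab_bij m n A A' (f : A -> 'I_m) (f' : A' -> 'I_n) :
  bijective f -> bijective f' -> bijective (sum_lab f f').
Proof.
move=> [g fK gK] [g' fK' gK'].
exists (fun i => match split i with inl a => inl (g a) | inr a => inr (g' a) end).
  by case=> [a|a] /=; rewrite ?(unsplitK (inl _)) ?(unsplitK (inr _)) ?fK ?fK'.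
by move=> i; case: splitP => a Ea; apply: val_inj; rewrite /= ?gK ?gK' Ea.
Qed.

(* Pulling back a fiberwise total order along an injection. *)
Lemma fiber_order_pull (A B V : finType) (f : A -> V) (r : rel A) (h : B -> A) :
  injective h -> fiber_order f r -> fiber_order (f \o h) (relpre h r).
Proof.
move=> h_inj fr v; have [r1 r2 r3 r4] := fr v; split=> [a Da|a b Da Db|b a c Db Da Dc|a b Da Db] /=.
- exact: r1.
- by move/r2 => /(_ Da Db)/h_inj.
- exact: r3.
- exact: r4.
Qed.

Lemma sum_fiber_order (A A' V V' : finType) (f : A -> V) (f' : A' -> V') r r' :
  fiber_order f r -> fiber_order f' r' -> fiber_order (sum_map f f') (sum_rel r r').
Proof.
move=> fr fr' [v|v]; [have [r1 r2 r3 r4] := fr v | have [r1 r2 r3 r4] := fr' v]; split.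
- by case=> a Da //; apply: r1.
- by move=> [a|a] [b|b] Da Db //= ab; congr inl; apply: r2.
- by move=> [b|b] [a|a] [c|c] Db Da Dc //=; apply: r3.
- by move=> [a|a] [b|b] Da Db //=; apply: r4.
- by case=> a Da //; apply: r1.
- by move=> [a|a] [b|b] Da Db //= ab; congr inr; apply: r2.
- by move=> [b|b] [a|a] [c|c] Db Da Dc //=; apply: r3.
- by move=> [a|a] [b|b] Da Db //=; apply: r4.
Qed.

Lemma card_fiber_comp (A B V : finType) (f : A -> V) (h : B -> A) v :
  bijective h -> #|[pred b | f (h b) == v]| = #|[pred a | f a == v]|.
Proof.
move=> h_bij; by rewrite -!sum1_card [RHS](reindex h) //=; apply: onW_bij.
Qed.

Lemma card_fiber_sum (A A' V V' : finType) (f : A -> V) (f' : A' -> V') (v : V + V') :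
  #|[pred a | sum_map f f' a == v]| =
  match v with
  | inl v => #|[pred a | f a == v]| | inr v => #|[pred a | f' a == v]|
  end.
Proof.
rewrite -sum1_card big_sumType /=; case: v => v.
  by rewrite [X in _ + X]big_pred0 ?addn0 // sum1_card; apply: eq_card.
by rewrite [X in X + _]big_pred0 ?add0n // sum1_card; apply: eq_card.
Qed.

Variables (X : nat -> nat -> Type) (k l k' l' : nat).
Variables (G : graph X k l) (H : graph X k' l').

Let uni_src := sum_map (src G) (src H) \o @sum_swap (iedge G) (outp G) (iedge H) (outp H).
Let uni_tgt := sum_map (tgt G) (tgt H) \o @sum_swap (iedge G) (inp G) (iedge H) (inp H).
Let uni_ilab := sum_lab (ilab G) (ilab H) \o @sum_swap (inp G) (inout G) (inp H) (inout H).
Let uni_olab := sum_lab (olab G) (olab H) \o @sum_swap (outp G) (inout G) (outp H) (inout H).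
Let uni_deco (v : vert G + vert H) :=
  match v with inl v => deco G v | inr v => deco H v end.

Lemma graph_hcat_ilab_bij : bijective uni_ilab.
Proof. exact: bij_comp (sum_lab_bij (ilab_bij G) (ilab_bij H)) (@sum_swap_bij _ _ _ _). Qed.

Lemma graph_hcat_olab_bij : bijective uni_olab.
Proof. exact: bij_comp (sum_lab_bij (olab_bij G) (olab_bij H)) (@sum_swap_bij _ _ _ _). Qed.

Lemma graph_hcat_ile_order :
  fiber_order uni_tgt (relpre (@sum_swap _ _ _ _) (sum_rel (ile G) (ile H))).
Proof.
apply: fiber_order_pull; first exact: bij_inj (@sum_swap_bij _ _ _ _).
exact: sum_fiber_order (@ile_order _ _ _ G) (@ile_order _ _ _ H).
Qed.

Lemma graph_hcat_ole_order :
  fiber_order uni_src (relpre (@sum_swap _ _ _ _) (sum_rel (ole G) (ole H))).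
Proof.
apply: fiber_order_pull; first exact: bij_inj (@sum_swap_bij _ _ _ _).
exact: sum_fiber_order (@ole_order _ _ _ G) (@ole_order _ _ _ H).
Qed.

Lemma graph_hcat_arity v :
  tag (uni_deco v) = (#|[pred a | uni_tgt a == v]|, #|[pred a | uni_src a == v]|).
Proof.
rewrite !(card_fiber_comp _ _ (@sum_swap_bij _ _ _ _)) !card_fiber_sum.
by case: v => v /=; rewrite deco_arity.
Qed.

Definition graph_hcat : graph X (k + k') (l + l') := {|
  vert := (vert G + vert H)%type; iedge := (iedge G + iedge H)%type;
  inp := (inp G + inp H)%type; outp := (outp G + outp H)%type;
  inout := (inout G + inout H)%type; loop := (loop G + loop H)%type;
  src := uni_src; tgt := uni_tgt; ilab := uni_ilab; olab := uni_olab;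
  ile := relpre (@sum_swap _ _ _ _) (sum_rel (ile G) (ile H));
  ole := relpre (@sum_swap _ _ _ _) (sum_rel (ole G) (ole H));
  deco := uni_deco;
  ilab_bij := graph_hcat_ilab_bij; olab_bij := graph_hcat_olab_bij;
  ile_order := graph_hcat_ile_order; ole_order := graph_hcat_ole_order;
  deco_arity := graph_hcat_arity |}.

End DisjointUnion.

Section CutLabels.
Variables (A B : finType) (n : nat) (lab : A -> 'I_n.+1) (e : A) (h : B -> A).

Definition onto_but : Prop := injective h /\ forall a, a != e <-> exists b, h b = a.

Hypotheses (lab_bij : bijective lab) (he : onto_but).

Lemma cut_lab_neq b : lab e != lab (h b).
Proof. by rewrite eq_sym (inj_eq (bij_inj lab_bij)); apply/he.2; exists b. Qed.

Definition cut_lab (b : B) : 'I_n := relabel (cut_lab_neq b).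

Lemma cut_lab_bij : bijective cut_lab.
Proof.
apply: inj_surj_bij => [b b' /(congr1 (lift (lab e)))|i].
  by rewrite !lift_relabel => /(bij_inj lab_bij)/he.1.
have [g gK labK] := lab_bij.
have /he.2[b hb] : g (lift (lab e) i) != e.
  by rewrite -(inj_eq (bij_inj lab_bij)) labK eq_sym neq_lift.
by exists b; apply: (@lift_inj _ (lab e)); rewrite lift_relabel hb labK.
Qed.

End CutLabels.

Section Reglue.
Variables (X : nat -> nat -> Type) (k l : nat) (G : graph X k.+1 l.+1).
Variables (e : inp G + inout G) (f : outp G + inout G).
Variables (E I O IO L : finType).
Variables (end_in : E + I -> iedge G + inp G) (end_out : E + O -> iedge G + outp G).
Variables (lab_in : I + IO -> inp G + inout G) (lab_out : O + IO -> outp G + inout G).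
Hypotheses (end_in_bij : bijective end_in) (end_out_bij : bijective end_out).
Hypotheses (lab_inP : onto_but e lab_in) (lab_outP : onto_but f lab_out).

Lemma reglue_arity v : tag (deco G v) =
  (#|[pred a | tgt G (end_in a) == v]|, #|[pred a | src G (end_out a) == v]|).
Proof. by rewrite !(card_fiber_comp _ _ end_in_bij, card_fiber_comp _ _ end_out_bij) deco_arity. Qed.

(* The graph with the vertices of [G] and the edges [E], [I], [O], [IO], [L],
   in which each incoming (outgoing) edge [a] of a vertex takes over the
   position of the edge [end_in a] ([end_out a]) of [G], and each input (output)
   [a] takes over the label of the edge [lab_in a] ([lab_out a]) of [G],
   relabelled after the removal of the labels of [e] and [f]. *)
Definition reglue : graph X k l := {|
  vert := vert G; iedge := E; inp := I; outp := O; inout := IO; loop := L;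
  src := src G \o end_out; tgt := tgt G \o end_in;
  ilab := cut_lab (ilab_bij G) lab_inP; olab := cut_lab (olab_bij G) lab_outP;
  ile := relpre end_in (ile G); ole := relpre end_out (ole G);
  deco := deco G;
  ilab_bij := cut_lab_bij (ilab_bij G) lab_inP;
  olab_bij := cut_lab_bij (olab_bij G) lab_outP;
  ile_order := fiber_order_pull (bij_inj end_in_bij) (@ile_order _ _ _ G);
  ole_order := fiber_order_pull (bij_inj end_out_bij) (@ole_order _ _ _ G);
  deco_arity := reglue_arity |}.

End Reglue.

Definition but (C : finType) (c : C) : finType := {x : C | x != c}.
Definition but2 (C : finType) (c d : C) : finType := {x : C | (x != c) && (x != d)}.

(* The maps along which partial traces are reglued.  The new edge is always the
   element [None] of an option type. *)
Section TraceMaps.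
Variables A B C : finType.

Definition end_new_internal (c : C) (x : option A + but c) : A + C :=
  match x with
  | inl (Some a) => inl a | inl None => inr c | inr y => inr (val y)
  end.

Definition end_new_leg (c : C) (x : A + option (but c)) : A + C :=
  match x with
  | inl a => inl a | inr (Some y) => inr (val y) | inr None => inr c
  end.

Definition lab_del_leg (c : C) (x : but c + B) : C + B :=
  match x with inl y => inl (val y) | inr b => inr b end.

Definition lab_del_inout (b : B) (x : C + but b) : C + B :=
  match x with inl c => inl c | inr y => inr (val y) end.

Definition lab_new_leg (c : C) (b : B) (x : option (but c) + but b) : C + B :=
  match x with
  | inl (Some y) => inl (val y) | inl None => inr b | inr y => inr (val y)
  end.

Definition lab_new_inout (b b' new : B) (x : C + option (but2 b b')) : C + B :=
  match x with
  | inl c => inl c | inr (Some y) => inr (val y) | inr None => inr new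
  end.

Lemma end_new_internal_bij c : bijective (@end_new_internal c).
Proof.
apply: inj_surj_bij.
  case=> [[a|]|[a ha]] [[b|]|[b hb]] //=; try by case=> ->.
  - by case=> E; exfalso; move: (hb); rewrite E eqxx.
  - by case=> E; exfalso; move: (ha); rewrite -E eqxx.
  - by case=> E; congr inr; apply: val_inj.
case=> [a|b]; first by exists (inl (Some a)).
case: (eqVneq b c) => [->|bc]; first by exists (inl None).
by exists (inr (exist _ b bc)).
Qed.

Lemma end_new_leg_bij c : bijective (@end_new_leg c).
Proof.
apply: inj_surj_bij.
  case=> [a|[[a ha]|]] [b|[[b hb]|]] //=; try by case=> ->.
  - by case=> E; congr (inr (Some _)); apply: val_inj.
  - by case=> E; exfalso; move: (ha); rewrite E eqxx.
  - by case=> E; exfalso; move: (hb); rewrite -E eqxx.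
case=> [a|b]; first by exists (inl a).
case: (eqVneq b c) => [->|bc]; first by exists (inr None).
by exists (inr (Some (exist _ b bc))).
Qed.

Lemma lab_del_legP c : onto_but (inl c) (@lab_del_leg c).
Proof.
split.
  case=> [[a ha]|a] [[b hb]|b] //=; last by case=> ->.
  by case=> E; congr inl; apply: val_inj.
case=> [a|b]; split => //; last by exists (inr b).
  by move=> ac; exists (inl (exist _ a ac)).
by case=> -[[y hy]|y] //= [<-].
Qed.

Lemma lab_del_inoutP b : onto_but (inr b) (@lab_del_inout b).
Proof.
split.
  case=> [a|[a ha]] [b'|[b' hb']] //=; first by case=> ->.
  by case=> E; congr inr; apply: val_inj.
case=> [a|b']; split => //; first by exists (inl a).
  by move=> ac; exists (inr (exist _ b' ac)).
by case=> -[y|[y hy]] //= [<-].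
Qed.

Lemma lab_new_legP c b : onto_but (inl c) (@lab_new_leg c b).
Proof.
split.
  case=> [[[x hx]|]|[x hx]] [[[y hy]|]|[y hy]] //=.
  - by case=> E; congr (inl (Some _)); apply: val_inj.
  - by case=> E; exfalso; move: (hy); rewrite -E eqxx.
  - by case=> E; exfalso; move: (hx); rewrite E eqxx.
  - by case=> E; congr inr; apply: val_inj.
case=> [a|b']; split => //.
- by move=> ac; exists (inl (Some (exist _ a ac))).
- by case=> -[[[y hy]|]|y] //= [<-].
- case: (eqVneq b' b) => [->|bb] _; first by exists (inl None).
  by exists (inr (exist _ b' bb)).
Qed.

Lemma lab_new_inoutP b b' : b <> b' ->
  onto_but (inr b) (@lab_new_inout b b' b') /\ onto_but (inr b') (@lab_new_inout b b' b).
Proof.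
move=> /eqP bb'; split; split.
- case=> [x|[[x hx]|]] [y|[[y hy]|]] //=; try by case=> ->.
  + by case=> E; congr (inr (Some _)); apply: val_inj.
  + by case=> E; exfalso; move: (hx); rewrite E eqxx andbF.
  + by case=> E; exfalso; move: (hy); rewrite -E eqxx andbF.
- case=> [x|x]; split=> //; first by exists (inl x).
    case: (eqVneq x b') => [->|xb'] xb; first by exists (inr None).
    have xbb : (x != b) && (x != b') by rewrite xb' andbT.
    by exists (inr (Some (exist _ x xbb))).
  by case=> -[y|[[y hy]|]] //= [<-]; [case/andP: hy | rewrite eq_sym].
- case=> [x|[[x hx]|]] [y|[[y hy]|]] //=; try by case=> ->.
  + by case=> E; congr (inr (Some _)); apply: val_inj.
  + by case=> E; exfalso; move: (hx); rewrite E eqxx.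
  + by case=> E; exfalso; move: (hy); rewrite -E eqxx.
- case=> [x|x]; split=> //; first by exists (inl x).
    case: (eqVneq x b) => [->|xb] xb'; first by exists (inr None).
    have xbb : (x != b) && (x != b') by rewrite xb; apply: xb'.
    by exists (inr (Some (exist _ x xbb))).
  by case=> -[y|[[y hy]|]] //= [<-] //; case/andP: hy.
Qed.

Lemma lab_del_inoutP_eq b b' : b = b' -> onto_but (inr b') (@lab_del_inout b).
Proof. by move=> <-; apply: lab_del_inoutP. Qed.

End TraceMaps.

Section PartialTrace.
Variables (X : nat -> nat -> Type) (k l : nat) (G : graph X k.+1 l.+1).

Lemma id_bij (T : Type) : bijective (@id T).
Proof. by exists id. Qed.

(* As an incoming (outgoing) edge of a vertex, the new edge takes over the
   position of [e] ([f]); as an input (output), it takes over the label of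
   [f] ([e]). *)
Definition graph_join (e : inp G + inout G) (f : outp G + inout G) : graph X k l :=
  match e, f with
  | inl a, inl b =>
    @reglue X k l G (inl a) (inl b)
      (option (iedge G)) (but a) (but b) (inout G) (loop G)
      (@end_new_internal _ _ a) (@end_new_internal _ _ b)
      (@lab_del_leg _ _ a) (@lab_del_leg _ _ b)
      (end_new_internal_bij _ _) (end_new_internal_bij _ _)
      (lab_del_legP _ _) (lab_del_legP _ _)
  | inr a, inl b =>
    @reglue X k l G (inr a) (inl b)
      (iedge G) (inp G) (option (but b)) (but a) (loop G)
      id (@end_new_leg _ _ b)
      (@lab_del_inout _ _ a) (@lab_new_leg _ _ b a)
      (id_bij _) (end_new_leg_bij _ _)
      (lab_del_inoutP _ _) (lab_new_legP _ _)
  | inl a, inr b =>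
    @reglue X k l G (inl a) (inr b)
      (iedge G) (option (but a)) (outp G) (but b) (loop G)
      (@end_new_leg _ _ a) id
      (@lab_new_leg _ _ a b) (@lab_del_inout _ _ b)
      (end_new_leg_bij _ _) (id_bij _)
      (lab_new_legP _ _) (lab_del_inoutP _ _)
  | inr a, inr b =>
    match @eqP _ a b with
    | ReflectT ab =>
      @reglue X k l G (inr a) (inr b)
        (iedge G) (inp G) (outp G) (but a) (option (loop G))
        id id
        (@lab_del_inout _ _ a) (@lab_del_inout _ _ a)
        (id_bij _) (id_bij _)
        (lab_del_inoutP _ _) (lab_del_inoutP_eq _ ab)
    | ReflectF ab =>
      @reglue X k l G (inr a) (inr b)
        (iedge G) (inp G) (outp G) (option (but2 a b)) (loop G)
        id id
        (@lab_new_inout _ _ a b b) (@lab_new_inout _ _ a b a)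
        (id_bij _) (id_bij _)
        (lab_new_inoutP _ ab).1 (lab_new_inoutP _ ab).2
    end
  end.

Lemma ilab_codom (i : 'I_k.+1) : i \in codom (ilab G).
Proof. by have [g _ gK] := ilab_bij G; rewrite -(gK i) codom_f. Qed.

Lemma olab_codom (j : 'I_l.+1) : j \in codom (olab G).
Proof. by have [g _ gK] := olab_bij G; rewrite -(gK j) codom_f. Qed.

Definition graph_ptr (i : 'I_k.+1) (j : 'I_l.+1) : graph X k l :=
  graph_join (iinv (ilab_codom i)) (iinv (olab_codom j)).

End PartialTrace.

(** * The TRAPs of isomorphism classes of graphs *)

Definition CGr (X : nat -> nat -> Type) (k l : nat) : Type :=
  {C : graph X k l -> Prop | exists G, C = isomorphic G}.

Section Classes.
Variable X : nat -> nat -> Type.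
Implicit Types k l : nat.

Definition class_of k l (G : graph X k l) : CGr X k l :=
  exist _ (isomorphic G) (ex_intro _ G erefl).

Definition repr_of k l (C : CGr X k l) : graph X k l := sval (cid (svalP C)).

Lemma class_ofK k l (C : CGr X k l) : class_of (repr_of C) = C.
Proof.
rewrite /repr_of; case: cid => G /= CG; case: C CG => C C_class /= CG.
by apply: eq_exist.
Qed.

Lemma isomorphic_refl k l (G : graph X k l) : isomorphic G G.
Proof.
constructor; apply: (@GraphIso X k l G G id id id id id id);
  by [exact: id_bij | case | move=> [x|x] [y|y] | ].
Qed.

Lemma repr_class_of k l (G : graph X k l) : isomorphic (repr_of (class_of G)) G.
Proof.
have [E] := class_ofK (class_of G).
by rewrite E; apply: isomorphic_refl.
Qed.

(* The operations on graphs are compatible with isomorphisms, so that the choice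
   of representatives is immaterial. *)
Definition CGr_trap : trap_ops := {|
  trap_sort := CGr X;
  lact := fun k l s C => class_of (graph_lact (repr_of C) s);
  ract := fun k l C t => class_of (graph_ract (repr_of C) t);
  hcat := fun k l k' l' C C' => class_of (graph_hcat (repr_of C) (repr_of C'));
  hunit := class_of (graph_void X);
  ptr := fun k l i j C => class_of (graph_ptr (repr_of C) i j) |}.

Definition CGr_unit : CGr X 1 1 := class_of (graph_unit X).

(* Whether a graph is solar only depends on its isomorphism class. *)
Definition solar_class k l (C : CGr X k l) : bool := solar (repr_of C).

Lemma solar_iso k l (G H : graph X k l) : isomorphic G H -> solar G = solar H.
Proof. by case=> h; rewrite /solar (bij_eq_card (isoIO_bij h)) (bij_eq_card (isoL_bij h)). Qed.

Lemma solar_class_of k l (G : graph X k l) : solar_class (class_of G) = solar G.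
Proof. exact/solar_iso/repr_class_of. Qed.

Definition solCGr (k l : nat) : Type := {C : CGr X k l | solar_class C}.

Definition Sol k l (C : CGr X k l) (C_solar : solar_class C) : solCGr k l :=
  exist _ C C_solar.

Lemma solar_lact k l (s : 'S_l) (C : CGr X k l) :
  solar_class C -> solar_class (lact (t := CGr_trap) s C).
Proof. by rewrite solar_class_of. Qed.

Lemma solar_ract k l (C : CGr X k l) (t : 'S_k) :
  solar_class C -> solar_class (ract (t := CGr_trap) C t).
Proof. by rewrite solar_class_of. Qed.

Lemma solar_hcat k l k' l' (C : CGr X k l) (C' : CGr X k' l') :
  solar_class C -> solar_class C' -> solar_class (hcat (t := CGr_trap) C C').
Proof.
rewrite solar_class_of => /andP[/eqP C1 /eqP C2] /andP[/eqP C3 /eqP C4].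
by rewrite /solar /= !card_sum C1 C2 C3 C4.
Qed.

Lemma solar_hunit : solar_class (hunit CGr_trap).
Proof. by rewrite solar_class_of /solar /= card_void. Qed.

Lemma solar_join k l (G : graph X k.+1 l.+1) e f : solar G -> solar (graph_join (G := G) e f).
Proof.
move=> solG; have io0 (a : inout G) : False.
  by case/andP: solG => /eqP/card0_eq/(_ a).
by case: e f => [a|a] [b|b] //=; case: (io0).
Qed.

Lemma solar_ptr k l (i : 'I_k.+1) (j : 'I_l.+1) (C : CGr X k.+1 l.+1) :
  solar_class C -> solar_class (ptr (t := CGr_trap) i j C).
Proof. by rewrite solar_class_of => /solar_join; apply. Qed.

Definition solCGr_trap : trap_ops := {|
  trap_sort := solCGr;
  lact := fun k l s C => Sol (solar_lact s (svalP C));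
  ract := fun k l C t => Sol (solar_ract t (svalP C));
  hcat := fun k l k' l' C C' => Sol (solar_hcat (svalP C) (svalP C'));
  hunit := Sol solar_hunit;
  ptr := fun k l i j C => Sol (solar_ptr i j (svalP C)) |}.

Lemma solar_corolla k l (x : X k l) : solar_class (class_of (corolla x)).
Proof. by rewrite solar_class_of /solar /= card_void. Qed.

Definition CGr_gen k l (x : X k l) : CGr X k l := class_of (corolla x).

Definition sol_gen k l (x : X k l) : solCGr k l := Sol (solar_corolla x).

End Classes.

(* Main.v *)
From HB Require Import structures.
From mathcomp Require Import all_boot all_fingroup.
From mathcomp Require Import boolp zify.
Require Import Defs.

(** The free TRAP.

    Up to numbering, a solar graph is obtained by putting the corollas of its
    vertices side by side and closing, for each internal edge, an output onto an
    input; a general graph also needs one unit for each input-output edge, and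
    one unit closed onto itself for each loop.  So graphs are generated by
    corollas and the unit ([stable_all]), and a morphism is determined by its
    values on them.  This is proved by cutting an edge, and by observing that a
    graph without internal edges is known, up to numbering, from its decorated
    vertices and its numbers of wires and loops ([edgeless_tpt]), because the
    flags at a vertex are totally ordered.

    Conversely, the values of the vertices have to be assembled in a way that
    depends neither on an order of the vertices nor on an order of the edges.
    Numberings are the obstacle; they are replaced by labels.  An element of
    [lab P C D] is an element of the TRAP [P] with inputs labelled in [C] and
    outputs labelled in [D], up to renumbering.  On such elements concatenation
    is associative and commutative, so that the product over all vertices is a
    big operator, and the traces [tr c d], which close the output labelled [d]
    onto the input labelled [c], commute ([tr_tr]) and only concern the factor
    in which the labels occur ([tr_mul]).  The value of a graph is the product of
    the values of its vertices, units and loops, traced along all its internal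
    edges ([evals]).  Isomorphisms, permutations and disjoint unions act on this
    expression by renaming labels and reindexing.  A partial trace of the graph
    adds one trace to the expression: either it is the trace along a new edge, or
    the unit axioms simplify it ([tr_wire_out], [tr_wire_in]).

    That graphs themselves form a unitary TRAP is checked on their strands.  A
    graph is a matching of the start points with the end points of its strands,
    and closing an output [j] onto an input [i] redirects to [i] the strand that
    ended at [j] ([wptr]).  The axioms about partial traces become identities
    between booleans.

    A unitary morphism extending a given morphism on solar graphs has
    prescribed values on corollas and on the unit, hence is unique; it exists
    because the restriction to solar graphs of the morphism given by [evals] has
    the right values on corollas. *)

Set Implicit Arguments.
Unset Strict Implicit.
Unset Printing Implicit Defensive.

(** * Bijections *)

(** Bundled with its proof, so that a transport along a bijection depends on its
    graph only ([bij_ext]). *)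
Record bij (A B : Type) := Bij { bij_fun :> A -> B; bijP : bijective bij_fun }.

Lemma bij_ext A B (f g : bij A B) : f =1 g -> f = g.
Proof.
case: f g => f f_bij [g g_bij] /= /funext fg; subst g.
by congr Bij; apply: Prop_irrelevance.
Qed.

Definition bid A : bij A A := Bij (id_bij A).

Definition bcomp A B C (g : bij B C) (f : bij A B) : bij A C :=
  Bij (bij_comp (bijP g) (bijP f)).

Lemma binv_subproof A B (f : bij A B) : exists g : B -> A, cancel f g /\ cancel g f.
Proof. by have [g gK fK] := bijP f; exists g. Qed.

Definition binv_fun A B (f : bij A B) : B -> A := sval (cid (binv_subproof f)).

Lemma bijK A B (f : bij A B) : cancel f (binv_fun f).
Proof. by rewrite /binv_fun; case: cid => g []. Qed.

Lemma bijVK A B (f : bij A B) : cancel (binv_fun f) f.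
Proof. by rewrite /binv_fun; case: cid => g []. Qed.

Definition binv A B (f : bij A B) : bij B A := Bij (Bijective (bijVK f) (bijK f)).

Lemma bij_injective A B (f : bij A B) : injective f.
Proof. exact: bij_inj (bijP f). Qed.

Lemma bij_eq (A B : eqType) (f : bij A B) a b : (f a == f b) = (a == b).
Proof. exact: inj_eq (@bij_injective _ _ f) a b. Qed.

Lemma bij_ord k k' (f : bij 'I_k 'I_k') : k = k'.
Proof. by have := bij_eq_card (bijP f); rewrite !card_ord. Qed.

Definition bcast k k' (e : k = k') : bij 'I_k 'I_k' :=
  Bij (Bijective (cast_ordK e) (cast_ordKV e)).

Definition bperm_of k (s : 'S_k) : bij 'I_k 'I_k := Bij (injF_bij (@perm_inj _ s)).

Definition bperm k (f : bij 'I_k 'I_k) : 'S_k := perm (@bij_injective _ _ f).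

Lemma bpermE k (f : bij 'I_k 'I_k) i : bperm f i = f i.
Proof. by rewrite permE. Qed.

Lemma bperm1 k : bperm (bid 'I_k) = 1%g.
Proof. by apply/permP => i; rewrite bpermE perm1. Qed.

Lemma bperm_comp k (f g : bij 'I_k 'I_k) : bperm (bcomp g f) = (bperm f * bperm g)%g.
Proof. by apply/permP => i; rewrite permM !bpermE. Qed.

Lemma bdel_neq k k' (f : bij 'I_k.+1 'I_k'.+1) i m : f i != f (lift i m).
Proof. by rewrite bij_eq neq_lift. Qed.

(** The counterpart of [pdel] for bijections: [i] is removed from the source and
    [f i] from the target. *)
Definition bdel_fun k k' (f : bij 'I_k.+1 'I_k'.+1) i (m : 'I_k) : 'I_k' :=
  relabel (bdel_neq f i m).

Lemma lift_bdel k k' (f : bij 'I_k.+1 'I_k'.+1) i m :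
  lift (f i) (bdel_fun f i m) = f (lift i m).
Proof. exact: lift_relabel. Qed.

Lemma bdel_bij k k' (f : bij 'I_k.+1 'I_k'.+1) i : bijective (bdel_fun f i).
Proof.
have [ek] := bij_ord f; subst k'; apply: injF_bij => m m' E.
by apply: (@lift_inj _ i); apply: (@bij_injective _ _ f); rewrite -!lift_bdel E.
Qed.

Definition bdel k k' (f : bij 'I_k.+1 'I_k'.+1) i : bij 'I_k 'I_k' := Bij (bdel_bij f i).

Definition ujoin A m n (u : 'I_m -> A) (u' : 'I_n -> A) (i : 'I_(m + n)) : A :=
  match split i with inl a => u a | inr b => u' b end.

Lemma ujoinl A m n (u : 'I_m -> A) (u' : 'I_n -> A) i : ujoin u u' (lshift n i) = u i.
Proof. by rewrite /ujoin (unsplitK (inl _)). Qed.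

Lemma ujoinr A m n (u : 'I_m -> A) (u' : 'I_n -> A) i : ujoin u u' (rshift m i) = u' i.
Proof. by rewrite /ujoin (unsplitK (inr _)). Qed.

Lemma ord_sumP m n (Q : 'I_(m + n) -> Prop) :
  (forall i, Q (lshift n i)) -> (forall i, Q (rshift m i)) -> forall i, Q i.
Proof.
move=> Ql Qr i; rewrite -(splitK i); case: (split i) => a; [exact: Ql | exact: Qr].
Qed.

Definition bsum_fun m n m' n' (f : bij 'I_m 'I_m') (g : bij 'I_n 'I_n') :
    'I_(m + n) -> 'I_(m' + n') :=
  ujoin (@lshift m' n' \o f) (@rshift m' n' \o g).

Lemma bsum_bij m n m' n' (f : bij 'I_m 'I_m') (g : bij 'I_n 'I_n') :
  bijective (bsum_fun f g).
Proof.
exists (bsum_fun (binv f) (binv g)); apply: ord_sumP => i;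
  by rewrite /bsum_fun ?ujoinl ?ujoinr /= ?ujoinl ?ujoinr /= ?bijK ?bijVK.
Qed.

Definition bsum m n m' n' (f : bij 'I_m 'I_m') (g : bij 'I_n 'I_n') :=
  Bij (bsum_bij f g).

(** The block permutation [pswap], with the target that needs no cast. *)
Definition bswap_fun m n : 'I_(m + n) -> 'I_(n + m) := ujoin (@rshift n m) (@lshift n m).

Lemma bswap_bij m n : bijective (@bswap_fun m n).
Proof.
exists (@bswap_fun n m); apply: ord_sumP => i;
  by rewrite /bswap_fun ?ujoinl ?ujoinr ?ujoinl ?ujoinr.
Qed.

Definition bswap m n := Bij (@bswap_bij m n).

Lemma bhead k (i : 'I_k.+1) : exists f : bij 'I_k.+1 'I_k.+1, f ord0 = i.
Proof. by exists (bperm_of (tperm ord0 i)); rewrite /= tpermL. Qed.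

Lemma ptensorV m n (s : 'S_m) (t : 'S_n) : (ptensor s t)^-1%g = ptensor s^-1 t^-1.
Proof.
apply/eqP; rewrite eq_invg_mul; apply/eqP/permP.
by apply: ord_sumP => i; rewrite permM perm1 !permE /ptensor_fun
  ?(unsplitK (inl _)) ?(unsplitK (inr _)) ?permK.
Qed.

Lemma sum_map_bij A A' B B' (f : A -> A') (g : B -> B') :
  bijective f -> bijective g -> bijective (sum_map f g).
Proof.
move=> [f' fK f'K] [g' gK g'K]; exists (sum_map f' g') => -[a|b] /=;
  by rewrite ?fK ?gK ?f'K ?g'K.
Qed.

Definition bsum_map A A' B B' (f : bij A A') (g : bij B B') : bij (A + B) (A' + B') :=
  Bij (sum_map_bij (bijP f) (bijP g)).

(** * Transport along renumberings of inputs and outputs *)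

Section Transport.
Variables (P : trap_ops).
Implicit Types k l : nat.

Lemma castP_id (Q : nat -> nat -> Type) k l (ek : k = k) (el : l = l) (p : Q k l) :
  castP ek el p = p.
Proof. by rewrite (eq_axiomK ek) (eq_axiomK el). Qed.

(** The actions of the symmetric groups, extended to the groupoid of bijections
    between ordinals.  As [cast_ord] is one of these, the casts in the axioms are
    transports like the others. *)
Definition tpt k k' l l' (f : bij 'I_k 'I_k') (g : bij 'I_l 'I_l') (p : P k l) : P k' l' :=
  castP (bij_ord f) (bij_ord g)
    (lact (bperm (bcomp (bcast (esym (bij_ord g))) g))
       (ract p (bperm (bcomp (bcast (esym (bij_ord f))) f))^-1%g)).

Lemma tptE k l (f : bij 'I_k 'I_k) (g : bij 'I_l 'I_l) (p : P k l) :
  tpt f g p = lact (bperm g) (ract p (bperm f)^-1%g).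
Proof.
rewrite /tpt castP_id; congr (lact _ (ract _ _^-1%g)).
  by apply/permP => i; rewrite !bpermE /=; apply: val_inj.
by apply/permP => i; rewrite !bpermE /=; apply: val_inj.
Qed.

Hypothesis HP : is_trap P.

Lemma tpt_id k l (f : bij 'I_k 'I_k) (g : bij 'I_l 'I_l) (p : P k l) :
  f =1 id -> g =1 id -> tpt f g p = p.
Proof.
move=> f1 g1; have -> : f = bid _ by exact: bij_ext.
have -> : g = bid _ by exact: bij_ext.
by rewrite tptE !bperm1 invg1 (ract1 HP) (lact1 HP).
Qed.

Lemma tpt_cast k k' l l' (ek : k = k') (el : l = l') (p : P k l) :
  castP ek el p = tpt (bcast ek) (bcast el) p.
Proof. by subst k' l'; rewrite tpt_id //= => i; apply: val_inj. Qed.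

Lemma tpt_comp k k' k'' l l' l'' (f : bij 'I_k 'I_k') (g : bij 'I_l 'I_l')
    (f' : bij 'I_k' 'I_k'') (g' : bij 'I_l' 'I_l'') (p : P k l) :
  tpt f' g' (tpt f g p) = tpt (bcomp f' f) (bcomp g' g) p.
Proof.
have ek := bij_ord f; have ek' := bij_ord f'; have el := bij_ord g.
have el' := bij_ord g'; subst k' k'' l' l''.
rewrite !tptE -(lract HP) (lactM HP) (ractM HP) !bperm_comp invMg.
by rewrite (lract HP).
Qed.

Lemma tpt_lact k l (s : 'S_l) (p : P k l) : lact s p = tpt (bid _) (bperm_of s) p.
Proof.
rewrite tptE bperm1 invg1 (ract1 HP); congr lact.
by apply/permP => i; rewrite bpermE.
Qed.

Lemma tpt_ract k l (t : 'S_k) (p : P k l) : ract p t = tpt (bperm_of t^-1) (bid _) p.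
Proof.
rewrite tptE bperm1 (lact1 HP); congr ract.
apply: (@invg_inj _ _ _); rewrite invgK.
by apply/permP => i; rewrite bpermE.
Qed.

Lemma tpt_hcat k k' l l' m m' n n' (f : bij 'I_k 'I_k') (g : bij 'I_l 'I_l')
    (f' : bij 'I_m 'I_m') (g' : bij 'I_n 'I_n') (p : P k l) (q : P m n) :
  hcat (tpt f g p) (tpt f' g' q) = tpt (bsum f f') (bsum g g') (hcat p q).
Proof.
have ek := bij_ord f; have ek' := bij_ord f'; have el := bij_ord g.
have el' := bij_ord g'; subst k' m' l' n'.
have tens a b (h : bij 'I_a 'I_a) (h' : bij 'I_b 'I_b) :
    bperm (bsum h h') = ptensor (bperm h) (bperm h').
  apply/permP; apply: ord_sumP => i; rewrite bpermE permE /= /bsum_fun /ptensor_fun.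
    by rewrite ujoinl (unsplitK (inl _)) bpermE.
  by rewrite ujoinr (unsplitK (inr _)) bpermE.
by rewrite !tptE (hcat_act HP) !tens ptensorV.
Qed.

Lemma tpt_hcatC k l k' l' (p : P k l) (q : P k' l') :
  tpt (bswap k k') (bswap l l') (hcat p q) = hcat q p.
Proof.
have bswapE m n : bcomp (bcast (addnC n m)) (bswap m n) = bperm_of (pswap m n).
  apply: bij_ext => i; apply: val_inj; move: i; rewrite /bswap /bswap_fun /=.
  by apply: ord_sumP => i; rewrite permE /pswap_fun ?ujoinl ?ujoinr /=
    ?(unsplitK (inl _)) ?(unsplitK (inr _)).
apply: (can_inj (g := tpt (bcast (addnC k k')) (bcast (addnC l l')))
  (f := tpt (bcast (addnC k' k)) (bcast (addnC l' l)))).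
  by move=> x; rewrite tpt_comp tpt_id // => i; apply: val_inj.
have := congr1 (fun x => ract x (pswap k k')^-1%g) (hcatC HP p q).
rewrite (ractM HP) /pcomp mulVg (ract1 HP) (tpt_cast) => <-.
rewrite -(lract HP) (tpt_ract) tpt_lact !tpt_comp; congr (tpt _ _ _).
  rewrite bswapE; apply: bij_ext => i /=; by rewrite invgK.
by rewrite bswapE; apply: bij_ext.
Qed.

Lemma tpt_hcatA k l k' l' k'' l'' (p : P k l) (q : P k' l') (r : P k'' l'') :
  tpt (bcast (addnA k k' k'')) (bcast (addnA l l' l'')) (hcat p (hcat q r)) =
  hcat (hcat p q) r.
Proof. by rewrite -tpt_cast (hcatA HP). Qed.

(** Read at the images of the traced positions, [ptr_act] no longer involves
    inverses: a renumbering moves the traced pair along. *)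
Lemma tpt_ptr k k' l l' (f : bij 'I_k.+1 'I_k'.+1) (g : bij 'I_l.+1 'I_l'.+1)
    (p : P k.+1 l.+1) i j :
  ptr (f i) (g j) (tpt f g p) = tpt (bdel f i) (bdel g j) (ptr i j p).
Proof.
have [ek] := bij_ord f; have [el] := bij_ord g; subst k' l'.
rewrite !tptE (ptr_act HP).
have -> : (bperm f)^-1%g (f i) = i by rewrite -(bpermE f i) permK.
have -> : (bperm g)^-1%g (g j) = j by rewrite -(bpermE g j) permK.
congr (lact _ (ract _ _)).
  apply/permP => m; rewrite bpermE permE /=; apply: (@lift_inj _ (g j)).
  rewrite lift_bdel lift_relabel bpermE; congr (g (lift _ _)).
  by rewrite -(bpermE g j) permK.
apply: (@invg_inj _ _ _); rewrite invgK; apply/permP => m; rewrite bpermE /=.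
apply: (canLR (f := pdel (bperm f)^-1%g i)); first exact: permK.
rewrite permE; apply: (@lift_inj _ i); rewrite lift_relabel.
by rewrite invgK bpermE lift_bdel -bpermE permK.
Qed.

End Transport.

(** * Elements with labelled inputs and outputs *)

(** The axioms are bundled because the monoid structure of [lab] depends on them
    and has to be inferred from the carrier alone. *)
Record trap := Trap { trap_struct :> trap_ops; trapP : is_trap trap_struct }.

Section Labelled.
Variables (P : trap).

(** Labels may be repeated: concatenation is then defined without disjointness
    conditions, and the uniqueness of labels is only required for traces. *)
Record lelt (C D : Type) := Lelt {
  lin : nat; lout : nat; lbody : P lin lout; lelt_in : 'I_lin -> C; lelt_out : 'I_lout -> D }.

Arguments lelt_in {C D} l _ : rename.
Arguments lelt_out {C D} l _ : rename.

Definition lequiv C D (x y : lelt C D) : Prop :=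
  exists (f : bij 'I_(lin x) 'I_(lin y)) (g : bij 'I_(lout x) 'I_(lout y)),
    [/\ lelt_in y \o f =1 lelt_in x, lelt_out y \o g =1 lelt_out x & lbody y = tpt f g (lbody x)].

Definition lab (C D : Type) : Type := {Q : lelt C D -> Prop | exists x, Q = lequiv x}.

Definition lclass C D (x : lelt C D) : lab C D :=
  exist _ (lequiv x) (ex_intro _ x erefl).

Definition mk C D k l (p : P k l) (u : 'I_k -> C) (w : 'I_l -> D) : lab C D :=
  lclass (Lelt p u w).

Section OneLabelType.
Variables (C D : Type).
Implicit Types (x y z : lab C D) (c : C) (d : D).

Lemma lequiv_refl (a : lelt C D) : lequiv a a.
Proof. by exists (bid _), (bid _); split; rewrite ?(tpt_id (trapP P)). Qed.

Lemma lequiv_sym (a b : lelt C D) : lequiv a b -> lequiv b a.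
Proof.
move=> [f [g [fu gw E]]]; exists (binv f), (binv g); split=> [i|i|] /=.
- by rewrite -fu /= bijVK.
- by rewrite -gw /= bijVK.
- by rewrite E (tpt_comp (trapP P)) (tpt_id (trapP P)) // => i /=; rewrite bijK.
Qed.

Lemma lequiv_trans (a b c : lelt C D) : lequiv a b -> lequiv b c -> lequiv a c.
Proof.
move=> [f [g [fu gw E]]] [f' [g' [fu' gw' E']]].
exists (bcomp f' f), (bcomp g' g); split=> [i|i|] /=.
- by rewrite -fu /= -fu'.
- by rewrite -gw /= -gw'.
- by rewrite E' E (tpt_comp (trapP P)).
Qed.

Lemma lclassE (a b : lelt C D) : lclass a = lclass b <-> lequiv a b.
Proof.
split=> [E|ab].
  have := congr1 (fun Q : lab C D => sval Q b) E => /= ->; exact: lequiv_refl.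
apply: eq_exist; apply: funext => c; apply: propext; split; apply: lequiv_trans => //.
exact: lequiv_sym.
Qed.

Lemma lab_lelt x : exists a, x = lclass a.
Proof.
case: x => Q Q_class; case: (Q_class) => a Qa; exists a.
by apply: eq_exist.
Qed.

Lemma mkE k l (p : P k l) u w k' l' (p' : P k' l') (u' : 'I_k' -> C) (w' : 'I_l' -> D) :
  mk p u w = mk p' u' w' <->
  exists (f : bij 'I_k 'I_k') (g : bij 'I_l 'I_l'),
    [/\ u' \o f =1 u, w' \o g =1 w & p' = tpt f g p].
Proof. exact: lclassE. Qed.

Lemma mkP x : exists k l (p : P k l) u w, x = mk p u w.
Proof. by have [[k l p u w] ->] := lab_lelt x; exists k, l, p, u, w. Qed.

Lemma mk_tpt k l k' l' (f : bij 'I_k 'I_k') (g : bij 'I_l 'I_l') (p : P k l)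
    (u : 'I_k' -> C) (w : 'I_l' -> D) :
  mk (tpt f g p) u w = mk p (u \o f) (w \o g).
Proof. by apply/esym/mkE; exists f, g. Qed.

Lemma mk_ext k l (p : P k l) (u u' : 'I_k -> C) (w w' : 'I_l -> D) :
  u =1 u' -> w =1 w' -> mk p u w = mk p u' w'.
Proof. by move=> /funext -> /funext ->. Qed.

Lemma mk_renumber k l k' l' (f : bij 'I_k' 'I_k) (g : bij 'I_l' 'I_l) (p : P k l)
    (u : 'I_k -> C) (w : 'I_l -> D) :
  mk p u w = mk (tpt (binv f) (binv g) p) (u \o f) (w \o g).
Proof. by rewrite mk_tpt; apply: mk_ext => i /=; rewrite bijVK. Qed.

(** When the labels are pairwise distinct, no renumbering but the identity
    preserves them, and the class determines its element. *)
Lemma mk_inj k l (p p' : P k l) (u : 'I_k -> C) (w : 'I_l -> D) :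
  injective u -> injective w -> mk p u w = mk p' u w -> p = p'.
Proof.
move=> u_inj w_inj /mkE [f [g [fu gw ->]]].
by rewrite (tpt_id (trapP P)) // => i; [apply: u_inj; apply: fu | apply: w_inj; apply: gw].
Qed.

Definition repr x : lelt C D := sval (cid (lab_lelt x)).

Lemma reprK x : lclass (repr x) = x.
Proof. by rewrite /repr; case: cid. Qed.

Lemma mk_repr x : mk (lbody (repr x)) (lelt_in (repr x)) (lelt_out (repr x)) = x.
Proof. by rewrite -[RHS]reprK /mk; case: (repr x). Qed.

(** Concatenation makes the labelled elements a commutative monoid, since the
    block permutations relating the two orders of concatenation are
    renumberings. *)
Definition mul x y : lab C D :=
  let a := repr x in let b := repr y in
  mk (hcat (lbody a) (lbody b)) (ujoin (lelt_in a) (lelt_in b)) (ujoin (lelt_out a) (lelt_out b)).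

Definition nolab A (i : 'I_0) : A := match notF (ltn_ord i) with end.

Definition scal (p : P 0 0) : lab C D := mk p (@nolab C) (@nolab D).

Definition one : lab C D := scal (hunit P).

Lemma ujoin_bsum A m n m' n' (f : bij 'I_m 'I_m') (g : bij 'I_n 'I_n')
    (u : 'I_m' -> A) (v : 'I_n' -> A) :
  ujoin u v \o bsum f g =1 ujoin (u \o f) (v \o g).
Proof. by apply: ord_sumP => i /=; rewrite /bsum_fun ?ujoinl ?ujoinr /= ?ujoinl ?ujoinr. Qed.

Lemma eq_ujoin A m n (u u' : 'I_m -> A) (v v' : 'I_n -> A) :
  u =1 u' -> v =1 v' -> ujoin u v =1 ujoin u' v'.
Proof. by move=> uu vv; apply: ord_sumP => i; rewrite ?ujoinl ?ujoinr. Qed.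

Lemma mul_mk k l (p : P k l) u w k' l' (p' : P k' l') u' w' :
  mul (mk p u w) (mk p' u' w') = mk (hcat p p') (ujoin u u') (ujoin w w').
Proof.
have /esym/mkE[f [g [fu gw E]]] := mk_repr (mk p u w).
have /esym/mkE[f' [g' [fu' gw' E']]] := mk_repr (mk p' u' w').
rewrite /mul E E' (tpt_hcat (trapP P)) mk_tpt; apply: mk_ext => i.
  by rewrite ujoin_bsum; apply: eq_ujoin => m; rewrite -?fu -?fu'.
by rewrite ujoin_bsum; apply: eq_ujoin => m; rewrite -?gw -?gw'.
Qed.

Lemma mulC : commutative mul.
Proof.
move=> x y; have [k [l [p [u [w ->]]]]] := mkP x; have [k' [l' [p' [u' [w' ->]]]]] := mkP y.
rewrite !mul_mk -(tpt_hcatC (trapP P) p p') mk_tpt.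
by apply: mk_ext; apply: ord_sumP => i /=; rewrite /bswap_fun ?ujoinl ?ujoinr ?ujoinl ?ujoinr.
Qed.

Lemma ujoinA A m n r (u : 'I_m -> A) (v : 'I_n -> A) (t : 'I_r -> A) :
  ujoin (ujoin u v) t \o bcast (addnA m n r) =1 ujoin u (ujoin v t).
Proof.
apply: ord_sumP => [i|]; last apply: ord_sumP => i.
- rewrite ujoinl /= (_ : cast_ord _ _ = lshift r (lshift n i)) ?ujoinl //.
  exact: val_inj.
- rewrite ujoinr ujoinl /= (_ : cast_ord _ _ = lshift r (rshift m i)) ?ujoinl ?ujoinr //.
  exact: val_inj.
- rewrite ujoinr ujoinr /= (_ : cast_ord _ _ = rshift (m + n) i) ?ujoinr //.
  by apply: val_inj; rewrite /= addnA.
Qed.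

Lemma mulA : associative mul.
Proof.
move=> x y z; have [k [l [p [u [w ->]]]]] := mkP x.
have [k' [l' [p' [u' [w' ->]]]]] := mkP y; have [k'' [l'' [q [v [t ->]]]]] := mkP z.
rewrite !mul_mk -(tpt_hcatA (trapP P)) mk_tpt.
by apply: mk_ext => i; rewrite ujoinA.
Qed.

Lemma mul1 : left_id one mul.
Proof.
move=> x; have [k [l [p [u [w ->]]]]] := mkP x; rewrite mul_mk (hcat0p (trapP P)).
by apply: mk_ext; apply: ord_sumP => [[]//|i]; rewrite ujoinr; congr (_ _); apply: val_inj.
Qed.

Lemma mulCA : left_commutative mul.
Proof. by move=> x y z; rewrite !mulA (mulC x). Qed.

HB.instance Definition _ := Monoid.isComLaw.Build (lab C D) one mul mulA mulC mul1.

End OneLabelType.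

Section Push.
Variables (C D C' D' : Type) (h : C -> C') (h' : D -> D').

Definition push (x : lab C D) : lab C' D' :=
  let a := repr x in mk (lbody a) (h \o lelt_in a) (h' \o lelt_out a).

Lemma push_mk k l (p : P k l) u w : push (mk p u w) = mk p (h \o u) (h' \o w).
Proof.
have /mkE[f [g [fu gw E]]] := mk_repr (mk p u w).
by rewrite /push [in RHS]E mk_tpt; apply: mk_ext => i /=; rewrite -?fu -?gw.
Qed.

Lemma push_scal p : push (scal C D p) = scal C' D' p.
Proof. by rewrite push_mk; apply: mk_ext => - []. Qed.

Lemma push_one : push (one C D) = one C' D'.
Proof. exact: push_scal. Qed.

Lemma push_mul : {morph push : x y / mul x y >-> mul x y}.
Proof.
move=> x y; have [k [l [p [u [w ->]]]]] := mkP x; have [k' [l' [p' [u' [w' ->]]]]] := mkP y.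
rewrite mul_mk !push_mk mul_mk; apply: mk_ext => i /=; rewrite /ujoin; by case: split.
Qed.

Lemma push_big (I : Type) (r : seq I) (Q : pred I) (F : I -> lab C D) :
  push (\big[@mul C D/one C D]_(i <- r | Q i) F i) =
  \big[@mul C' D'/one C' D']_(i <- r | Q i) push (F i).
Proof. exact: (big_morph push push_mul push_one). Qed.

Lemma push_inj : injective h -> injective h' -> injective push.
Proof.
move=> h_inj h'_inj x y.
have [k [l [p [u [w ->]]]]] := mkP x; have [k' [l' [p' [u' [w' ->]]]]] := mkP y.
rewrite !push_mk => /mkE[f [g [fu gw E]]]; apply/mkE; exists f, g; split=> // i.
- by apply: h_inj; apply: fu.
- by apply: h'_inj; apply: gw.
Qed.

End Push.

Section Count.
Variables (C D : eqType).
Implicit Types (x y : lab C D) (c : C) (d : D).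

Definition in_count x c : nat := #|[pred i | lelt_in (repr x) i == c]|.
Definition out_count x d : nat := #|[pred i | lelt_out (repr x) i == d]|.

Lemma card_preim_bij (A B : finType) (f : bij A B) (Q : pred B) :
  #|[pred a | Q (f a)]| = #|Q|.
Proof. by rewrite -!sum1_card [RHS](reindex f) //; apply: onW_bij; apply: bijP. Qed.

Lemma in_count_mk k l (p : P k l) u w c : in_count (mk p u w) c = #|[pred i | u i == c]|.
Proof.
have /mkE[f [g [fu gw E]]] := mk_repr (mk p u w).
rewrite /in_count -(card_preim_bij f); apply: eq_card => i.
by rewrite !inE -fu.
Qed.

Lemma out_count_mk k l (p : P k l) u w d : out_count (mk p u w) d = #|[pred i | w i == d]|.
Proof.
have /mkE[f [g [fu gw E]]] := mk_repr (mk p u w).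
rewrite /out_count -(card_preim_bij g); apply: eq_card => i.
by rewrite !inE -gw.
Qed.

Lemma card_ujoin (A : eqType) m n (u : 'I_m -> A) (v : 'I_n -> A) a :
  #|[pred i | ujoin u v i == a]| = #|[pred i | u i == a]| + #|[pred i | v i == a]|.
Proof.
rewrite -!sum1_card big_split_ord /=.
by congr (_ + _); apply: eq_bigl => i; rewrite !inE ?ujoinl ?ujoinr.
Qed.

Lemma in_count_mul x y c : in_count (mul x y) c = in_count x c + in_count y c.
Proof.
have [k [l [p [u [w ->]]]]] := mkP x; have [k' [l' [p' [u' [w' ->]]]]] := mkP y.
by rewrite mul_mk !in_count_mk card_ujoin.
Qed.

Lemma out_count_mul x y d : out_count (mul x y) d = out_count x d + out_count y d.
Proof.
have [k [l [p [u [w ->]]]]] := mkP x; have [k' [l' [p' [u' [w' ->]]]]] := mkP y.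
by rewrite mul_mk !out_count_mk card_ujoin.
Qed.

Lemma in_count_scal p c : in_count (scal C D p) c = 0.
Proof. by rewrite in_count_mk; apply: eq_card0 => - []. Qed.

Lemma out_count_scal p d : out_count (scal C D p) d = 0.
Proof. by rewrite out_count_mk; apply: eq_card0 => - []. Qed.

Lemma in_count_big (I : Type) (r : seq I) (Q : pred I) (F : I -> lab C D) c :
  in_count (\big[@mul C D/one C D]_(i <- r | Q i) F i) c = \sum_(i <- r | Q i) in_count (F i) c.
Proof. exact: (big_morph (in_count^~ c) (fun x y => in_count_mul x y c) (in_count_scal _ c)). Qed.

Lemma out_count_big (I : Type) (r : seq I) (Q : pred I) (F : I -> lab C D) d :
  out_count (\big[@mul C D/one C D]_(i <- r | Q i) F i) d = \sum_(i <- r | Q i) out_count (F i) d.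
Proof. exact: (big_morph (out_count^~ d) (fun x y => out_count_mul x y d) (out_count_scal _ d)). Qed.

End Count.

Lemma in_count_push (C D C' D' : eqType) (h : C -> C') (h' : D -> D') (x : lab C D) c :
  injective h -> in_count (push h h' x) (h c) = in_count x c.
Proof.
move=> h_inj; have [k [l [p [u [w ->]]]]] := mkP x; rewrite push_mk !in_count_mk.
by apply: eq_card => i; rewrite !inE /= inj_eq.
Qed.

Lemma out_count_push (C D C' D' : eqType) (h : C -> C') (h' : D -> D') (x : lab C D) d :
  injective h' -> out_count (push h h' x) (h' d) = out_count x d.
Proof.
move=> h_inj; have [k [l [p [u [w ->]]]]] := mkP x; rewrite push_mk !out_count_mk.
by apply: eq_card => i; rewrite !inE /= inj_eq.
Qed.

Lemma in_count_push0 (C D C' D' : eqType) (h : C -> C') (h' : D -> D') (x : lab C D) c :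
  (forall a, h a != c) -> in_count (push h h' x) c = 0.
Proof.
move=> hc; have [k [l [p [u [w ->]]]]] := mkP x; rewrite push_mk !in_count_mk.
by apply: eq_card0 => i; rewrite !inE /= (negbTE (hc _)).
Qed.

Lemma out_count_push0 (C D C' D' : eqType) (h : C -> C') (h' : D -> D') (x : lab C D) d :
  (forall a, h' a != d) -> out_count (push h h' x) d = 0.
Proof.
move=> hd; have [k [l [p [u [w ->]]]]] := mkP x; rewrite push_mk !out_count_mk.
by apply: eq_card0 => i; rewrite !inE /= (negbTE (hd _)).
Qed.

Section Trace.
Variables (C D : eqType).
Implicit Types (x y : lab C D) (c : C) (d : D).

Lemma card_lift (A : eqType) n (u : 'I_n.+1 -> A) i a :
  #|[pred m | u m == a]| = (u i == a) + #|[pred m | u (lift i m) == a]|.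
Proof.
rewrite -!sum1_card !big_mkcond /= (bigD1_ord i) //=.
by congr (_ + _); rewrite -big_mkcond; apply: eq_bigl => m; rewrite !inE.
Qed.

Lemma count0_neq (A : eqType) k (u : 'I_k -> A) a m :
  #|[pred i | u i == a]| = 0 -> u m != a.
Proof. by move=> /card0_eq/(_ m); rewrite inE => ->. Qed.

Lemma ord_of_count (A : eqType) k (u : 'I_k -> A) a :
  #|[pred i | u i == a]| = 1 -> exists k' (f : bij 'I_k'.+1 'I_k), u (f ord0) = a.
Proof.
move=> u1; have /card_gt0P[i] : 0 < #|[pred i | u i == a]| by rewrite u1.
rewrite inE => /eqP ui; case: k => [|k] in u u1 i ui *; first by case: i ui.
by have [f fi] := bhead i; exists k, f; rewrite fi.
Qed.

(** Positions being immaterial, labels occurring once may be assumed to come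
    first. *)
Lemma lab_head x c d : in_count x c = 1 -> out_count x d = 1 ->
  exists k l (p : P k.+1 l.+1) u w, [/\ x = mk p u w, u ord0 = c & w ord0 = d].
Proof.
have [k [l [p [u [w ->]]]]] := mkP x; rewrite in_count_mk out_count_mk.
move=> /ord_of_count[k' [f uc]] /ord_of_count[l' [g wd]].
by exists k', l', (tpt (binv f) (binv g) p), (u \o f), (w \o g); rewrite -mk_renumber.
Qed.

(** Tracing the input labelled [c] with the output labelled [d]; [tr] returns
    its argument when one of the labels does not occur exactly once. *)
Definition traces c d x y : Prop :=
  exists k l (p : P k.+1 l.+1) u w i j,
    [/\ x = mk p u w, u i = c, w j = d & y = mk (ptr i j p) (u \o lift i) (w \o lift j)].

Definition tr c d x : lab C D :=
  match pselect (in_count x c = 1 /\ out_count x d = 1 /\ exists y, traces c d x y) with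
  | left H => sval (cid H.2.2)
  | right _ => x
  end.

(** Renumberings preserve the position of a label that occurs once, and are
    compatible with the trace there by [tpt_ptr]. *)
Lemma traces_fun c d x y y' :
  in_count x c = 1 -> out_count x d = 1 -> traces c d x y -> traces c d x y' -> y = y'.
Proof.
move=> xc xd [k [l [p [u [w [i [j [Ex ui wj ->]]]]]]]].
move=> [k' [l' [p' [u' [w' [i' [j' [Ex' ui' wj' ->]]]]]]]].
have once (A : eqType) n (v : 'I_n -> A) a m m' :
    #|[pred m | v m == a]| = 1 -> v m = a -> v m' = a -> m = m'.
  move=> /eqP/card1P[m0 Hm0] vm vm'.
  have := Hm0 m; have := Hm0 m'; rewrite !inE vm vm' eqxx => /esym/eqP-> /esym/eqP->.
  by [].
move: Ex' xc xd; rewrite Ex => /mkE[f [g [fu gw ->]]]; rewrite in_count_mk out_count_mk => uc wd.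
have fi : f i = i'.
  apply/(bij_injective (f := binv f))/(once _ _ _ _ _ _ uc); first by rewrite /= bijK.
  by rewrite -fu /= bijVK.
have gj : g j = j'.
  apply/(bij_injective (f := binv g))/(once _ _ _ _ _ _ wd); first by rewrite /= bijK.
  by rewrite -gw /= bijVK.
rewrite -fi -gj (tpt_ptr (trapP P)) mk_tpt; apply: mk_ext => m.
  by rewrite /= lift_bdel -fu.
by rewrite /= lift_bdel -gw.
Qed.

Lemma tr_mk k l (p : P k.+1 l.+1) u w i j c d :
  in_count (mk p u w) c = 1 -> out_count (mk p u w) d = 1 -> u i = c -> w j = d ->
  tr c d (mk p u w) = mk (ptr i j p) (u \o lift i) (w \o lift j).
Proof.
move=> xc xd ui wj.
have xt : traces c d (mk p u w) (mk (ptr i j p) (u \o lift i) (w \o lift j)).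
  by exists k, l, p, u, w, i, j.
rewrite /tr; case: pselect => [H|[]]; last by do !split => //; eexists; apply: xt.
by case: cid => y /= xy; apply: traces_fun xy xt.
Qed.

Lemma in_count_tr c d x c' : in_count x c = 1 -> out_count x d = 1 -> in_count (tr c d x) c' = in_count x c' - (c == c').
Proof.
move=> xc xd; have [k [l [p [u [w [Ex uc wd]]]]]] := lab_head xc xd.
by subst x; rewrite (tr_mk xc xd uc wd) !in_count_mk (card_lift _ ord0) uc addKn.
Qed.

Lemma out_count_tr c d x d' : in_count x c = 1 -> out_count x d = 1 -> out_count (tr c d x) d' = out_count x d' - (d == d').
Proof.
move=> xc xd; have [k [l [p [u [w [Ex uc wd]]]]]] := lab_head xc xd.
by subst x; rewrite (tr_mk xc xd uc wd) !out_count_mk (card_lift _ ord0) wd addKn.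
Qed.

(** With the traced labels in the left factor, this is the axiom [ptr_hcatl]. *)
Lemma tr_mul c d x y : in_count x c = 1 -> out_count x d = 1 -> in_count y c = 0 -> out_count y d = 0 ->
  tr c d (mul x y) = mul (tr c d x) y.
Proof.
move=> xc xd yc yd.
have zc : in_count (mul x y) c = 1 by rewrite in_count_mul xc yc.
have zd : out_count (mul x y) d = 1 by rewrite out_count_mul xd yd.
have [k [l [p [u [w [Ex uc wd]]]]]] := lab_head xc xd.
have [k' [l' [p' [u' [w' Ey]]]]] := mkP y; subst x y.
have lift_l n n' (i : 'I_n) : lift (lshift n' ord0) (lshift n' i) = lshift n' (lift ord0 i)
    :> 'I_(n.+1 + n').
  exact: val_inj.
have lift_r n n' (i : 'I_n') : lift (lshift n' ord0) (rshift n i) = rshift n.+1 i :> 'I_(n.+1 + n').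
  exact: val_inj.
move: zc zd; rewrite (tr_mk xc xd uc wd) !mul_mk -(ptr_hcatl (trapP P)) => zc zd.
rewrite (@tr_mk (k + k') (l + l') _ _ _ (lshift k' ord0) (lshift l' ord0) _ _ zc zd) ?ujoinl //.
by apply: mk_ext; apply: ord_sumP => i /=; rewrite ?lift_l ?lift_r ?ujoinl ?ujoinr.
Qed.

Lemma ord_of_count2 (A : eqType) k (u : 'I_k -> A) a b :
  a != b -> #|[pred i | u i == a]| = 1 -> #|[pred i | u i == b]| = 1 ->
  exists k' (f : bij 'I_k'.+2 'I_k), u (f ord0) = a /\ u (f (lift ord0 ord0)) = b.
Proof.
move=> ab /ord_of_count[n [f ufa]] ub.
have : #|[pred i | u (f (lift ord0 i)) == b]| = 1.
  by move: ub; rewrite -(card_preim_bij f) (card_lift _ ord0) ufa (negbTE ab).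
move=> /ord_of_count[n' [g ugb]].
have h_bij : bijective (bsum (bid 'I_1) g : 'I_n'.+2 -> 'I_n.+1) by apply: bijP.
exists n', (bcomp f (Bij h_bij)); split; rewrite /= /bsum_fun.
  have -> : @ord0 n'.+1 = @lshift 1 n'.+1 ord0 by exact: val_inj.
  rewrite ujoinl; by rewrite -ufa; congr (u (f _)); apply: val_inj.
have -> : lift (@ord0 n'.+1) ord0 = @rshift 1 n'.+1 ord0 by exact: val_inj.
rewrite ujoinr; by rewrite -ugb; congr (u (f _)); apply: val_inj.
Qed.

(** Both orders of tracing amount to tracing the first two inputs with the first
    two outputs, for which one instance of the exchange axiom suffices. *)
Lemma tr_tr c d c' d' x : c != c' -> d != d' ->
  in_count x c = 1 -> out_count x d = 1 -> in_count x c' = 1 -> out_count x d' = 1 ->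
  tr c d (tr c' d' x) = tr c' d' (tr c d x).
Proof.
move=> cc dd xc xd xc' xd'.
have [k [l [p [u [w Ex]]]]] := mkP x.
have [k' [f [uc uc']]] : exists k' (f : bij 'I_k'.+2 'I_k), u (f ord0) = c /\ u (f (lift ord0 ord0)) = c'.
  by apply: ord_of_count2 => //; [move: xc | move: xc']; rewrite Ex in_count_mk.
have [l' [g [wd wd']]] : exists l' (f : bij 'I_l'.+2 'I_l), w (f ord0) = d /\ w (f (lift ord0 ord0)) = d'.
  by apply: ord_of_count2 => //; [move: xd | move: xd']; rewrite Ex out_count_mk.
move: Ex; rewrite (mk_renumber f g); move: (tpt _ _ _) => {}p Ex; subst x.
have yc : in_count (tr c d (mk p (u \o f) (w \o g))) c' = 1 by rewrite in_count_tr // (negbTE cc) subn0.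
have yd : out_count (tr c d (mk p (u \o f) (w \o g))) d' = 1 by rewrite out_count_tr // (negbTE dd) subn0.
have zc : in_count (tr c' d' (mk p (u \o f) (w \o g))) c = 1.
  by rewrite in_count_tr // eq_sym (negbTE cc) subn0.
have zd : out_count (tr c' d' (mk p (u \o f) (w \o g))) d = 1.
  by rewrite out_count_tr // eq_sym (negbTE dd) subn0.
have Ey := tr_mk xc xd uc wd; have Ez := tr_mk xc' xd' uc' wd'.
move: yc yd zc zd; rewrite Ey Ez => yc yd zc zd.
rewrite (tr_mk (i := ord0) (j := ord0) yc yd) //.
rewrite (tr_mk (i := ord0) (j := ord0) zc zd); first last.
- by rewrite -wd; congr (w (g _)); apply: val_inj.
- by rewrite -uc; congr (u (f _)); apply: val_inj.
have inord0 n : inord 0 = ord0 :> 'I_n.+1 by apply: val_inj; rewrite /= inordK.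
have inord1 n : inord 1 = lift ord0 ord0 :> 'I_n.+2 by apply: val_inj; rewrite /= inordK.
rewrite [X in _ = mk X _ _](ptr_ptr_gege (trapP P)) // !inord0 !inord1.
have lift01 n (m : 'I_n) :
    lift ord0 (lift ord0 m) = lift (lift ord0 ord0) (lift ord0 m) :> 'I_n.+2 by exact: val_inj.
by apply: mk_ext => m /=; rewrite lift01.
Qed.

End Trace.

(** Renaming may merge labels, but the traced ones have to remain unique. *)
Lemma tr_push (C D C' D' : eqType) (h : C -> C') (h' : D -> D') (x : lab C D) c d :
  in_count x c = 1 -> out_count x d = 1 -> in_count (push h h' x) (h c) = 1 -> out_count (push h h' x) (h' d) = 1 ->
  tr (h c) (h' d) (push h h' x) = push h h' (tr c d x).
Proof.
move=> xc xd; have [k [l [p [u [w [Ex uc wd]]]]]] := lab_head xc xd.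
subst x; rewrite (tr_mk xc xd uc wd) !push_mk => yc yd.
by rewrite (tr_mk (i := ord0) (j := ord0) yc yd) //= ?uc ?wd.
Qed.

Section UnitRules.
Variables (C D : eqType) (I : P 1 1).
Hypothesis HI : is_trap_unit I.
Implicit Types (x : lab C D) (c : C) (d : D).

(** The unit of the TRAP as a wire from an input labelled [c] to an output
    labelled [d]. *)
Definition wire c d : lab C D := mk I (fun=> c) (fun=> d).

Definition rename (A : eqType) (a b y : A) := if y == a then b else y.

Lemma in_count_wire c d c' : in_count (wire c d) c' = (c == c').
Proof.
rewrite in_count_mk; case: eqP => [cc|/eqP/negbTE cc]; last by rewrite eq_card0 // => i; rewrite inE cc.
by rewrite (@eq_card _ _ predT) ?card_ord // => i; rewrite !inE cc eqxx.
Qed.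

Lemma out_count_wire c d d' : out_count (wire c d) d' = (d == d').
Proof.
rewrite out_count_mk; case: eqP => [cc|/eqP/negbTE cc]; last by rewrite eq_card0 // => i; rewrite inE cc.
by rewrite (@eq_card _ _ predT) ?card_ord // => i; rewrite !inE cc eqxx.
Qed.

Lemma pcycle00 n : pcycle n.+1 0 0 = 1%g.
Proof.
apply/permP => i; rewrite permE perm1 /segment.
have -> : [seq j : 'I_n.+1 <- enum 'I_n.+1 | 0 <= val j <= 0] = [:: ord0].
  rewrite enum_ordSl /=; congr (_ :: _); apply/eqP; rewrite -[_ == _]negbK -has_filter.
  by apply/hasP => -[j /mapP[m _ ->]].
by rewrite /=; case: eqP.
Qed.

Lemma lab_headl x c : in_count x c = 1 -> exists k l (p : P k.+1 l) u w, x = mk p u w /\ u ord0 = c.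
Proof.
have [k [l [p [u [w ->]]]]] := mkP x; rewrite in_count_mk => /ord_of_count[k' [f uc]].
by exists k', l, (tpt (binv f) (binv (bid _)) p), (u \o f), (w \o bid _); rewrite -mk_renumber.
Qed.

Lemma lab_headr x d : out_count x d = 1 -> exists k l (p : P k l.+1) u w, x = mk p u w /\ w ord0 = d.
Proof.
have [k [l [p [u [w ->]]]]] := mkP x; rewrite out_count_mk => /ord_of_count[l' [g wd]].
by exists k, l', (tpt (binv (bid _)) (binv g) p), (u \o bid _), (w \o g); rewrite -mk_renumber.
Qed.

(** Closing the output [d] onto a wire only moves this
    output to the other end of the wire. *)
Lemma tr_wire_out c d d' x : d' != d -> in_count x c = 0 -> out_count x d = 1 ->
  tr c d (mul (wire c d') x) = push id (rename d d') x.
Proof.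
move=> dd xc xd.
have zc : in_count (mul (wire c d') x) c = 1 by rewrite in_count_mul in_count_wire eqxx xc.
have zd : out_count (mul (wire c d') x) d = 1 by rewrite out_count_mul out_count_wire (negbTE dd) xd.
have [k [l [p [u [w [Ex wd]]]]]] := lab_headr xd; subst x.
move: zc zd; rewrite push_mk mul_mk => zc zd.
have r0 : rshift 1 ord0 = lift ord0 ord0 :> 'I_(1 + l.+1) by exact: val_inj.
have l0 : lshift k ord0 = ord0 :> 'I_(1 + k) by exact: val_inj.
rewrite (@tr_mk _ _ k l.+1 _ _ _ ord0 (lift ord0 ord0) _ _ zc zd) //; first last.
- by rewrite -r0 ujoinr.
- by rewrite -l0 ujoinl.
rewrite [X in mk X _ _](_ : _ = p); last first.
  by rewrite -[RHS](lact1 (trapP P)) -(pcycle00 l); exact: (ptr_unitl_out HI).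
apply: mk_ext => i /=.
  by rewrite (_ : lift ord0 i = rshift 1 i) ?ujoinr //; apply: val_inj.
case: (unliftP ord0 i) => [m|] ->.
  rewrite (_ : lift _ _ = rshift 1 (lift ord0 m)) ?ujoinr; last exact: val_inj.
  have wm : w (lift ord0 m) != d.
    apply: (count0_neq (u := fun m => w (lift ord0 m))).
    by move: xd; rewrite out_count_mk (card_lift _ ord0) wd eqxx => -[].
  by rewrite /rename (negbTE wm).
rewrite (_ : lift _ _ = @lshift 1 l.+1 ord0) ?ujoinl; last exact: val_inj.
by rewrite wd /rename eqxx.
Qed.

(** The second unit axiom, with inputs and outputs exchanged. *)
Lemma tr_wire_in c c' d x : c' != c -> in_count x c = 1 -> out_count x d = 0 ->
  tr c d (mul (wire c' d) x) = push (rename c c') id x.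
Proof.
move=> cc xc xd.
have zc : in_count (mul (wire c' d) x) c = 1 by rewrite in_count_mul in_count_wire (negbTE cc) xc.
have zd : out_count (mul (wire c' d) x) d = 1 by rewrite out_count_mul out_count_wire eqxx xd.
have [k [l [p [u [w [Ex wd]]]]]] := lab_headl xc; subst x.
move: zc zd; rewrite push_mk mul_mk => zc zd.
have r0 : rshift 1 ord0 = lift ord0 ord0 :> 'I_(1 + k.+1) by exact: val_inj.
have l0 : lshift l ord0 = ord0 :> 'I_(1 + l) by exact: val_inj.
rewrite (@tr_mk _ _ k.+1 l _ _ _ (lift ord0 ord0) ord0 _ _ zc zd) //; first last.
- by rewrite -l0 ujoinl.
- by rewrite -r0 ujoinr.
rewrite [X in mk X _ _](_ : _ = p); last first.
  by rewrite -[RHS](ract1 (trapP P)) -invg1 -(pcycle00 k); exact: (ptr_unitl_in HI).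
apply: mk_ext => i /=; last first.
  by rewrite (_ : lift ord0 i = rshift 1 i) ?ujoinr //; apply: val_inj.
case: (unliftP ord0 i) => [m|] ->.
  rewrite (_ : lift _ _ = rshift 1 (lift ord0 m)) ?ujoinr; last exact: val_inj.
  have um : u (lift ord0 m) != c.
    apply: (count0_neq (u := fun m => u (lift ord0 m))).
    by move: xc; rewrite in_count_mk (card_lift _ ord0) wd eqxx => -[].
  by rewrite /rename (negbTE um).
rewrite (_ : lift _ _ = @lshift 1 k.+1 ord0) ?ujoinl; last exact: val_inj.
by rewrite wd /rename eqxx.
Qed.

Lemma tr_wire c d : tr c d (wire c d) = scal C D (ptr ord0 ord0 I).
Proof.
have zc : in_count (wire c d) c = 1 by rewrite in_count_wire eqxx.
have zd : out_count (wire c d) d = 1 by rewrite out_count_wire eqxx.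
by rewrite (tr_mk (i := ord0) (j := ord0) zc zd) //; apply: mk_ext => - [].
Qed.

End UnitRules.

Section IteratedTrace.
Variables (C D : eqType).
Implicit Types (x y : lab C D).

(** Tracing successively along pairs of labels; the last pair of the sequence is
    traced first, but the order is immaterial. *)
Definition trs (s : seq (C * D)) x : lab C D := foldr (fun cd => tr cd.1 cd.2) x s.

Definition traceable (s : seq (C * D)) x : Prop :=
  [/\ uniq (map fst s), uniq (map snd s), {in s, forall cd, in_count x cd.1 = 1}
    & {in s, forall cd, out_count x cd.2 = 1}].

Lemma traceable_cons cd s x : traceable (cd :: s) x ->
  [/\ traceable s x, in_count x cd.1 = 1, out_count x cd.2 = 1,
     cd.1 \notin map fst s & cd.2 \notin map snd s].
Proof.
move=> [/= /andP[u1 u1'] /andP[u2 u2'] h1 h2]; split=> //; last first.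
- by apply: h2; rewrite mem_head.
- by apply: h1; rewrite mem_head.
- by split=> // a sa; [apply: h1 | apply: h2]; rewrite inE sa orbT.
Qed.

Lemma count_trs s x : traceable s x ->
  (forall c, in_count (trs s x) c = in_count x c - (c \in map fst s)) /\
  (forall d, out_count (trs s x) d = out_count x d - (d \in map snd s)).
Proof.
elim: s => [|cd s IH]; first by split=> ?; rewrite subn0.
move=> /traceable_cons[st c1 d1 cs ds]; have [IH1 IH2] := IH st.
have c1' : in_count (trs s x) cd.1 = 1 by rewrite IH1 (negbTE cs) subn0.
have d1' : out_count (trs s x) cd.2 = 1 by rewrite IH2 (negbTE ds) subn0.
split=> [c|d] /=.
  by rewrite in_count_tr // IH1 inE [cd.1 == c]eq_sym -subnDA addnC; case: eqP => //= ->; rewrite (negbTE cs).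
by rewrite out_count_tr // IH2 inE [cd.2 == d]eq_sym -subnDA addnC; case: eqP => //= ->; rewrite (negbTE ds).
Qed.

(** By [tr_tr], one more trace can be performed first or last. *)
Lemma trs_tr c d s x : traceable ((c, d) :: s) x -> trs s (tr c d x) = tr c d (trs s x).
Proof.
elim: s => //= -[c' d'] s IH st.
have [st' c1 d1 cs ds] := traceable_cons st.
have [st'' c1' d1' cs' ds'] := traceable_cons st'.
rewrite IH; last first.
  case: st => /= /and3P[_ u1 u2] /and3P[_ v1 v2] h1 h2; split=> //=.
  - by move: cs; rewrite /= inE negb_or u2 => /andP[_ ->].
  - by move: ds; rewrite /= inE negb_or v2 => /andP[_ ->].
  - by move=> a; rewrite inE => sa; apply: h1; rewrite !inE; case/orP: sa => ->; rewrite ?orbT.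
  - by move=> a; rewrite inE => sa; apply: h2; rewrite !inE; case/orP: sa => ->; rewrite ?orbT.
have [E1 E2] := count_trs st''; move: cs ds => /=; rewrite !inE !negb_or => /andP[cc cs] /andP[dd ds].
by rewrite /= tr_tr ?E1 ?E2 ?(negbTE cs) ?(negbTE ds) ?(negbTE cs') ?(negbTE ds') ?subn0 // eq_sym.
Qed.

Lemma trs_cat s t x : trs (s ++ t) x = trs s (trs t x).
Proof. exact: foldr_cat. Qed.

Lemma traceable_perm s t x : perm_eq s t -> traceable s x -> traceable t x.
Proof.
move=> st [u1 u2 h1 h2]; split.
- by rewrite -(perm_uniq (perm_map fst st)).
- by rewrite -(perm_uniq (perm_map snd st)).
- by move=> a; rewrite -(perm_mem st); apply: h1.
- by move=> a; rewrite -(perm_mem st); apply: h2.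
Qed.

Lemma traceable_catr s t x : traceable (s ++ t) x -> traceable t x.
Proof.
move=> [u1 u2 h1 h2]; split.
- by move: u1; rewrite map_cat cat_uniq => /and3P[].
- by move: u2; rewrite map_cat cat_uniq => /and3P[].
- by move=> a ta; apply: h1; rewrite mem_cat ta orbT.
- by move=> a ta; apply: h2; rewrite mem_cat ta orbT.
Qed.

Lemma traceable_catl s t x : traceable (s ++ t) x -> traceable s (trs t x).
Proof.
move=> stx; have [E1 E2] := count_trs (traceable_catr stx); case: stx => u1 u2 h1 h2.
move: u1 u2; rewrite !map_cat !cat_uniq => /and3P[u1 /hasPn v1 _] /and3P[u2 /hasPn v2 _].
split=> // a sa; rewrite ?E1 ?E2 ?h1 ?h2 ?mem_cat ?sa //.
  by rewrite (negbTE (contraL (v1 _) _)) // map_f.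
by rewrite (negbTE (contraL (v2 _) _)) // map_f.
Qed.

Lemma trs_perm s t x : perm_eq s t -> traceable s x -> trs s x = trs t x.
Proof.
elim: s t => [|a s IH] t; first by rewrite perm_sym => /perm_nilP ->.
move=> st sx; have ta : a \in t by rewrite -(perm_mem st) mem_head.
case/splitPr: t / ta st => t1 t2 st.
have st' : perm_eq (a :: s) (a :: t1 ++ t2).
  by rewrite (perm_trans st) // -cat1s perm_catCA.
have [sx' _ _ _ _] := traceable_cons sx.
have tx := traceable_perm st' sx; rewrite -cat_cons in tx.
have st'' : perm_eq s (t1 ++ t2) by move: st'; rewrite perm_cons.
rewrite [LHS]/= (IH _ st'' sx') !trs_cat.
by case: a {st st' sx} tx => c d /traceable_catl/trs_tr ->.
Qed.

Lemma trs_mul s x y : traceable s x ->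
  {in s, forall cd, in_count y cd.1 = 0} -> {in s, forall cd, out_count y cd.2 = 0} ->
  trs s (mul x y) = mul (trs s x) y.
Proof.
elim: s => //= cd s IH st h1 h2; have [st' c1 d1 cs ds] := traceable_cons st.
have [E1 E2] := count_trs st'.
rewrite IH // => [|a sa|a sa]; try by [apply: h1; rewrite inE sa orbT | apply: h2; rewrite inE sa orbT].
by rewrite tr_mul ?E1 ?E2 ?(negbTE cs) ?(negbTE ds) ?subn0 ?h1 ?h2 ?mem_head.
Qed.

End IteratedTrace.

Lemma trs_push (C D C' D' : eqType) (h : C -> C') (h' : D -> D') s (x : lab C D) :
  injective h -> injective h' -> traceable s x ->
  trs [seq (h cd.1, h' cd.2) | cd <- s] (push h h' x) = push h h' (trs s x).
Proof.
move=> h_inj h'_inj; elim: s => //= cd s IH st; have [st' c1 d1 cs ds] := traceable_cons st.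
have [E1 E2] := count_trs st'.
by rewrite IH // tr_push ?in_count_push ?out_count_push ?E1 ?E2 ?(negbTE cs) ?(negbTE ds) ?subn0.
Qed.

Lemma traceable_push (C D C' D' : eqType) (h : C -> C') (h' : D -> D') s (x : lab C D) :
  injective h -> injective h' -> traceable s x ->
  traceable [seq (h cd.1, h' cd.2) | cd <- s] (push h h' x).
Proof.
move=> h_inj h'_inj [u1 u2 h1 h2]; split.
- by rewrite -map_comp (map_comp h fst) map_inj_uniq.
- by rewrite -map_comp (map_comp h' snd) map_inj_uniq.
- by move=> _ /mapP[cd scd ->] /=; rewrite in_count_push ?h1.
- by move=> _ /mapP[cd scd ->] /=; rewrite out_count_push ?h2.
Qed.

(** Labels given by words; [one] is a default value for words of the wrong
    length. *)
Definition mk_words (C D : Type) k l (p : P k l) (u : seq C) (w : seq D) : lab C D :=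
  match insub u, insub w with
  | Some u', Some w' => mk p (@tnth k C u') (@tnth l D w')
  | _, _ => one C D
  end.

Lemma mk_words_tuple C D k l (p : P k l) (u : k.-tuple C) (w : l.-tuple D) :
  mk_words p u w = mk p (tnth u) (tnth w).
Proof. by rewrite /mk_words !valK. Qed.

Lemma push_mk_words C D C' D' (h : C -> C') (h' : D -> D') k l (p : P k l) u w :
  size u = k -> size w = l -> push h h' (mk_words p u w) = mk_words p (map h u) (map h' w).
Proof.
move=> /eqP su /eqP sw; rewrite -[u]/(val (Tuple su)) -[w]/(val (Tuple sw)).
rewrite mk_words_tuple push_mk -[map h _]/(val (map_tuple h (Tuple su))).
rewrite -[map h' _]/(val (map_tuple h' (Tuple sw))) mk_words_tuple.
by apply: mk_ext => i /=; rewrite tnth_map.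
Qed.

Lemma card_tnth (A : eqType) k (t : k.-tuple A) a : #|[pred i | tnth t i == a]| = count_mem a t.
Proof.
rewrite -[in RHS](map_tnth_enum t) count_map -sum1_card -sum1_count.
by rewrite [RHS]big_enum_cond; apply: eq_bigl => i; rewrite !inE.
Qed.

Lemma in_count_mk_words (C D : eqType) k l (p : P k l) (u : seq C) (w : seq D) c :
  size u = k -> size w = l -> in_count (mk_words p u w) c = count_mem c u.
Proof.
move=> /eqP su /eqP sw; rewrite -[u]/(val (Tuple su)) -[w]/(val (Tuple sw)).
by rewrite mk_words_tuple in_count_mk card_tnth.
Qed.

Lemma out_count_mk_words (C D : eqType) k l (p : P k l) (u : seq C) (w : seq D) d :
  size u = k -> size w = l -> out_count (mk_words p u w) d = count_mem d w.
Proof.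
move=> /eqP su /eqP sw; rewrite -[u]/(val (Tuple su)) -[w]/(val (Tuple sw)).
by rewrite mk_words_tuple out_count_mk card_tnth.
Qed.

End Labelled.

(** * The ordered fibers of a graph *)

Section FiberSeq.
Variables (A V : finType) (f : A -> V) (r : rel A).

Definition fiber_seq v : seq A := sort r (enum [pred a | f a == v]).

Lemma mem_fiber_seq v a : (a \in fiber_seq v) = (f a == v).
Proof. by rewrite mem_sort mem_enum. Qed.

Lemma uniq_fiber_seq v : uniq (fiber_seq v).
Proof. by rewrite sort_uniq enum_uniq. Qed.

Lemma size_fiber_seq v : size (fiber_seq v) = #|[pred a | f a == v]|.
Proof. by rewrite size_sort -cardE. Qed.

Lemma sorted_fiber_seq v : fiber_order f r -> sorted r (fiber_seq v).
Proof.
move=> fr; have [_ _ _ r4] := fr v; apply: (sort_sorted_in r4).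
by apply/allP => a; rewrite mem_enum.
Qed.

Lemma fiber_seq_unique v s : fiber_order f r ->
  uniq s -> s =i [pred a | f a == v] -> sorted r s -> s = fiber_seq v.
Proof.
move=> fr s_uniq s_fib s_sorted; have [_ r2 r3 _] := fr v.
apply: (@sorted_eq_in _ r) => //.
- by move=> a b c; rewrite !s_fib; apply: r3.
- by move=> a b; rewrite !s_fib; apply: r2.
- exact: sorted_fiber_seq.
- by apply: uniq_perm => //; [apply: uniq_fiber_seq | move=> a; rewrite s_fib mem_fiber_seq].
Qed.

End FiberSeq.

(** A finite total order has only one increasing enumeration, which increasing
    bijections therefore preserve. *)
Lemma fiber_seq_map (A A' V V' : finType) (f : A -> V) (r : rel A) (f' : A' -> V') (r' : rel A')
    (h : A -> A') v v' :
  fiber_order f r -> fiber_order f' r' -> injective h ->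
  (forall a, (f' (h a) == v') = (f a == v)) ->
  (forall a', f' a' = v' -> exists a, h a = a') ->
  (forall a b, f a = v -> f b = v -> r' (h a) (h b) = r a b) ->
  fiber_seq f' r' v' = map h (fiber_seq f r v).
Proof.
move=> fr fr' h_inj hf h_surj hr; symmetry; apply: fiber_seq_unique => //.
- by rewrite map_inj_uniq ?uniq_fiber_seq.
- move=> a'; rewrite inE; apply/mapP/eqP => [[a]|a'v].
    by rewrite mem_fiber_seq -hf => /eqP ? ->.
  have [a Ea] := h_surj _ a'v; exists a => //; by rewrite mem_fiber_seq -hf Ea a'v.
- have := sorted_fiber_seq v fr; rewrite sorted_map.
  apply: (@sub_in_sorted _ [pred a | f a == v]) => [a b /eqP av /eqP bv|] /=.
    by rewrite hr.
  by apply/allP => a; rewrite mem_fiber_seq.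
Qed.

Lemma sum_count_fiber (A V : finType) (C : eqType) (f : A -> V) (r : rel A) (u : A -> C) c :
  \sum_(v : V) count_mem c (map u (fiber_seq f r v)) = #|[pred a | u a == c]|.
Proof.
rewrite -[RHS]sum1_card (partition_big f predT) //=; apply: eq_bigr => v _.
have /seq.permP E : perm_eq (fiber_seq f r v) (enum [pred a | f a == v]) by rewrite perm_sort.
rewrite count_map E -sum1_count big_enum_cond /=.
by apply: eq_bigl => a; rewrite !inE andbC.
Qed.

Section Flags.
Variables (X : nat -> nat -> Type).
Implicit Types k l : nat.

Definition in_seq k l (G : graph X k l) v := fiber_seq (tgt G) (ile G) v.
Definition out_seq k l (G : graph X k l) v := fiber_seq (src G) (ole G) v.

Arguments in_seq {k l} G v.
Arguments out_seq {k l} G v.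

Lemma size_in_seq k l (G : graph X k l) v : size (in_seq G v) = (tag (deco G v)).1.
Proof. by rewrite size_fiber_seq deco_arity. Qed.

Lemma size_out_seq k l (G : graph X k l) v : size (out_seq G v) = (tag (deco G v)).2.
Proof. by rewrite size_fiber_seq deco_arity. Qed.

End Flags.
Arguments in_seq {X k l} G v.
Arguments out_seq {X k l} G v.

Section BigSubtypes.
Variables (R : Type) (idx : R) (op : Monoid.com_law idx).

Lemma enum_optionE (T : finType) : enum {: option T} = None :: map Some (enum T).
Proof. by rewrite !enumT [in LHS]unlock. Qed.

Lemma big_option (T : finType) (F : option T -> R) :
  \big[op/idx]_(x : option T) F x = op (F None) (\big[op/idx]_(x : T) F (Some x)).
Proof. by rewrite -big_enum enum_optionE big_cons big_map big_enum. Qed.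

Lemma big_sig (T : finType) (Q : pred T) (F : T -> R) :
  \big[op/idx]_(x : {x : T | Q x}) F (val x) = \big[op/idx]_(x | Q x) F x.
Proof.
rewrite [RHS](reindex_omap (val : {x | Q x} -> T) insub) => [|x Qx]; last by rewrite insubT.
by apply: eq_bigl => -[x Qx]; rewrite /= insubT Qx /= eqxx.
Qed.

End BigSubtypes.

Lemma lift_cut_lab (A B : finType) n (lab : A -> 'I_n.+1) (e : A) (h : B -> A)
    (lab_bij : bijective lab) (he : onto_but e h) b :
  lift (lab e) (cut_lab lab_bij he b) = lab (h b).
Proof. exact: lift_relabel. Qed.

(** * Evaluation of a graph in a TRAP *)

Section Eval.
Variables (X : nat -> nat -> Type) (P : trap).
Variables (phi : forall k l, X k l -> P k l) (oI : option (P 1 1)).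
Hypothesis oI_unit : forall J, oI = Some J -> is_trap_unit J.

Notation mulm := (@mul P _ _).
Notation onem := (@one P _ _).

Section Boxes.
Variables (C D : eqType).

Definition vbox (d : {kl : nat * nat & X kl.1 kl.2}) (u : seq C) (w : seq D) : lab P C D :=
  mk_words (phi (tagged d)) u w.

(** Without a unit only solar graphs are evaluated: the products of the wires and
    of the loops are then empty, and [one] is a mere default value. *)
Definition iobox (c : C) (d : D) : lab P C D := if oI is Some J then wire J c d else onem.

Definition lbox : lab P C D :=
  if oI is Some J then scal C D (ptr ord0 ord0 J) else onem.

Definition prodV k l (G : graph X k l) (cl : iedge G + inp G -> C) (dl : iedge G + outp G -> D) :=
  \big[mulm/onem]_(v : vert G) vbox (deco G v) (map cl (in_seq G v)) (map dl (out_seq G v)).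

Definition prodIO (T : finType) (ci : T -> C) (di : T -> D) :=
  \big[mulm/onem]_(c : T) iobox (ci c) (di c).

Definition prodL (T : finType) := \big[mulm/onem]_(c : T) lbox.

Lemma in_count_prodV k l (G : graph X k l) cl dl c :
  in_count (prodV (G := G) cl dl) c = #|[pred a | cl a == c]|.
Proof.
rewrite in_count_big -(sum_count_fiber (tgt G) (ile G)); apply: eq_bigr => v _.
by rewrite in_count_mk_words // size_map ?size_in_seq ?size_out_seq.
Qed.

Lemma in_count_iobox c d c' : isSome oI -> in_count (iobox c d) c' = (c == c').
Proof. by rewrite /iobox; case: oI => // J _; rewrite in_count_wire. Qed.

Lemma in_count_prodIO (T : finType) (ci : T -> C) (di : T -> D) c :
  isSome oI || (#|T| == 0) -> in_count (prodIO ci di) c = #|[pred x | ci x == c]|.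
Proof.
move=> oT; rewrite in_count_big -[RHS]sum1_card [RHS]big_mkcond /=.
case/orP: oT => [oIs|/eqP/card0_eq T0].
  by apply: eq_bigr => x _; rewrite in_count_iobox // inE; case: eqP.
by apply: eq_bigr => x; have := T0 x.
Qed.

Lemma in_count_prodL (T : finType) c : in_count (prodL T) c = 0.
Proof.
rewrite in_count_big big1 // => x _; rewrite /lbox; case: oI => [J|]; exact: in_count_scal.
Qed.

Lemma out_count_prodV k l (G : graph X k l) cl dl d :
  out_count (prodV (G := G) cl dl) d = #|[pred a | dl a == d]|.
Proof.
rewrite out_count_big -(sum_count_fiber (src G) (ole G)); apply: eq_bigr => v _.
by rewrite out_count_mk_words // size_map ?size_in_seq ?size_out_seq.
Qed.

Lemma out_count_iobox c d d' : isSome oI -> out_count (iobox c d) d' = (d == d').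
Proof. by rewrite /iobox; case: oI => // J _; rewrite out_count_wire. Qed.

Lemma out_count_prodIO (T : finType) (ci : T -> C) (di : T -> D) d :
  isSome oI || (#|T| == 0) -> out_count (prodIO ci di) d = #|[pred x | di x == d]|.
Proof.
move=> oT; rewrite out_count_big -[RHS]sum1_card [RHS]big_mkcond /=.
case/orP: oT => [oIs|/eqP/card0_eq T0].
  by apply: eq_bigr => x _; rewrite out_count_iobox // inE; case: eqP.
by apply: eq_bigr => x; have := T0 x.
Qed.

Lemma out_count_prodL (T : finType) d : out_count (prodL T) d = 0.
Proof.
rewrite out_count_big big1 // => x _; rewrite /lbox; case: oI => [J|]; exact: out_count_scal.
Qed.

(** The boxes of [G] side by side, with its internal edges cut open: each flag of
    a vertex and each end of a wire is labelled separately. *)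
Definition prodG k l (G : graph X k l) (cl : iedge G + inp G -> C) (ci : inout G -> C)
    (dl : iedge G + outp G -> D) (di : inout G -> D) : lab P C D :=
  mul (mul (prodV (G := G) cl dl) (prodIO ci di)) (prodL (loop G)).

End Boxes.

Section PushBoxes.
Variables (C D C' D' : eqType) (h : C -> C') (h' : D -> D').

Lemma push_iobox c d : push h h' (iobox c d) = iobox (h c) (h' d).
Proof. by rewrite /iobox; case: oI => [J|]; rewrite ?push_one // push_mk. Qed.

Lemma push_lbox : push h h' (lbox C D) = lbox C' D'.
Proof. by rewrite /lbox; case: oI => [J|]; rewrite ?push_one // push_scal. Qed.

Lemma push_prodG k l (G : graph X k l) cl ci dl di :
  push h h' (prodG (G := G) cl ci dl di) =
  prodG (G := G) (h \o cl) (h \o ci) (h' \o dl) (h' \o di).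
Proof.
rewrite !push_mul !push_big; congr (mul (mul _ _) _); apply: eq_bigr => v _.
- by rewrite push_mk_words ?size_map ?size_in_seq ?size_out_seq // -!map_comp.
- exact: push_iobox.
- exact: push_lbox.
Qed.

End PushBoxes.

Lemma eq_prodG (C D : eqType) k l (G : graph X k l) cl ci dl di cl' ci' dl' di' :
  cl =1 cl' -> ci =1 ci' -> dl =1 dl' -> di =1 di' ->
  prodG (C := C) (D := D) (G := G) cl ci dl di = prodG (G := G) cl' ci' dl' di'.
Proof. by move=> /funext-> /funext-> /funext-> /funext->. Qed.

(** * The value of a graph *)

Section Value.
Variables (k l : nat) (G : graph X k l).

Definition evable : bool := isSome oI || solar G.

Definition in_label : iedge G + inp G -> iedge G + 'I_k := sum_map id (ilab G \o inl).
Definition io_in_label (c : inout G) : iedge G + 'I_k := inr (ilab G (inr c)).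
Definition out_label : iedge G + outp G -> iedge G + 'I_l := sum_map id (olab G \o inl).
Definition io_out_label (c : inout G) : iedge G + 'I_l := inr (olab G (inr c)).

(** The two halves of a cut edge [e] are an input and an output with the same
    label [inl e]; the inputs and outputs of [G] are labelled by their numbers. *)
Definition cut_value := prodG (G := G) in_label io_in_label out_label io_out_label.

Definition edge_pairs : seq ((iedge G + 'I_k) * (iedge G + 'I_l)) :=
  [seq (inl e, inl e) | e <- enum (iedge G)].

(** Closing every cut edge leaves the inputs and outputs of [G] only, whose labels
    prescribe their order. *)
Definition evals (p : P k l) : Prop :=
  trs edge_pairs cut_value = mk p (@inr (iedge G) _) (@inr (iedge G) _).

Lemma evals_fun p p' : evals p -> evals p' -> p = p'.
Proof. by rewrite /evals => -> /mk_inj-> // ? ? []. Qed.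

Lemma card_std_label (E I J : finType) n (f : I + J -> 'I_n) (c : E + 'I_n) : bijective f ->
  #|[pred a : E + I | sum_map id (f \o inl) a == c]| +
  #|[pred x | inr (f (inr x)) == c]| = 1.
Proof.
move=> f_bij; rewrite -!sum1_card big_sumType /= -addnA; case: c => [e|i].
  rewrite (big_pred1 e) => [|a]; last by rewrite !inE.
  by rewrite !big_pred0.
rewrite big_pred0 // add0n; transitivity #|pred1 i|; last exact: card1.
rewrite -(card_preim_bij (Bij f_bij)) -[RHS]sum1_card big_sumType.
by congr (_ + _); apply: eq_bigl => x; rewrite !inE.
Qed.

Lemma evable_inout : evable -> isSome oI || (#|inout G| == 0).
Proof. by case/orP => [->//|/andP[-> _]]; rewrite orbT. Qed.

Lemma in_count_cut_value c : evable -> in_count cut_value c = 1.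
Proof.
move=> /evable_inout Gev; rewrite !in_count_mul in_count_prodL addn0 in_count_prodV in_count_prodIO //.
exact/card_std_label/ilab_bij.
Qed.

Lemma out_count_cut_value d : evable -> out_count cut_value d = 1.
Proof.
move=> /evable_inout Gev; rewrite !out_count_mul out_count_prodL addn0 out_count_prodV out_count_prodIO //.
exact/card_std_label/olab_bij.
Qed.

Lemma traceable_edges : evable -> traceable edge_pairs cut_value.
Proof.
move=> Gev; split=> [||cd _|cd _]; rewrite ?in_count_cut_value ?out_count_cut_value //.
  by rewrite -map_comp map_inj_uniq ?enum_uniq // => ? ? [].
by rewrite -map_comp map_inj_uniq ?enum_uniq // => ? ? [].
Qed.

(** Labels in which each number occurs once are a numbering. *)
Lemma straighten (E : finType) m n (u : 'I_m -> E + 'I_n) :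
  (forall e, #|[pred i | u i == inl e]| = 0) -> (forall j, #|[pred i | u i == inr j]| = 1) ->
  exists g : bij 'I_n 'I_m, u \o g =1 inr.
Proof.
move=> u0 u1; have uP j : exists i, u i == inr j.
  by have /card_gt0P[i ui] : 0 < #|[pred i | u i == inr j]| by [rewrite u1]; exists i.
pose g j := xchoose (uP j); have ug j : u (g j) = inr j by apply/eqP/(xchooseP (uP j)).
have g_bij : bijective g.
  apply: inj_surj_bij => [j j' gj|i]; first by have := ug j; rewrite gj ug => -[].
  case ui: (u i) => [e|j]; first by have /card0_eq/(_ i) := u0 e; rewrite inE ui eqxx.
  exists j; have /eqP/card1P[i0 Hi0] := u1 j.
  by have := Hi0 i; have := Hi0 (g j); rewrite !inE ug ui eqxx => /esym/eqP-> /esym/eqP->.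
by exists (Bij g_bij).
Qed.

(** Each edge uses up its label on both sides, so that every remaining label
    occurs once and [straighten] applies. *)
Lemma evals_exists : evable -> exists p, evals p.
Proof.
move=> Gev; have Gt := traceable_edges Gev; have [E1 E2] := count_trs Gt.
rewrite /evals; have [k' [l' [p [u [w E]]]]] := mkP (trs edge_pairs cut_value).
have inl_pairs e : (inl e \in map fst edge_pairs) && (inl e \in map snd edge_pairs).
  by rewrite -!map_comp !map_f ?mem_enum.
have inr1 i : (inr i \in map fst edge_pairs) = false.
  by apply/negP; rewrite -map_comp => /mapP[].
have inr2 i : (inr i \in map snd edge_pairs) = false.
  by apply/negP; rewrite -map_comp => /mapP[].
have [f fu] : exists f : bij 'I_k 'I_k', u \o f =1 inr.
  apply: straighten => [e|i]; rewrite -(in_count_mk p u w) -E E1 in_count_cut_value ?inr1 //.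
  by have /andP[->] := inl_pairs e.
have [g gw] : exists g : bij 'I_l 'I_l', w \o g =1 inr.
  apply: straighten => [e|i]; rewrite -(out_count_mk p u w) -E E2 out_count_cut_value ?inr2 //.
  by have /andP[_ ->] := inl_pairs e.
exists (tpt (binv f) (binv g) p); rewrite E (mk_renumber f g).
exact: mk_ext.
Qed.

End Value.

Section Iso.
Variables (k l : nat) (G H : graph X k l) (h : graph_iso G H).

Lemma in_seq_iso v : in_seq H (isoV h v) = map (sum_map (isoE h) (isoI h)) (in_seq G v).
Proof.
have hb := sum_map_bij (isoE_bij h) (isoI_bij h).
apply: fiber_seq_map (ile_order (g := G)) (ile_order (g := H)) (bij_inj hb) _ _ _ => [a|a' _|a b av bv].
- by rewrite iso_tgt (inj_eq (bij_inj (isoV_bij h))).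
- by have [g _ gK] := hb; exists (g a').
- by rewrite iso_ile // av bv.
Qed.

Lemma out_seq_iso v : out_seq H (isoV h v) = map (sum_map (isoE h) (isoO h)) (out_seq G v).
Proof.
have hb := sum_map_bij (isoE_bij h) (isoO_bij h).
apply: fiber_seq_map (ole_order (g := G)) (ole_order (g := H)) (bij_inj hb) _ _ _ => [a|a' _|a b av bv].
- by rewrite iso_src (inj_eq (bij_inj (isoV_bij h))).
- by have [g _ gK] := hb; exists (g a').
- by rewrite iso_ole // av bv.
Qed.

Lemma prodG_iso (C D : eqType) cl ci dl di :
  prodG (C := C) (D := D) (G := H) cl ci dl di =
  prodG (G := G) (cl \o sum_map (isoE h) (isoI h)) (ci \o isoIO h)
    (dl \o sum_map (isoE h) (isoO h)) (di \o isoIO h).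
Proof.
rewrite /prodG /prodV /prodIO /prodL; congr (mul (mul _ _) _).
- rewrite (reindex (isoV h)) /=; last by apply: onW_bij; apply: isoV_bij.
  by apply: eq_bigr => v _; rewrite iso_deco in_seq_iso out_seq_iso -!map_comp.
- by rewrite (reindex (isoIO h)) //=; apply: onW_bij; apply: isoIO_bij.
- by rewrite (reindex (isoL h)) //=; apply: onW_bij; apply: isoL_bij.
Qed.

Lemma cut_value_iso :
  cut_value H = push (sum_map (isoE h) id) (sum_map (isoE h) id) (cut_value G).
Proof.
rewrite push_prodG /cut_value prodG_iso; apply: eq_prodG => [[e|a]|c|[e|a]|c] //=.
- by rewrite -(iso_ilab h (inl a)).
- by rewrite /io_in_label /= -(iso_ilab h (inr c)).
- by rewrite -(iso_olab h (inl a)).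
- by rewrite /io_out_label /= -(iso_olab h (inr c)).
Qed.

Lemma evals_graph_iso p : evable G -> evals G p -> evals H p.
Proof.
move=> Gev; rewrite /evals cut_value_iso => Gp.
have h_inj n : injective (sum_map (isoE h) (@id 'I_n)).
  exact: bij_inj (sum_map_bij (isoE_bij h) (id_bij _)).
have Gt := traceable_edges Gev.
have Hev : evable H by rewrite /evable -(solar_iso (inhabits h)).
rewrite (@trs_perm _ _ _ _ [seq (sum_map (isoE h) id cd.1, sum_map (isoE h) id cd.2) | cd <- edge_pairs G]).
- by rewrite (trs_push (h_inj k) (h_inj l) Gt) Gp push_mk; apply: mk_ext.
- rewrite /edge_pairs -map_comp /=.
  rewrite [X in perm_eq _ X](_ : _ = map (fun e => (inl e, inl e)) (map (isoE h) (enum (iedge G)))).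
    apply: perm_map; apply: uniq_perm => [||e]; first exact: enum_uniq.
      by rewrite map_inj_uniq ?enum_uniq //; apply: bij_inj (isoE_bij h).
    rewrite mem_enum; apply/esym/mapP; have [g _ gK] := isoE_bij h.
    by exists (g e); rewrite ?mem_enum ?gK.
  by rewrite -map_comp.
- by rewrite -cut_value_iso; apply: traceable_edges.
Qed.

End Iso.

Lemma evals_iso k l (G H : graph X k l) p :
  isomorphic G H -> evable G -> evals G p -> evals H p.
Proof. by case=> h; apply: evals_graph_iso. Qed.

Lemma evals_lact k l (G : graph X k l) s p :
  evable G -> evals G p -> evals (graph_lact G s) (lact s p).
Proof.
move=> Gev; rewrite /evals => Gp.
rewrite [cut_value _](_ : _ = push id (sum_map id s) (cut_value G)); last first.
  by rewrite push_prodG; apply: eq_prodG => [[e|a]|c|[e|a]|c].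
have s_inj : injective (sum_map (@id (iedge G)) s).
  by apply: bij_inj (sum_map_bij (id_bij _) (injF_bij (@perm_inj _ s))).
rewrite (_ : edge_pairs (graph_lact G s) = [seq (id cd.1, sum_map id s cd.2) | cd <- edge_pairs G]); last first.
  by rewrite -map_comp.
have id_inj : injective (@id (iedge G + 'I_k)) by [].
rewrite (trs_push id_inj s_inj (traceable_edges Gev)).
rewrite Gp push_mk (tpt_lact (trapP P)) mk_tpt; exact: mk_ext.
Qed.

Lemma evals_ract k l (G : graph X k l) t p :
  evable G -> evals G p -> evals (graph_ract G t) (ract p t).
Proof.
move=> Gev; rewrite /evals => Gp.
rewrite [cut_value _](_ : _ = push (sum_map id t^-1%g) id (cut_value G)); last first.
  by rewrite push_prodG; apply: eq_prodG => [[e|a]|c|[e|a]|c].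
have t_inj : injective (sum_map (@id (iedge G)) t^-1%g).
  by apply: bij_inj (sum_map_bij (id_bij _) (injF_bij (@perm_inj _ t^-1%g))).
rewrite (_ : edge_pairs (graph_ract G t) = [seq (sum_map id t^-1%g cd.1, id cd.2) | cd <- edge_pairs G]); last first.
  by rewrite -map_comp.
have id_inj : injective (@id (iedge G + 'I_l)) by [].
rewrite (trs_push t_inj id_inj (traceable_edges Gev)).
rewrite Gp push_mk (tpt_ract (trapP P)) mk_tpt; exact: mk_ext.
Qed.

Lemma enum_void_type (T : finType) : #|T| = 0 -> enum T = [::].
Proof. by rewrite cardE => /size0nil. Qed.

Lemma evals_void : evals (graph_void X) (hunit P).
Proof.
rewrite /evals /edge_pairs enum_void_type ?card_void //= /cut_value /prodG.
rewrite /prodV /prodIO /prodL !big_pred0 ?mul1; try by case.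
by apply: mk_ext => -[].
Qed.

Lemma evals_unit J : oI = Some J -> evals (graph_unit X) J.
Proof.
move=> oIJ; rewrite /evals /edge_pairs enum_void_type ?card_void //=.
rewrite /cut_value /prodG /prodV /prodIO /prodL.
rewrite big_pred0; last by case.
rewrite mul1 [X in mul _ X]big_pred0; last by case.
rewrite mulC mul1 (big_pred1 tt); last by case.
rewrite /iobox oIJ; apply: mk_ext => i; by rewrite ord1.
Qed.

Lemma evals_corolla k l (x : X k l) : evals (corolla x) (phi x).
Proof.
rewrite /evals /edge_pairs enum_void_type ?card_void //=.
rewrite /cut_value /prodG /prodV /prodIO /prodL.
rewrite [X in mul _ X]big_pred0; last by case.
rewrite [X in mul (mul _ X) _]big_pred0; last by case.
rewrite mulC mul1 mulC mul1 (big_pred1 tt); last by case.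
have fib n v :
    fiber_order (@corolla_end n) (@corolla_le n) ->
    fiber_seq (@corolla_end n) (@corolla_le n) v = [tuple of map inr (ord_tuple n)].
  move=> fo; symmetry; apply: fiber_seq_unique => //.
  - by rewrite map_inj_uniq ?val_ord_tuple ?enum_uniq // => ? ? [].
  - by move=> [[]|i]; rewrite inE map_f ?val_ord_tuple ?mem_enum //; case: v.
  - rewrite sorted_map val_ord_tuple; have := iota_sorted 0 n; rewrite -val_enum_ord sorted_map.
    by [].
rewrite /in_seq /out_seq /= !fib; try exact: corolla_order.
rewrite /vbox (mk_words_tuple (phi x) [tuple of map _ _] [tuple of map _ _]).
by apply: mk_ext => i; rewrite !tnth_map tnth_ord_tuple.
Qed.

Section Hcat.
Variables (k l k' l' : nat) (G : graph X k l) (H : graph X k' l').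
Local Notation U := (graph_hcat G H).

Lemma inl_inl_inj A A' B B' : injective (sum_map (@inl A A') (@inl B B')).
Proof. by move=> [a|b] [a'|b'] //= [->]. Qed.

Lemma inr_inr_inj A A' B B' : injective (sum_map (@inr A' A) (@inr B' B)).
Proof. by move=> [a|b] [a'|b'] //= [->]. Qed.

Lemma in_seq_hcatl v : in_seq U (inl v) = map (sum_map inl inl) (in_seq G v).
Proof.
apply: fiber_seq_map (ile_order (g := G)) (ile_order (g := U)) (@inl_inl_inj _ _ _ _) _ _ _.
- by case.
- by move=> [[a|a]|[a|a]] //= _; [exists (inl a) | exists (inr a)].
- by move=> [a|a] [b|b].
Qed.

Lemma in_seq_hcatr v : in_seq U (inr v) = map (sum_map inr inr) (in_seq H v).
Proof.
apply: fiber_seq_map (ile_order (g := H)) (ile_order (g := U)) (@inr_inr_inj _ _ _ _) _ _ _.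
- by case.
- by move=> [[a|a]|[a|a]] //= _; [exists (inl a) | exists (inr a)].
- by move=> [a|a] [b|b].
Qed.

Lemma out_seq_hcatl v : out_seq U (inl v) = map (sum_map inl inl) (out_seq G v).
Proof.
apply: fiber_seq_map (ole_order (g := G)) (ole_order (g := U)) (@inl_inl_inj _ _ _ _) _ _ _.
- by case.
- by move=> [[a|a]|[a|a]] //= _; [exists (inl a) | exists (inr a)].
- by move=> [a|a] [b|b].
Qed.

Lemma out_seq_hcatr v : out_seq U (inr v) = map (sum_map inr inr) (out_seq H v).
Proof.
apply: fiber_seq_map (ole_order (g := H)) (ole_order (g := U)) (@inr_inr_inj _ _ _ _) _ _ _.
- by case.
- by move=> [[a|a]|[a|a]] //= _; [exists (inl a) | exists (inr a)].
- by move=> [a|a] [b|b].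
Qed.

Lemma prodG_hcat (C D : eqType) cl ci dl di :
  prodG (C := C) (D := D) (G := U) cl ci dl di =
  mul (prodG (G := G) (cl \o sum_map inl inl) (ci \o inl) (dl \o sum_map inl inl) (di \o inl))
      (prodG (G := H) (cl \o sum_map inr inr) (ci \o inr) (dl \o sum_map inr inr) (di \o inr)).
Proof.
rewrite /prodG /prodV /prodIO /prodL !big_sumType /=.
rewrite [RHS]Monoid.mulmACA; congr mul; rewrite [RHS]Monoid.mulmACA; congr (mul (mul _ _) _).
  by apply: eq_bigr => v _; rewrite in_seq_hcatl out_seq_hcatl -!map_comp.
by apply: eq_bigr => v _; rewrite in_seq_hcatr out_seq_hcatr -!map_comp.
Qed.

Lemma evable_hcat : evable G -> evable H -> evable U.
Proof.
rewrite /evable /solar; case: oI => //= /andP[/eqP G1 /eqP G2] /andP[/eqP H1 /eqP H2].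
by rewrite !card_sum G1 G2 H1 H2.
Qed.

(** The edges of the two graphs have different labels: each trace only concerns
    the factor to which its edge belongs ([trs_mul]). *)
Lemma evals_hcat p q : evable G -> evable H ->
  evals G p -> evals H q -> evals U (hcat p q).
Proof.
move=> Gev Hev Gp Hq.
pose i1 n n' := sum_map (@inl (iedge G) (iedge H)) (@lshift n n').
pose i2 n n' := sum_map (@inr (iedge G) (iedge H)) (@rshift n n').
have i1_inj n n' : injective (@i1 n n').
  by move=> [a|a] [b|b] //= [] => [->|/eqP E] //; congr inr; apply: val_inj; apply/eqP.
have i2_inj n n' : injective (@i2 n n').
  move=> [a|a] [b|b] //= [] => [->|/eqP E] //; congr inr; apply: val_inj; apply/eqP.
  by rewrite -(eqn_add2l n).
have i12 n n' a b : i1 n n' a != i2 n n' b.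
  case: a b => [a|a] [b|b] //; apply/eqP => -[] /eqP; rewrite ltn_eqF //.
  exact: leq_trans (ltn_ord a) (leq_addr _ _).
have cutU : cut_value U =
    mul (push (@i1 k k') (@i1 l l') (cut_value G)) (push (@i2 k k') (@i2 l l') (cut_value H)).
  rewrite !push_prodG /cut_value prodG_hcat; congr mul;
    by apply: eq_prodG => [[e|a]|c|[e|a]|c].
pose s1 := [seq (i1 k k' cd.1, i1 l l' cd.2) | cd <- edge_pairs G].
pose s2 := [seq (i2 k k' cd.1, i2 l l' cd.2) | cd <- edge_pairs H].
have Ut := traceable_edges (evable_hcat Gev Hev).
have perm12 : perm_eq (edge_pairs U) (s1 ++ s2).
  apply: uniq_perm.
  - by rewrite map_inj_uniq ?enum_uniq // => ? ? [->].
  - rewrite cat_uniq; apply/and3P; split.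
    + by rewrite /s1 -map_comp map_inj_uniq ?enum_uniq // => ? ? [->].
    + by apply/hasP => -[_ /mapP[_ /mapP[e _ ->] ->] /mapP[_ /mapP[e' _ ->]]].
    + by rewrite /s2 -map_comp map_inj_uniq ?enum_uniq // => ? ? [->].
  - move=> a; rewrite mem_cat; apply/mapP/orP => [[[e|e] _ ->]|[]/mapP[_ /mapP[e _ ->] ->]].
    + by left; rewrite /s1 -map_comp; apply/mapP; exists e; rewrite ?mem_enum.
    + by right; rewrite /s2 -map_comp; apply/mapP; exists e; rewrite ?mem_enum.
    + by exists (inl e); rewrite ?mem_enum.
    + by exists (inr e); rewrite ?mem_enum.
have Gt := traceable_edges Gev; have Ht := traceable_edges Hev.
have mem1 cd : cd \in s1 -> exists e, cd = (inl (inl e), inl (inl e)).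
  by move=> /mapP[_ /mapP[e _ ->] ->]; exists e.
have mem2 cd : cd \in s2 -> exists e, cd = (inl (inr e), inl (inr e)).
  by move=> /mapP[_ /mapP[e _ ->] ->]; exists e.
rewrite /evals (trs_perm perm12 Ut) trs_cat cutU [mul _ _]mulC trs_mul; first last.
- by move=> cd /mem2[e ->]; apply: out_count_push0 => -[].
- by move=> cd /mem2[e ->]; apply: in_count_push0 => -[].
- exact: traceable_push (i2_inj k k') (i2_inj l l') Ht.
rewrite (trs_push (i2_inj k k') (i2_inj l l') Ht) Hq mulC trs_mul; first last.
- by move=> cd /mem1[e ->]; apply: out_count_push0 => -[].
- by move=> cd /mem1[e ->]; apply: in_count_push0 => -[].
- exact: traceable_push (i1_inj k k') (i1_inj l l') Gt.
rewrite (trs_push (i1_inj k k') (i1_inj l l') Gt) Gp !push_mk mul_mk; apply: mk_ext; apply: ord_sumP => i;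
  by rewrite ?ujoinl ?ujoinr.
Qed.

End Hcat.

Section Reglued.
Variables (k l : nat) (G : graph X k.+1 l.+1).
Variables (e : inp G + inout G) (f : outp G + inout G) (E I O IO L : finType).
Variables (end_in : E + I -> iedge G + inp G) (end_out : E + O -> iedge G + outp G).
Variables (lab_in : I + IO -> inp G + inout G) (lab_out : O + IO -> outp G + inout G).
Hypotheses (end_in_bij : bijective end_in) (end_out_bij : bijective end_out).
Hypotheses (lab_inP : onto_but e lab_in) (lab_outP : onto_but f lab_out).
Let R := reglue L end_in_bij end_out_bij lab_inP lab_outP.

Lemma in_seq_reglue v : map end_in (in_seq R v) = in_seq G v.
Proof.
symmetry; apply: fiber_seq_map (ile_order (g := R)) (ile_order (g := G)) (bij_inj end_in_bij) _ _ _.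
- by [].
- by move=> a _; have [g _ gK] := end_in_bij; exists (g a).
- by [].
Qed.

Lemma out_seq_reglue v : map end_out (out_seq R v) = out_seq G v.
Proof.
symmetry; apply: fiber_seq_map (ole_order (g := R)) (ole_order (g := G)) (bij_inj end_out_bij) _ _ _.
- by [].
- by move=> a _; have [g _ gK] := end_out_bij; exists (g a).
- by [].
Qed.

(** The vertices of a reglued graph keep their boxes: once its labels are read in
    [G], the flags may bear other labels, and the wires and loops may differ. *)
Lemma push_cut_reglue (C D : eqType) (i : E + 'I_k -> C) (j : E + 'I_l -> D) cl ci dl di :
  i \o in_label (G := R) =1 cl \o end_in -> i \o io_in_label (G := R) =1 ci ->
  j \o out_label (G := R) =1 dl \o end_out -> j \o io_out_label (G := R) =1 di ->
  push i j (cut_value R) = mul (mul (prodV (G := G) cl dl) (prodIO ci di)) (prodL C D L).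
Proof.
move=> /funext E1 /funext E2 /funext E3 /funext E4.
rewrite push_prodG E1 E2 E3 E4 /prodG; congr (mul (mul _ _) _).
by apply: eq_bigr => v _; rewrite -in_seq_reglue -out_seq_reglue -!map_comp.
Qed.

(** After reading the labels of the reglued graph in [G], a partial trace removes
    two labels and leaves the other ones unchanged: this is the form in which
    the two values are compared. *)
Lemma evals_reglue p (i : E + 'I_k -> iedge G + 'I_k.+1) (j : E + 'I_l -> iedge G + 'I_l.+1) :
  evable R -> evals G p ->
  injective i -> injective j ->
  i \o inr =1 inr \o lift (ilab G e) -> j \o inr =1 inr \o lift (olab G f) ->
  trs [seq (i cd.1, j cd.2) | cd <- edge_pairs R] (push i j (cut_value R)) =
    tr (inr (ilab G e)) (inr (olab G f)) (trs (edge_pairs G) (cut_value G)) ->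
  evals R (ptr (ilab G e) (olab G f) p).
Proof.
move=> Rev Gp i_inj j_inj ie jf.
rewrite (trs_push i_inj j_inj (traceable_edges Rev)) Gp.
rewrite (@tr_mk _ _ _ k l _ _ _ (ilab G e) (olab G f)) //.
- move=> E1; apply: (push_inj i_inj j_inj); rewrite E1 push_mk; exact: mk_ext.
- by rewrite in_count_mk (card_lift _ (ilab G e)) eqxx eq_card0 // => m;
    rewrite inE; apply/negP => /eqP [] /eqP; rewrite eq_sym (negbTE (neq_lift _ _)).
- by rewrite out_count_mk (card_lift _ (olab G f)) eqxx eq_card0 // => m;
    rewrite inE; apply/negP => /eqP [] /eqP; rewrite eq_sym (negbTE (neq_lift _ _)).
Qed.

End Reglued.

Section Join.
Variables (k l : nat) (G : graph X k.+1 l.+1).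

(** The two halves of the new edge are the traced input and the traced output. *)
Definition label_in_new_edge E n (i : 'I_n.+1) (x : option E + 'I_n) : E + 'I_n.+1 :=
  match x with
  | inl (Some e) => inl e | inl None => inr i | inr m => inr (lift i m)
  end.

Lemma label_in_new_edge_inj E n (i : 'I_n.+1) : injective (@label_in_new_edge E n i).
Proof.
case=> [[e|]|m] [[e'|]|m'] //=; first by case=> ->.
- by case=> /eqP; rewrite (negbTE (neq_lift _ _)).
- by case=> /eqP; rewrite eq_sym (negbTE (neq_lift _ _)).
- by case=> E'; congr inr; apply: (@lift_inj _ i); apply: val_inj.
Qed.

Definition label_in (E : Type) n (i : 'I_n.+1) : E + 'I_n -> E + 'I_n.+1 := sum_map id (lift i).

Lemma label_in_inj E n (i : 'I_n.+1) : injective (@label_in E n i).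
Proof. move=> [e|m] [e'|m'] //= [] E'; first by rewrite E'.
by congr inr; apply: (@lift_inj _ i); apply: val_inj. Qed.

Variable p : P k.+1 l.+1.
Hypotheses (Gev : evable G) (Gp : evals G p).

(** Cutting the new edge gives the cut graph [G] back: the partial trace is just
    the trace along one more edge. *)
Lemma evals_join_edge a b :
  evals (graph_join (G := G) (inl a) (inl b)) (ptr (ilab G (inl a)) (olab G (inl b)) p).
Proof.
have Rev : evable (graph_join (G := G) (inl a) (inl b)).
  by move: Gev; rewrite /evable; case: oI => //= /solar_join; apply.
apply: (evals_reglue (i := @label_in_new_edge _ _ (ilab G (inl a)))
  (j := @label_in_new_edge _ _ (olab G (inl b)))) => //; try exact: label_in_new_edge_inj.
rewrite (push_cut_reglue (cl := in_label (G := G)) (ci := io_in_label (G := G))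
  (dl := out_label (G := G)) (di := io_out_label (G := G))).
- by rewrite /edge_pairs enum_optionE /= -!map_comp.
- by move=> [[x|]|x] //; rewrite /= lift_cut_lab.
- by move=> c; rewrite /= /io_in_label lift_cut_lab.
- by move=> [[x|]|x] //; rewrite /= lift_cut_lab.
- by move=> c; rewrite /= /io_out_label lift_cut_lab.
Qed.

(** If the partial trace creates no internal edge, it can be performed before the
    edges are closed ([trs_tr]). *)
Lemma evals_reglue_keep e f (I O IO L : finType)
    (end_in : iedge G + I -> iedge G + inp G) (end_out : iedge G + O -> iedge G + outp G)
    (lab_in : I + IO -> inp G + inout G) (lab_out : O + IO -> outp G + inout G)
    (end_in_bij : bijective end_in) (end_out_bij : bijective end_out)
    (lab_inP : onto_but e lab_in) (lab_outP : onto_but f lab_out) :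
  let R := reglue L end_in_bij end_out_bij lab_inP lab_outP in
  isSome oI ->
  push (@label_in _ _ (ilab G e)) (@label_in _ _ (olab G f)) (cut_value R) =
    tr (inr (ilab G e)) (inr (olab G f)) (cut_value G) ->
  evals R (ptr (ilab G e) (olab G f) p).
Proof.
move=> R oIs cutR.
have Rev : evable R by rewrite /evable oIs.
apply: (evals_reglue (i := @label_in _ _ (ilab G e)) (j := @label_in _ _ (olab G f))) => //;
  try exact: label_in_inj.
rewrite cutR [X in trs X _](_ : _ = edge_pairs G); last by rewrite /edge_pairs -map_comp.
apply: trs_tr; have [u1 u2 h1 h2] := traceable_edges Gev; split=> /=.
- by rewrite u1 andbT; apply/negP => /mapP[_ /mapP[x _ ->]].
- by rewrite u2 andbT; apply/negP => /mapP[_ /mapP[x _ ->]].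
- by move=> cd _; apply: in_count_cut_value.
- by move=> cd _; apply: out_count_cut_value.
Qed.

Definition rest_value (a : inout G) : lab P (iedge G + 'I_k.+1) (iedge G + 'I_l.+1) :=
  mul (mul (prodV (in_label (G := G)) (out_label (G := G)))
    (\big[@mul P _ _/one P _ _]_(c | c != a) iobox (io_in_label c) (io_out_label c)))
    (prodL _ _ (loop G)).

Variable J : P 1 1.
Hypothesis oIJ : oI = Some J.

Lemma cut_value_inout a :
  cut_value G = mul (wire J (io_in_label a) (io_out_label a)) (rest_value a).
Proof.
rewrite /cut_value /prodG /rest_value {1}/prodIO (bigD1 a) //= {1}/iobox oIJ.
by rewrite [X in mul X _]mulCA -[LHS]mulA.
Qed.

Lemma in_count_rest a c : in_count (rest_value a) c = (io_in_label a != c).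
Proof.
have := in_count_cut_value c Gev; rewrite (cut_value_inout a) in_count_mul in_count_wire.
by case: eqP => // _; rewrite ?add1n ?add0n => -[].
Qed.

Lemma out_count_rest a d : out_count (rest_value a) d = (io_out_label a != d).
Proof.
have := out_count_cut_value d Gev; rewrite (cut_value_inout a) out_count_mul out_count_wire.
by case: eqP => // _; rewrite ?add1n ?add0n => -[].
Qed.

Lemma rename_neq (A : eqType) (a b x : A) : x != a -> rename a b x = x.
Proof. by rewrite /rename => /negbTE->. Qed.

Lemma rename_eq (A : eqType) (a b : A) : rename a b a = b.
Proof. by rewrite /rename eqxx. Qed.

Lemma olab_eq x y : (olab G x == olab G y) = (x == y).
Proof. exact: inj_eq (bij_inj (olab_bij G)) x y. Qed.

Lemma ilab_eq x y : (ilab G x == ilab G y) = (x == y).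
Proof. exact: inj_eq (bij_inj (ilab_bij G)) x y. Qed.

Lemma push_rest (C D : eqType) h h' a :
  push h h' (rest_value a) =
  mul (mul (prodV (G := G) (h \o in_label (G := G)) (h' \o out_label (G := G)))
    (\big[@mul P _ _/one P _ _]_(c | c != a) iobox (h (io_in_label c)) (h' (io_out_label c))))
    (prodL C D (loop G)).
Proof.
rewrite !push_mul !push_big; congr (mul (mul _ _) _); apply: eq_bigr => v _.
- by rewrite push_mk_words ?size_map ?size_in_seq ?size_out_seq // -!map_comp.
- exact: push_iobox.
- exact: push_lbox.
Qed.

(** The output [b] is closed onto the wire [a], whose output it becomes. *)
Lemma evals_join_outp a b :
  evals (graph_join (G := G) (inr a) (inl b)) (ptr (ilab G (inr a)) (olab G (inl b)) p).
Proof.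
have ab : io_out_label a != inr (olab G (inl b)).
  by rewrite /io_out_label; apply/eqP => -[] /eqP; rewrite olab_eq.
apply: evals_reglue_keep; first by rewrite oIJ.
rewrite (cut_value_inout a) (tr_wire_out (oI_unit oIJ)) ?out_count_rest ?in_count_rest ?eqxx ?ab //.
rewrite push_rest -big_sig.
pose r := rename (inr (olab G (inl b))) (@inr (iedge G) _ (olab G (inr a))).
rewrite (push_cut_reglue (cl := in_label (G := G)) (ci := fun c : but a => io_in_label (val c))
  (dl := r \o out_label (G := G)) (di := fun c : but a => r (io_out_label (val c)))) //.
- by move=> [x|x] //; rewrite /= lift_cut_lab.
- by move=> c; rewrite /= lift_cut_lab.
- move=> [x|[x|]] //; rewrite /= lift_cut_lab /r /= ?rename_eq // rename_neq //.
  by apply/eqP => -[] /eqP; rewrite olab_eq => /eqP[E']; case: x E' => x /= /eqP.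
- move=> c; rewrite /= lift_cut_lab /r /= rename_neq //.
  by apply/eqP => -[] /eqP; rewrite olab_eq.
Qed.

Lemma evals_join_inp a b :
  evals (graph_join (G := G) (inl a) (inr b)) (ptr (ilab G (inl a)) (olab G (inr b)) p).
Proof.
have ba : io_in_label b != inr (ilab G (inl a)).
  by rewrite /io_in_label; apply/eqP => -[] /eqP; rewrite ilab_eq.
apply: evals_reglue_keep; first by rewrite oIJ.
rewrite (cut_value_inout b) (tr_wire_in (oI_unit oIJ)) ?out_count_rest ?in_count_rest ?eqxx ?ba //.
rewrite push_rest -big_sig.
pose r := rename (inr (ilab G (inl a))) (@inr (iedge G) _ (ilab G (inr b))).
rewrite (push_cut_reglue (dl := out_label (G := G)) (di := fun c : but b => io_out_label (val c))
  (cl := r \o in_label (G := G)) (ci := fun c : but b => r (io_in_label (val c)))) //.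
- move=> [x|[x|]] //; rewrite /= lift_cut_lab /r /= ?rename_eq // rename_neq //.
  by apply/eqP => -[] /eqP; rewrite ilab_eq => /eqP[E']; case: x E' => x /= /eqP.
- move=> c; rewrite /= lift_cut_lab /r /= rename_neq //.
  by apply/eqP => -[] /eqP; rewrite ilab_eq.
- by move=> [x|x] //; rewrite /= lift_cut_lab.
- by move=> c; rewrite /= lift_cut_lab.
Qed.

(** Two wires compose to a wire, and a wire closed onto itself is a loop. *)
Lemma evals_join_inout a b :
  evals (graph_join (G := G) (inr a) (inr b)) (ptr (ilab G (inr a)) (olab G (inr b)) p).
Proof.
rewrite /graph_join; case: eqP => ab; (apply: evals_reglue_keep; first by rewrite oIJ).
  subst b; rewrite (cut_value_inout a) tr_mul ?in_count_rest ?out_count_rest ?in_count_wire ?out_count_wire ?eqxx //.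
  rewrite tr_wire.
  rewrite (push_cut_reglue (cl := in_label (G := G)) (ci := fun c : but a => io_in_label (val c))
    (dl := out_label (G := G)) (di := fun c : but a => io_out_label (val c))).
  - rewrite /rest_value -big_sig /prodL big_option mulCA /lbox.
    by case: oI oIJ => // _ [->].
  - by move=> [x|x] //; rewrite /= lift_cut_lab.
  - by move=> c; rewrite /= lift_cut_lab.
  - by move=> [x|x] //; rewrite /= lift_cut_lab.
  - by move=> c; rewrite /= lift_cut_lab.
have neq_ab : io_out_label a != inr (olab G (inr b)).
  by rewrite /io_out_label; apply/eqP => -[] /eqP; rewrite olab_eq => /eqP[].
rewrite (cut_value_inout a) (tr_wire_out (oI_unit oIJ)) ?out_count_rest ?in_count_rest ?eqxx ?neq_ab //.
pose r := rename (inr (olab G (inr b))) (@inr (iedge G) _ (olab G (inr a))).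
rewrite push_rest (bigD1 b) /=; last by apply/eqP => ba; apply: ab.
pose ci (c : option (but2 a b)) := if c is Some x then io_in_label (val x) else io_in_label b.
pose di (c : option (but2 a b)) :=
  if c is Some x then r (io_out_label (val x)) else r (io_out_label b).
rewrite (push_cut_reglue (cl := in_label (G := G)) (ci := ci)
  (dl := r \o out_label (G := G)) (di := di)).
- rewrite [prodIO _ _]big_option /=.
  rewrite (big_sig _ _ (fun c => iobox (io_in_label c) (r (io_out_label c)))).
  by [].
- by move=> [x|x] //; rewrite /= lift_cut_lab.
- by move=> [c|]; rewrite /= lift_cut_lab.
- move=> [x|x] //; rewrite /= lift_cut_lab /r /= rename_neq //.
  by apply/eqP => -[] /eqP; rewrite olab_eq.
- move=> [c|]; rewrite /= lift_cut_lab /r /=; last by rewrite rename_eq.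
  rewrite rename_neq //; apply/eqP => -[] /eqP; rewrite olab_eq => /eqP[E'].
  by case: c E' => x /= /andP[_ /eqP].
Qed.

End Join.

Lemma evals_ptr k l (G : graph X k.+1 l.+1) i j p :
  evable G -> evals G p -> evals (graph_ptr G i j) (ptr i j p).
Proof.
move=> Gev Gp; rewrite /graph_ptr.
have ei := f_iinv (ilab_codom G i); have fj := f_iinv (olab_codom G j).
move: (iinv _) (iinv _) ei fj => f e <- <-.
have io_unit (a : inout G) : exists J, oI = Some J.
  move: Gev; rewrite /evable; case: oI => [J _|]; first by exists J.
  by move=> /andP[/eqP/card0_eq/(_ a)].
case: e f => [a|a] [b|b].
- exact: evals_join_edge.
- by have [J oIJ] := io_unit b; exact: (evals_join_inp Gev Gp oIJ a b).
- by have [J oIJ] := io_unit a; exact: (evals_join_outp Gev Gp oIJ a b).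
- by have [J oIJ] := io_unit a; exact: (evals_join_inout Gev Gp oIJ a b).
Qed.

End Eval.

(** * Graphs as wirings *)

(** Up to isomorphism, a graph consists of decorated vertices with their outgoing
    flags [wD] and incoming flags [wC], of the matching [wR] of the starting
    points of its strands (outgoing flags and inputs) with their end points
    (incoming flags and outputs), and of the number [wL] of its loops.  The kinds
    of edges, and with them the five cases of the partial traces, disappear. *)
Record wiring (X : nat -> nat -> Type) (k l : nat) := Wiring {
  wV : finType; wD : finType; wC : finType;
  wsrc : wD -> wV; wtgt : wC -> wV;
  wole : rel wD; wile : rel wC;
  wdeco : wV -> {kl : nat * nat & X kl.1 kl.2};
  wR : wD + 'I_k -> wC + 'I_l -> bool;
  wL : nat }.

Arguments wsrc {X k l} W _ : rename.
Arguments wtgt {X k l} W _ : rename.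
Arguments wole {X k l} W _ _ : rename.
Arguments wile {X k l} W _ _ : rename.
Arguments wdeco {X k l} W _ : rename.
Arguments wR {X k l} W _ _ : rename.

(** The strand starting at [a]: it leaves an output of a vertex or an input of
    the graph, and reaches an input of a vertex or an output of the graph. *)
Definition strand (X : nat -> nat -> Type) k l (G : graph X k l) (a : (iedge G + outp G) + 'I_k) :
    (iedge G + inp G) + 'I_l :=
  match a with
  | inl (inl e) => inl (inl e)
  | inl (inr b) => inr (olab G (inl b))
  | inr i => match binv (Bij (ilab_bij G)) i with
    | inl a => inl (inr a) | inr c => inr (olab G (inr c)) end
  end.
Arguments strand {X k l} G a : simpl never.

Section Wirings.
Variable X : nat -> nat -> Type.
Implicit Types k l : nat.

Record wiring_iso k l (W W' : wiring X k l) := WiringIso {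
  hV : bij (wV W) (wV W'); hD : bij (wD W) (wD W'); hC : bij (wC W) (wC W');
  hsrc : forall d, wsrc W' (hD d) = hV (wsrc W d);
  htgt : forall c, wtgt W' (hC c) = hV (wtgt W c);
  hole : forall c d, wsrc W c = wsrc W d -> wole W' (hD c) (hD d) = wole W c d;
  hile : forall c d, wtgt W c = wtgt W d -> wile W' (hC c) (hC d) = wile W c d;
  hdeco : forall v, wdeco W' (hV v) = wdeco W v;
  hR : forall a b, wR W' (sum_map hD id a) (sum_map hC id b) = wR W a b;
  hL : wL W' = wL W }.

Definition weq k l (W W' : wiring X k l) : Prop := inhabited (wiring_iso W W').

Lemma weq_refl k l (W : wiring X k l) : weq W W.
Proof. by constructor; exists (bid _) (bid _) (bid _) => // -[a|a] [b|b]. Qed.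

Lemma weq_sym k l (W W' : wiring X k l) : weq W W' -> weq W' W.
Proof.
case=> h; constructor; exists (binv (hV h)) (binv (hD h)) (binv (hC h)).
- by move=> d; apply: (@bij_injective _ _ (hV h)); rewrite -hsrc /= !bijVK.
- by move=> d; apply: (@bij_injective _ _ (hV h)); rewrite -htgt /= !bijVK.
- move=> c d cd; rewrite -[in RHS](bijVK (hD h) c) -[in RHS](bijVK (hD h) d) hole //.
  by apply: (@bij_injective _ _ (hV h)); rewrite -!hsrc /= !bijVK.
- move=> c d cd; rewrite -[in RHS](bijVK (hC h) c) -[in RHS](bijVK (hC h) d) hile //.
  by apply: (@bij_injective _ _ (hV h)); rewrite -!htgt /= !bijVK.
- by move=> v; rewrite -(hdeco h) /= bijVK.
- by move=> a b; rewrite -(hR h); congr wR; [case: a | case: b] => c /=; rewrite ?bijVK.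
- by rewrite (hL h).
Qed.

Lemma weq_trans k l (W W' W'' : wiring X k l) : weq W W' -> weq W' W'' -> weq W W''.
Proof.
case=> h [h']; constructor.
exists (bcomp (hV h') (hV h)) (bcomp (hD h') (hD h)) (bcomp (hC h') (hC h)) => /=.
- by move=> d; rewrite !hsrc.
- by move=> d; rewrite !htgt.
- by move=> c d cd; rewrite !hole // !hsrc cd.
- by move=> c d cd; rewrite !hile // !htgt cd.
- by move=> v; rewrite !hdeco.
- by move=> a b; rewrite -(hR h) -(hR h'); congr wR; [case: a | case: b].
- by rewrite (hL h') (hL h).
Qed.

Lemma strand_edge k l (G : graph X k l) e : strand G (inl (inl e)) = inl (inl e).
Proof. by []. Qed.

Lemma strand_outp k l (G : graph X k l) b : strand G (inl (inr b)) = inr (olab G (inl b)).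
Proof. by []. Qed.

Lemma strand_in k l (G : graph X k l) a : strand G (inr (ilab G (inl a))) = inl (inr a).
Proof. by rewrite /strand /= (bijK (Bij (ilab_bij G))). Qed.

Lemma strand_inout k l (G : graph X k l) c :
  strand G (inr (ilab G (inr c))) = inr (olab G (inr c)).
Proof. by rewrite /strand /= (bijK (Bij (ilab_bij G))). Qed.

Definition strandE := (strand_edge, strand_outp, strand_in, strand_inout).

Lemma ilabP k l (G : graph X k l) (Q : 'I_k -> Prop) :
  (forall x, Q (ilab G x)) -> forall i, Q i.
Proof. by move=> QG i; have [g _ gK] := ilab_bij G; rewrite -(gK i). Qed.

Lemma strandP k l (G : graph X k l) (Q : (iedge G + outp G) + 'I_k -> Prop) :
  (forall e, Q (inl (inl e))) -> (forall b, Q (inl (inr b))) ->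
  (forall a, Q (inr (ilab G (inl a)))) -> (forall c, Q (inr (ilab G (inr c)))) ->
  forall x, Q x.
Proof.
move=> Qe Qb Qa Qc [[e|b]|i] //; move: i; apply: (ilabP (G := G)) => -[a|c]; by [].
Qed.

Lemma strand_inj k l (G : graph X k l) : injective (strand G).
Proof.
apply: strandP => [e|b|a|c]; apply: strandP => [e'|b'|a'|c'];
  rewrite !strandE //.
- by case=> ->.
- by case=> /(bij_inj (olab_bij G))[->].
- by case=> /(bij_inj (olab_bij G)).
- by case=> ->.
- by case=> /(bij_inj (olab_bij G)).
- by case=> /(bij_inj (olab_bij G))[->].
Qed.

Definition wir k l (G : graph X k l) : wiring X k l := {|
  wV := vert G; wD := (iedge G + outp G)%type; wC := (iedge G + inp G)%type;
  wsrc := src G; wtgt := tgt G; wole := ole G; wile := ile G; wdeco := deco G;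
  wR := fun a b => strand G a == b; wL := #|loop G| |}.

Lemma iso_weq k l (G H : graph X k l) : isomorphic G H -> weq (wir G) (wir H).
Proof.
case=> h; constructor.
pose hD := Bij (sum_map_bij (isoE_bij h) (isoO_bij h)).
pose hC := Bij (sum_map_bij (isoE_bij h) (isoI_bij h)).
have strandH a : strand H (sum_map hD id a) = sum_map hC id (strand G a).
  move: a; apply: (strandP (G := G)) => [e|b|a|c] /=.
  - by rewrite !strandE.
  - by rewrite !strandE /= -(iso_olab h (inl b)).
  - by rewrite [in RHS]strandE -(iso_ilab h (inl a)) /= strandE.
  - by rewrite [in RHS]strandE -(iso_ilab h (inr c)) /= strandE -(iso_olab h (inr c)).
exists (Bij (isoV_bij h)) hD hC => /=.
- by move=> d; rewrite iso_src.
- by move=> d; rewrite iso_tgt.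
- by move=> c d cd; rewrite iso_ole.
- by move=> c d cd; rewrite iso_ile.
- by move=> v; rewrite iso_deco.
- move=> a b; rewrite strandH; apply: inj_eq => -[x|x] [y|y] //= [].
    by move/(bij_injective (f := hC))->.
  by move=> ->.
- by rewrite (bij_eq_card (isoL_bij h)).
Qed.

Section WeqIso.
Variables (k l : nat) (G H : graph X k l) (h : wiring_iso (wir G) (wir H)).

Lemma strand_iso a : strand H (sum_map (hD h) id a) = sum_map (hC h) id (strand G a).
Proof. by apply/eqP; have := hR h a (strand G a); rewrite /= eqxx => ->. Qed.

Lemma iso_edge e : exists e', hD h (inl e) = inl e' /\ hC h (inl e) = inl e'.
Proof.
have := strand_iso (inl (inl e)); rewrite strandE /=; case: (hD h (inl e)) => e' //; rewrite strandE => -[E].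
by exists e'.
Qed.

Lemma iso_outp b : exists b', hD h (inr b) = inr b' /\ olab H (inl b') = olab G (inl b).
Proof.
have := strand_iso (inl (inr b)); rewrite strandE /=; case: (hD h (inr b)) => b' //; rewrite strandE => -[E].
by exists b'.
Qed.

Lemma iso_inp a : exists a', hC h (inr a) = inr a' /\ ilab H (inl a') = ilab G (inl a).
Proof.
have := strand_iso (inr (ilab G (inl a))); rewrite strandE /=.
have [g _ gK] := ilab_bij H; rewrite -[X in strand H (inr X)]gK.
case E: (g _) => [a'|c']; rewrite strandE //= => -[<-].
by exists a'; rewrite -E gK.
Qed.

Lemma iso_inout c : exists c', ilab H (inr c') = ilab G (inr c) /\ olab H (inr c') = olab G (inr c).
Proof.
have := strand_iso (inr (ilab G (inr c))); rewrite strandE /=.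
have [g _ gK] := ilab_bij H; rewrite -[X in strand H (inr X)]gK.
case E: (g _) => [a'|c']; rewrite strandE //= => -[E'].
by exists c'; rewrite -E gK.
Qed.

End WeqIso.

Lemma bij_of_card (A B : finType) : #|A| = #|B| -> {f : A -> B | bijective f}.
Proof.
move=> AB; exists (fun a => enum_val (cast_ord AB (enum_rank a))).
exists (fun b => enum_val (cast_ord (esym AB) (enum_rank b))) => x;
  by rewrite enum_valK ?cast_ordK ?cast_ordKV enum_rankK.
Qed.

(** The two ends of a strand tell to which kind of edge it belongs, so that an
    isomorphism of wirings respects the kinds of edges. *)
Lemma weq_iso k l (G H : graph X k l) : weq (wir G) (wir H) -> isomorphic G H.
Proof.
move=> GH; have inj_parts (G1 H1 : graph X k l) : weq (wir G1) (wir H1) ->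
    [/\ #|iedge G1| <= #|iedge H1|, #|inp G1| <= #|inp H1|, #|outp G1| <= #|outp H1|
      & #|inout G1| <= #|inout H1|].
  case=> h; have [fE hE] := choice (iso_edge h); have [fO hO] := choice (iso_outp h).
  have [fI hI] := choice (iso_inp h); have [fIO hIO] := choice (iso_inout h); split.
  - apply: (@leq_card _ _ fE) => x y E; have := (hE x).1.
    by rewrite E -(hE y).1 => /(bij_injective (f := hD h)) [].
  - apply: (@leq_card _ _ fI) => x y E; have := (hI x).1.
    by rewrite E -(hI y).1 => /(bij_injective (f := hC h)) [].
  - apply: (@leq_card _ _ fO) => x y E; have := (hO x).1.
    by rewrite E -(hO y).1 => /(bij_injective (f := hD h)) [].
  - apply: (@leq_card _ _ fIO) => x y E; have := (hIO x).1.
    by rewrite E (hIO y).1 => /(bij_inj (ilab_bij G1))[].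
have [le1 le2 le3 le4] := inj_parts _ _ (weq_sym GH).
case: GH => h.
have [fE hE] := choice (iso_edge h); have [fO hO] := choice (iso_outp h).
have [fI hI] := choice (iso_inp h); have [fIO hIO] := choice (iso_inout h).
have [fL fL_bij] : {f : loop G -> loop H | bijective f} by apply: bij_of_card; apply: esym (hL h).
have DE a : sum_map fE fO a = hD h a by case: a => c /=; rewrite ?(hE c).1 ?(hO c).1.
have CE a : sum_map fE fI a = hC h a by case: a => c /=; rewrite ?(hE c).2 ?(hI c).1.
constructor; exists (hV h) fE fI fO fIO fL => //.
- exact: bijP.
- apply: inj_card_bij => // x y E; have := (hE x).1.
  by rewrite E -(hE y).1 => /(bij_injective (f := hD h)) [].
- apply: inj_card_bij => // x y E; have := (hI x).1.
  by rewrite E -(hI y).1 => /(bij_injective (f := hC h)) [].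
- apply: inj_card_bij => // x y E; have := (hO x).1.
  by rewrite E -(hO y).1 => /(bij_injective (f := hD h)) [].
- apply: inj_card_bij => // x y E; have := (hIO x).1.
  by rewrite E (hIO y).1 => /(bij_inj (ilab_bij G))[].
- by move=> a; rewrite DE; apply: (hsrc h).
- by move=> a; rewrite CE; apply: (htgt h).
- by move=> [a|c] /=; rewrite ?(hI a).2 ?(hIO c).1.
- by move=> [b|c] /=; rewrite ?(hO b).2 ?(hIO c).2.
- by move=> a b ab; rewrite !CE; apply: (hile h).
- by move=> a b ab; rewrite !DE; apply: (hole h).
- by move=> v; apply: (hdeco h).
Qed.

End Wirings.

Section WiringOperations.
Variable X : nat -> nat -> Type.
Implicit Types k l : nat.

Definition rewire k l k' l' (W : wiring X k l)
    (R : wD W + 'I_k' -> wC W + 'I_l' -> bool) (n : nat) : wiring X k' l' := {|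
  wV := wV W; wD := wD W; wC := wC W; wsrc := wsrc W; wtgt := wtgt W;
  wole := wole W; wile := wile W; wdeco := wdeco W; wR := R; wL := n |}.

Lemma weq_rewire k l k' l' (W : wiring X k l) R R' n n' :
  R =2 R' -> n = n' -> weq (@rewire k l k' l' W R n) (rewire R' n').
Proof.
move=> RR <-; have -> : R = R' by apply: funext => a; apply: funext => b; apply: RR.
exact: weq_refl.
Qed.

Lemma weq_rewire_iso k l k' l' (W W' : wiring X k l) (h : wiring_iso W W') R R' n n' :
  (forall a b, R' (sum_map (hD h) id a) (sum_map (hC h) id b) = R a b) -> n' = n ->
  weq (@rewire k l k' l' W R n) (@rewire k l k' l' W' R' n').
Proof.
move=> RR nn; case: h RR => fV fD fC *; constructor.
by exists (fV : bij (wV (rewire R n)) (wV (rewire R' n')))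
  (fD : bij (wD (rewire R n)) (wD (rewire R' n')))
  (fC : bij (wC (rewire R n)) (wC (rewire R' n'))).
Qed.

Definition wlact k l (s : 'S_l) (W : wiring X k l) : wiring X k l :=
  rewire (fun a b => wR W a (sum_map id s^-1%g b)) (wL W).

Definition wract k l (W : wiring X k l) (t : 'S_k) : wiring X k l :=
  rewire (fun a b => wR W (sum_map id t a) b) (wL W).

Definition wcast k k' l l' (ek : k = k') (el : l = l') (W : wiring X k l) : wiring X k' l' :=
  rewire (fun a b => wR W (sum_map id (cast_ord (esym ek)) a)
                          (sum_map id (cast_ord (esym el)) b)) (wL W).

(** Closing the output [j] onto the input [i] prolongs the strand ending at [j]
    by the strand starting at [i], and creates a loop when they are the same
    strand. *)
Definition wptr k l (i : 'I_k.+1) (j : 'I_l.+1) (W : wiring X k.+1 l.+1) : wiring X k l :=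
  rewire (fun a b =>
    wR W (sum_map id (lift i) a) (sum_map id (lift j) b) ||
    wR W (sum_map id (lift i) a) (inr j) && wR W (inr i) (sum_map id (lift j) b))
   (wL W + wR W (inr i) (inr j)).

(** The components from which a start or end point of a disjoint union comes. *)
Definition wsplit D D' k k' (a : (D + D') + 'I_(k + k')) : (D + 'I_k) + (D' + 'I_k') :=
  match a with
  | inl (inl d) => inl (inl d) | inl (inr d) => inr (inl d)
  | inr i => match split i with inl i1 => inl (inr i1) | inr i2 => inr (inr i2) end
  end.

Lemma wsplitl D D' k k' (i : 'I_k) : wsplit (inr (lshift k' i)) = inl (inr i) :> (D + _) + (D' + _).
Proof. by rewrite /= (unsplitK (inl _)). Qed.

Lemma wsplitr D D' k k' (i : 'I_k') : wsplit (inr (rshift k i)) = inr (inr i) :> (D + _) + (D' + _).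
Proof. by rewrite /= (unsplitK (inr _)). Qed.

Lemma wsplit_inj D D' k k' : injective (@wsplit D D' k k').
Proof.
apply: (can_inj (g := fun x => match x with
  | inl (inl d) => inl (inl d) | inl (inr i) => inr (lshift k' i)
  | inr (inl d) => inl (inr d) | inr (inr i) => inr (rshift k i) end)) => -[[d|d]|] //.
by apply: ord_sumP => i; rewrite ?wsplitl ?wsplitr.
Qed.

Definition wjoin_rel A A' B B' (R : A -> B -> bool) (R' : A' -> B' -> bool) (a : A + A') (b : B + B') :=
  match a, b with inl a, inl b => R a b | inr a, inr b => R' a b | _, _ => false end.

Definition whcat k l k' l' (W : wiring X k l) (W' : wiring X k' l') :
    wiring X (k + k') (l + l') := {|
  wV := (wV W + wV W')%type; wD := (wD W + wD W')%type; wC := (wC W + wC W')%type;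
  wsrc := sum_map (wsrc W) (wsrc W'); wtgt := sum_map (wtgt W) (wtgt W');
  wole := sum_rel (wole W) (wole W'); wile := sum_rel (wile W) (wile W');
  wdeco := fun v => match v with inl v => wdeco W v | inr v => wdeco W' v end;
  wR := fun a b => wjoin_rel (wR W) (wR W') (wsplit a) (wsplit b);
  wL := wL W + wL W' |}.

Lemma wR_lact k l (s : 'S_l) (W : wiring X k l) a b :
  wR (wlact s W) a b = wR W a (sum_map id s^-1%g b).
Proof. by []. Qed.

Lemma wR_ract k l (W : wiring X k l) (t : 'S_k) a b :
  wR (wract W t) a b = wR W (sum_map id t a) b.
Proof. by []. Qed.

Lemma wR_ptr k l i j (W : wiring X k.+1 l.+1) a b :
  wR (wptr i j W) a b =
    wR W (sum_map id (lift i) a) (sum_map id (lift j) b) ||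
    wR W (sum_map id (lift i) a) (inr j) && wR W (inr i) (sum_map id (lift j) b).
Proof. by []. Qed.

Lemma wR_hcat k l k' l' (W : wiring X k l) (W' : wiring X k' l') a b :
  wR (whcat W W') a b = wjoin_rel (wR W) (wR W') (wsplit a) (wsplit b).
Proof. by []. Qed.

Lemma wR_cast k k' l l' (ek : k = k') (el : l = l') (W : wiring X k l) a b :
  wR (wcast ek el W) a b = wR W (sum_map id (cast_ord (esym ek)) a)
                                (sum_map id (cast_ord (esym el)) b).
Proof. by []. Qed.

Lemma weq_lact k l s (W W' : wiring X k l) : weq W W' -> weq (wlact s W) (wlact s W').
Proof.
case=> h; apply: (weq_rewire_iso (h := h)); last exact: hL.
by move=> a b; rewrite -(hR h); case: b.
Qed.

Lemma weq_ract k l t (W W' : wiring X k l) : weq W W' -> weq (wract W t) (wract W' t).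
Proof.
case=> h; apply: (weq_rewire_iso (h := h)); last exact: hL.
by move=> a b; rewrite -(hR h); case: a.
Qed.

Lemma weq_ptr k l i j (W W' : wiring X k.+1 l.+1) :
  weq W W' -> weq (wptr i j W) (wptr i j W').
Proof.
case=> h; apply: (weq_rewire_iso (h := h)).
  by move=> a b; rewrite -!(hR h); case: a b => [a|a] [b|b].
by rewrite (hL h) -(hR h).
Qed.

Lemma weq_hcat k l k' l' (W W1 : wiring X k l) (W' W1' : wiring X k' l') :
  weq W W1 -> weq W' W1' -> weq (whcat W W') (whcat W1 W1').
Proof.
case=> h [h']; constructor.
have sp D D1 D' D1' (f : D -> D1) (f' : D' -> D1') m m' (a : (D + D') + 'I_(m + m')) :
    wsplit (sum_map (sum_map f f') id a) = sum_map (sum_map f id) (sum_map f' id) (wsplit a).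
  by case: a => [[d|d]|i] //=; case: split.
exists (bsum_map (hV h) (hV h')) (bsum_map (hD h) (hD h')) (bsum_map (hC h) (hC h')) => /=.
- by case=> d /=; rewrite hsrc.
- by case=> d /=; rewrite htgt.
- by move=> [c|c] [d|d] //= [] cd; rewrite hole.
- by move=> [c|c] [d|d] //= [] cd; rewrite hile.
- by case=> v /=; rewrite hdeco.
- move=> a b; rewrite !sp; case: (wsplit a) => a1; case: (wsplit b) => b1 //=; exact: hR.
- by rewrite (hL h) (hL h').
Qed.

Lemma wir_lact k l s (G : graph X k l) : weq (wir (graph_lact G s)) (wlact s (wir G)).
Proof.
apply: (@weq_rewire k l k l (wir G)) => // a b /=.
have -> : strand (graph_lact G s) a = sum_map id s (strand G a).
  by move: a; apply: (strandP (G := graph_lact G s)) => [e|o|a|c];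
    rewrite strandE /= ?(strand_edge, strand_outp, strand_in (G := G), strand_inout (G := G)).
case: (strand G a) b => [c|j] [c'|j'] //=.
by apply/eqP/eqP => -[] => [<-|->]; rewrite ?permK ?permKV.
Qed.

Lemma wir_ract k l t (G : graph X k l) : weq (wir (graph_ract G t)) (wract (wir G) t).
Proof.
apply: (@weq_rewire k l k l (wir G)) => // a b /=; congr (_ == _).
by move: a; apply: (strandP (G := graph_ract G t)) => [e|o|a|c];
  rewrite strandE /= ?permKV ?(strand_edge, strand_outp, strand_in (G := G), strand_inout (G := G)).
Qed.

Lemma wir_hcat k l k' l' (G : graph X k l) (H : graph X k' l') :
  weq (wir (graph_hcat G H)) (whcat (wir G) (wir H)).
Proof.
pose U := graph_hcat G H.
pose hV : bij (wV (wir U)) (wV (whcat (wir G) (wir H))) := bid (vert G + vert H)%type.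
pose hD : bij (wD (wir U)) (wD (whcat (wir G) (wir H))) :=
  Bij (@sum_swap_bij (iedge G) (outp G) (iedge H) (outp H)).
pose hC : bij (wC (wir U)) (wC (whcat (wir G) (wir H))) :=
  Bij (@sum_swap_bij (iedge G) (inp G) (iedge H) (inp H)).
have strandU a : wsplit (sum_map hC id (strand U a)) =
    sum_map (strand G) (strand H) (wsplit (sum_map hD id a)).
  move: a; apply: (strandP (G := U)) => -[x|x]; rewrite strandE /=;
    by rewrite ?(unsplitK (inl _)) ?(unsplitK (inr _)) /= ?strandE.
have split_inj : injective (fun b : (iedge U + inp U) + 'I_(l + l') => wsplit (sum_map hC id b)).
  have hinj : injective (sum_map hC (@id 'I_(l + l'))) := bij_injective (f := bsum_map hC (bid _)).
  by move=> b b' E; apply: hinj; apply: wsplit_inj.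
constructor; exists hV hD hC => //=.
- move=> a b; rewrite -(inj_eq split_inj) strandU.
  by case: (wsplit _) => x; case: (wsplit _) => y.
- by rewrite card_sum.
Qed.

Section StrandTrace.
Variables (k l : nat) (G : graph X k.+1 l.+1).
Variables (e : inp G + inout G) (f : outp G + inout G) (E I O IO L : finType).
Variables (end_in : E + I -> iedge G + inp G) (end_out : E + O -> iedge G + outp G).
Variables (lab_in : I + IO -> inp G + inout G) (lab_out : O + IO -> outp G + inout G).
Hypotheses (end_in_bij : bijective end_in) (end_out_bij : bijective end_out).
Hypotheses (lab_inP : onto_but e lab_in) (lab_outP : onto_but f lab_out).
Let R := reglue L end_in_bij end_out_bij lab_inP lab_outP.
Let i := ilab G e.
Let j := olab G f.
Let up_out (a : (E + O) + 'I_k) := sum_map end_out (lift i) a.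
Let up_in (b : (E + I) + 'I_l) := sum_map end_in (lift j) b.

Let redirect (x : (iedge G + inp G) + 'I_l.+1) :=
  if x == inr j then strand G (inr i) else x.

(** The strands of the reglued graph start as in [G] and, if they come to the
    output [j], continue from the input [i]. *)
Lemma wir_reglue :
  (forall x, inl (end_in (inl x)) = redirect (strand G (inl (end_out (inl x))))) ->
  (forall x, inr (olab G (lab_out (inl x))) = redirect (strand G (inl (end_out (inr x))))) ->
  (forall x, inl (end_in (inr x)) = redirect (strand G (inr (ilab G (lab_in (inl x)))))) ->
  (forall x, inr (olab G (lab_out (inr x))) =
    redirect (strand G (inr (ilab G (lab_in (inr x)))))) ->
  #|L| = #|loop G| + (strand G (inr i) == inr j) ->
  weq (wir R) (wptr i j (wir G)).
Proof.
move=> RE RO RI RIO loopR.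
have strandR a : up_in (strand R a) = redirect (strand G (up_out a)).
  move: a; apply: (strandP (G := R)) => x; rewrite strandE /= ?lift_cut_lab.
  - exact: RE.
  - exact: RO.
  - exact: RI.
  - exact: RIO.
pose hV : bij (wV (wir R)) (wV (wptr i j (wir G))) := bid (vert G).
pose hD : bij (wD (wir R)) (wD (wptr i j (wir G))) := Bij end_out_bij.
pose hC : bij (wC (wir R)) (wC (wptr i j (wir G))) := Bij end_in_bij.
constructor; exists hV hD hC => //= a b.
have up_inj : injective up_in.
  move=> [c|m] [c'|m'] //= [].
    by move/(bij_inj end_in_bij)->.
  by move=> E'; congr inr; apply: (@lift_inj _ j); apply: val_inj.
rewrite -(inj_eq up_inj) strandR /redirect.
have up_j c : (inr j == up_in c) = false.
  by apply/negP; case: c => [c|m] /eqP //= [] /eqP; rewrite (negbTE (neq_lift _ _)).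
have -> : sum_map id (lift i) (sum_map end_out id a) = up_out a by case: a.
have -> : sum_map id (lift j) (sum_map end_in id b) = up_in b by case: b.
by case: (strand G (up_out a) =P inr j) => [->|_]; rewrite ?up_j /= ?orbF.
Qed.

End StrandTrace.

Lemma inr_olab_eq k l (G : graph X k l) (A : eqType) x y :
  (@inr A _ (olab G x) == inr (olab G y)) = (x == y).
Proof. exact: inj_eq (bij_inj (olab_bij G)) x y. Qed.

Lemma wir_join k l (G : graph X k.+1 l.+1) e f :
  weq (wir (graph_join (G := G) e f)) (wptr (ilab G e) (olab G f) (wir G)).
Proof.
case: e f => [a|a] [b|b]; last first; rewrite /graph_join; first case: eqP => ab.
all: apply: wir_reglue.
all: try move=> x; rewrite !strandE ?inr_olab_eq ?addn0 //=.
all: try by rewrite ?card_option ?ab ?eqxx ?addn1.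
- case: x => y yb /=; case: eqP => // -[E]; by move: yb; rewrite E ab eqxx.
- case: x => [[y yb]|] /=; rewrite strandE inr_olab_eq ?eqxx //.
  by case: eqP => // -[E]; move: yb; rewrite E eqxx andbF.
- by case: eqP => [[]|] //; rewrite addn0.
- case: x => [[y yb]|] /=; rewrite strandE inr_olab_eq ?eqxx //.
  by case: eqP => // -[E]; move: yb; rewrite E eqxx.
- by case: x => [[y yb]|] /=; rewrite strandE ?inr_olab_eq ?eqxx.
- case: x => y yb /=; case: eqP => // -[E]; by move: yb; rewrite E eqxx.
- by case: x => [y|] /=; rewrite strandE ?inr_olab_eq ?eqxx.
- case: x => y yb /=; case: eqP => // -[E]; by move: yb; rewrite E eqxx.
Qed.

Lemma wir_ptr k l (G : graph X k.+1 l.+1) i j :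
  weq (wir (graph_ptr G i j)) (wptr i j (wir G)).
Proof.
rewrite /graph_ptr; have ei := f_iinv (ilab_codom G i); have fj := f_iinv (olab_codom G j).
move: (iinv _) (iinv _) ei fj => f e <- <-; exact: wir_join.
Qed.

End WiringOperations.

(** * Isomorphism classes of graphs form a unitary TRAP *)

Section GraphTrap.
Variable X : nat -> nat -> Type.
Implicit Types k l : nat.

Local Notation T := (CGr_trap X).

(** [W] is the wiring of the class [C], up to isomorphism. *)
Definition wired k l (C : CGr X k l) (W : wiring X k l) : Prop := weq (wir (repr_of C)) W.

Lemma wired_refl k l (C : CGr X k l) : wired C (wir (repr_of C)).
Proof. exact: weq_refl. Qed.

Lemma class_of_weq k l (G H : graph X k l) :
  weq (wir G) (wir H) -> class_of G = class_of H.
Proof.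
move=> GH; apply: eq_exist; apply: funext => K; apply: propext; split=> [/iso_weq GK|/iso_weq HK].
  by apply: weq_iso; apply: weq_trans GK; apply: weq_sym.
by apply: weq_iso; apply: weq_trans HK.
Qed.

Lemma wired_class k l (G : graph X k l) : wired (class_of G) (wir G).
Proof. exact/iso_weq/repr_class_of. Qed.

Lemma wired_eq k l (C C' : CGr X k l) W W' : wired C W -> wired C' W' -> weq W W' -> C = C'.
Proof.
move=> CW CW' WW; rewrite -(class_ofK C) -(class_ofK C'); apply: class_of_weq.
by apply: weq_trans CW _; apply: weq_trans WW _; apply: weq_sym.
Qed.

Lemma wired_lact k l s (C : T k l) W : wired C W -> wired (lact s C) (wlact s W).
Proof.
move=> CW; apply: weq_trans (wired_class _) _; apply: weq_trans (wir_lact _ _) _.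
exact: weq_lact.
Qed.

Lemma wired_ract k l t (C : T k l) W : wired C W -> wired (ract C t) (wract W t).
Proof.
move=> CW; apply: weq_trans (wired_class _) _; apply: weq_trans (wir_ract _ _) _.
exact: weq_ract.
Qed.

Lemma wired_hcat k l k' l' (C : T k l) W (C' : T k' l') W' :
  wired C W -> wired C' W' -> wired (hcat C C' : T _ _) (whcat W W').
Proof.
move=> CW CW'; apply: weq_trans (wired_class _) _; apply: weq_trans (wir_hcat _ _) _.
exact: weq_hcat.
Qed.

Lemma wired_ptr k l i j (C : T k.+1 l.+1) W :
  wired C W -> wired (ptr i j C : T k l) (wptr i j W).
Proof.
move=> CW; apply: weq_trans (wired_class _) _; apply: weq_trans (wir_ptr _ _ _) _.
exact: weq_ptr.
Qed.

Lemma wired_cast k k' l l' (ek : k = k') (el : l = l') (C : T k l) W :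
  wired C W -> wired (castP ek el C : T _ _) (wcast ek el W).
Proof.
move=> CW; subst k' l'; apply: weq_trans CW _.
case: W => V D C' sr tg ro ri de R n;
apply: (@weq_rewire _ k l k l (Wiring sr tg ro ri de R n)) => // a b /=.
by congr R; [case: a | case: b] => // c /=; rewrite cast_ord_id.
Qed.

Lemma wired_hunit : wired (hunit T : T 0 0) (wir (graph_void X)).
Proof. exact: wired_class. Qed.

Lemma wired_unit : wired (CGr_unit X) (wir (graph_unit X)).
Proof. exact: wired_class. Qed.

Lemma CGr_lact1 k l (p : T k l) : lact 1%g p = p.
Proof.
apply: wired_eq (wired_lact _ (wired_refl p)) (wired_refl p) _.
apply: (@weq_rewire _ k l k l (wir (repr_of p))) => // a [b|b] //=.
by rewrite invg1 perm1.
Qed.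

Lemma CGr_lactM k l s s' (p : T k l) : lact s (lact s' p) = lact (pcomp s s') p.
Proof.
apply: wired_eq (wired_lact _ (wired_lact _ (wired_refl p))) (wired_lact _ (wired_refl p)) _.
apply: (@weq_rewire _ k l k l (wir (repr_of p))) => // a [b|b] //=.
by rewrite /pcomp invMg permM.
Qed.

Lemma CGr_ract1 k l (p : T k l) : ract p 1%g = p.
Proof.
apply: wired_eq (wired_ract _ (wired_refl p)) (wired_refl p) _.
apply: (@weq_rewire _ k l k l (wir (repr_of p))) => // -[a|a] b //=.
by rewrite perm1.
Qed.

Lemma CGr_ractM k l t t' (p : T k l) : ract (ract p t) t' = ract p (pcomp t t').
Proof.
apply: wired_eq (wired_ract _ (wired_ract _ (wired_refl p))) (wired_ract _ (wired_refl p)) _.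
apply: (@weq_rewire _ k l k l (wir (repr_of p))) => // -[a|a] b //=.
by rewrite /pcomp permM.
Qed.

Lemma CGr_lract k l s t (p : T k l) : lact s (ract p t) = ract (lact s p) t.
Proof.
apply: wired_eq (wired_lact _ (wired_ract _ (wired_refl p)))
  (wired_ract _ (wired_lact _ (wired_refl p))) _.
exact: weq_refl.
Qed.

Lemma sumA_bij A B C : bijective (fun x : A + (B + C) => match x with
  | inl a => inl (inl a) | inr (inl b) => inl (inr b) | inr (inr c) => inr c end).
Proof.
by exists (fun x => match x with
  | inl (inl a) => inl a | inl (inr b) => inr (inl b) | inr c => inr (inr c) end)
  => [[a|[b|c]]|[[a|b]|c]].
Qed.

Definition bsumA A B C : bij (A + (B + C)) ((A + B) + C) := Bij (@sumA_bij A B C).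

Section HcatA.
Variables (D D' D'' : Type) (k k' k'' : nat).

(** Splitting a triple disjoint union from the left and, below, from the right. *)
Definition nestl (x : ((D + D') + 'I_(k + k')) + (D'' + 'I_k'')) :
    (D + 'I_k) + ((D' + 'I_k') + (D'' + 'I_k'')) :=
  match x with
  | inl y => match wsplit y with inl z => inl z | inr z => inr (inl z) end
  | inr z => inr (inr z)
  end.

Definition nestr (x : (D + 'I_k) + ((D' + D'') + 'I_(k' + k''))) :
    (D + 'I_k) + ((D' + 'I_k') + (D'' + 'I_k'')) :=
  match x with inl z => inl z | inr y => inr (wsplit y) end.

Lemma nestA (a : (D + (D' + D'')) + 'I_(k + k' + k'')) :
  nestl (wsplit (sum_map (@bsumA _ _ _) id a)) =
  nestr (wsplit (sum_map id (cast_ord (esym (addnA k k' k''))) a)).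
Proof.
case: a => [[d|[d|d]]|] //; apply: ord_sumP => i; first (move: i; apply: ord_sumP => i).
- have -> : sum_map id (cast_ord (esym (addnA k k' k''))) (inr (lshift k'' (lshift k' i))) =
      inr (lshift (k' + k'') i) :> (D + (D' + D'')) + 'I_(k + (k' + k'')).
    by congr inr; apply: val_inj.
  by rewrite wsplitl [sum_map _ _ _]/= wsplitl /nestl wsplitl.
- have -> : sum_map id (cast_ord (esym (addnA k k' k''))) (inr (lshift k'' (rshift k i))) =
      inr (rshift k (lshift k'' i)) :> (D + (D' + D'')) + 'I_(k + (k' + k'')).
    by congr inr; apply: val_inj.
  by rewrite wsplitr [sum_map _ _ _]/= wsplitl /nestl /nestr wsplitr wsplitl.
- have -> : sum_map id (cast_ord (esym (addnA k k' k''))) (inr (rshift (k + k') i)) =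
      inr (rshift k (rshift k' i)) :> (D + (D' + D'')) + 'I_(k + (k' + k'')).
    by congr inr; apply: val_inj; rewrite /= addnA.
  by rewrite wsplitr [sum_map _ _ _]/= wsplitr /nestl /nestr wsplitr.
Qed.

End HcatA.

Lemma whcatA k l k' l' k'' l'' (W : wiring X k l) (W' : wiring X k' l') (W'' : wiring X k'' l'') :
  weq (wcast (addnA k k' k'') (addnA l l' l'') (whcat W (whcat W' W'')))
      (whcat (whcat W W') W'').
Proof.
constructor; exists (bsumA (wV W) (wV W') (wV W'')) (bsumA (wD W) (wD W') (wD W''))
  (bsumA (wC W) (wC W') (wC W'')) => /=.
- by move=> [d|[d|d]].
- by move=> [d|[d|d]].
- by move=> [c|[c|c]] [d|[d|d]].
- by move=> [c|[c|c]] [d|[d|d]].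
- by move=> [v|[v|v]].
- move=> a b; transitivity (wjoin_rel (wR W) (wjoin_rel (wR W') (wR W''))
    (nestl (wsplit (sum_map (@bsumA _ _ _) id a)))
    (nestl (wsplit (sum_map (@bsumA _ _ _) id b)))).
    case: (wsplit _) => x; case: (wsplit _) => y //=.
    + by case: (wsplit _) => x'; case: (wsplit _) => y'.
    + by case: (wsplit _) => x'.
    + by case: (wsplit _) => x'.
  rewrite !nestA; by case: (wsplit _) => x; case: (wsplit _) => y.
- by rewrite addnA.
Qed.

Lemma CGr_hcatA k l k' l' k'' l'' (p : T k l) (p' : T k' l') (p'' : T k'' l'') :
  castP (addnA k k' k'') (addnA l l' l'') (hcat p (hcat p' p'')) = hcat (hcat p p') p''.
Proof.
exact: wired_eq
  (wired_cast _ _ (wired_hcat (wired_refl p) (wired_hcat (wired_refl p') (wired_refl p''))))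
  (wired_hcat (wired_hcat (wired_refl p) (wired_refl p')) (wired_refl p'')) (whcatA _ _ _).
Qed.

Lemma sum0_bij A : bijective (fun x : void + A => match x with inl v => of_void A v | inr a => a end).
Proof. by exists inr => // -[]. Qed.

Lemma void2_bij A (f : void + void -> A) : bijective (fun x : (void + void) + A =>
  match x with inl v => f v | inr a => a end).
Proof. by exists inr => // -[[[]|[]]|]. Qed.

Lemma void2r_bij A (f : void + void -> A) : bijective (fun x : A + (void + void) =>
  match x with inl a => a | inr v => f v end).
Proof. by exists inl => // -[|[[]|[]]]. Qed.

Lemma voidr_bij A (f : void -> A) : bijective (fun x : A + void =>
  match x with inl a => a | inr v => f v end).
Proof. by exists inl => // -[|[]]. Qed.

Lemma whcat0p k l (W : wiring X k l) : weq (whcat (wir (graph_void X)) W) W.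
Proof.
constructor; exists (Bij (@sum0_bij (wV W))) (Bij (void2_bij (from_void2 (wD W))))
  (Bij (void2_bij (from_void2 (wC W)))) => /=.
- by move=> [[[]|[]]|d].
- by move=> [[[]|[]]|d].
- by move=> [[[]|[]]|d] [[[]|[]]|d'].
- by move=> [[[]|[]]|d] [[[]|[]]|d'].
- by move=> [[]|v].
- have E D m (a : ((void + void) + D) + 'I_(0 + m)) :
    wsplit a = inr (sum_map (fun x => match x with inl v => from_void2 D v | inr a => a end) id a).
    case: a => [[[[]|[]]|d]|] //; apply: ord_sumP => [[]//|i]; rewrite wsplitr /=.
    by congr (inr (inr _)); apply: val_inj.
  by move=> a b; rewrite !E.
- by rewrite card_void.
Qed.

Lemma whcatp0 k l (W : wiring X k l) :
  weq (wcast (addn0 k) (addn0 l) (whcat W (wir (graph_void X)))) W.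
Proof.
constructor; exists (Bij (voidr_bij (of_void (wV W)))) (Bij (void2r_bij (from_void2 (wD W))))
  (Bij (void2r_bij (from_void2 (wC W)))) => /=.
- by move=> [d|[[]|[]]].
- by move=> [d|[[]|[]]].
- by move=> [d|[[]|[]]] [d'|[[]|[]]].
- by move=> [d|[[]|[]]] [d'|[[]|[]]].
- by move=> [v|[]].
- have E D m (a : (D + (void + void)) + 'I_m) :
    wsplit (sum_map id (cast_ord (esym (addn0 m))) a) =
      inl (sum_map (fun x => match x with inl a => a | inr v => from_void2 D v end) id a).
    case: a => [[d|[[]|[]]]|i] //; rewrite -wsplitl; congr wsplit; congr inr.
    exact: val_inj.
  by move=> a b; rewrite !E.
- by rewrite card_void addn0.
Qed.

Lemma CGr_hcat0p k l (p : T k l) : hcat (hunit T) p = p.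
Proof.
exact: wired_eq (wired_hcat wired_hunit (wired_refl p)) (wired_refl p) (whcat0p _).
Qed.

Lemma CGr_hcatp0 k l (p : T k l) : castP (addn0 k) (addn0 l) (hcat p (hunit T)) = p.
Proof.
exact: wired_eq (wired_cast _ _ (wired_hcat (wired_refl p) wired_hunit)) (wired_refl p)
  (whcatp0 _).
Qed.

Lemma CGr_hcat_act k l k' l' (s : 'S_l) (t : 'S_k) (s' : 'S_l') (t' : 'S_k')
    (p : T k l) (p' : T k' l') :
  hcat (lact s (ract p t)) (lact s' (ract p' t')) =
  lact (ptensor s s') (ract (hcat p p') (ptensor t t')).
Proof.
apply: wired_eq (wired_hcat (wired_lact _ (wired_ract _ (wired_refl p)))
                            (wired_lact _ (wired_ract _ (wired_refl p'))))
  (wired_lact _ (wired_ract _ (wired_hcat (wired_refl p) (wired_refl p')))) _.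
have E D D' m m' (r : 'S_m) (r' : 'S_m') (a : (D + D') + 'I_(m + m')) :
    wsplit (sum_map id (ptensor r r') a) = sum_map (sum_map id r) (sum_map id r') (wsplit a).
  case: a => [[d|d]|] //; apply: ord_sumP => i; rewrite ?wsplitl ?wsplitr /= permE /ptensor_fun.
    by rewrite (unsplitK (inl _)) -[RHS]wsplitl.
  by rewrite (unsplitK (inr _)) -[RHS]wsplitr.
apply: (@weq_rewire _ _ _ _ _ (whcat (wir (repr_of p)) (wir (repr_of p')))) => // a b.
rewrite ptensorV [RHS]/= !E; by case: (wsplit a) => x; case: (wsplit b) => y.
Qed.

Lemma sumC_bij A B : bijective (fun x : A + B => match x with inl a => inr a | inr b => inl b end).
Proof.
by exists (fun x => match x with inl a => inr a | inr b => inl b end) => -[].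
Qed.

Lemma whcatC k l k' l' (W : wiring X k l) (W' : wiring X k' l') :
  weq (wlact (pswap l l') (whcat W W'))
    (wract (wcast (addnC k' k) (addnC l' l) (whcat W' W)) (pswap k k')).
Proof.
pose sw A B (x : A + B) : B + A := match x with inl a => inr a | inr b => inl b end.
constructor; exists (Bij (sumC_bij (wV W) (wV W'))) (Bij (sumC_bij (wD W) (wD W')))
  (Bij (sumC_bij (wC W) (wC W'))) => /=.
- by case.
- by case.
- by move=> [c|c] [d|d].
- by move=> [c|c] [d|d].
- by case.
- have E D D' m n (a : (D + D') + 'I_(m + n)) :
      wsplit (sum_map (@sw _ _) (cast_ord (esym (addnC n m)) \o pswap m n) a) = sw _ _ (wsplit a).
    case: a => [[d|d]|] //; apply: ord_sumP => i; rewrite ?wsplitl ?wsplitr /= permE /pswap_fun.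
      rewrite (unsplitK (inl _)) -[RHS]wsplitr; congr (wsplit (inr _)); exact: val_inj.
    rewrite (unsplitK (inr _)) -[RHS]wsplitl; congr (wsplit (inr _)); exact: val_inj.
  move=> a b.
  have [b' ->] : exists b', b = sum_map id (pswap l l') b'.
    by exists (sum_map id (pswap l l')^-1%g b); case: b => //= j; rewrite permKV.
  have -> : sum_map id (pswap l l')^-1%g (sum_map id (pswap l l') b') = b'.
    by case: b' => //= j; rewrite permK.
  have -> : sum_map id (cast_ord (esym (addnC k' k)))
      (sum_map id (pswap k k') (sum_map (@sw _ _) id a)) =
      sum_map (@sw _ _) (cast_ord (esym (addnC k' k)) \o pswap k k') a by case: a.
  have -> : sum_map id (cast_ord (esym (addnC l' l)))
      (sum_map (@sw _ _) id (sum_map id (pswap l l') b')) =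
      sum_map (@sw _ _) (cast_ord (esym (addnC l' l)) \o pswap l l') b' by case: b'.
  by rewrite !E; case: (wsplit a) => x; case: (wsplit b') => y.
- by rewrite addnC.
Qed.

Lemma CGr_hcatC k l k' l' (p : T k l) (p' : T k' l') :
  lact (pswap l l') (hcat p p' : T _ _) =
  ract (castP (addnC k' k) (addnC l' l) (hcat p' p : T _ _)) (pswap k k').
Proof.
exact: wired_eq (wired_lact _ (wired_hcat (wired_refl p) (wired_refl p')))
  (wired_ract _ (wired_cast _ _ (wired_hcat (wired_refl p') (wired_refl p)))) (whcatC _ _).
Qed.

(** * Exchanging two partial traces *)

(** [i1] followed by [i2], and [i1'] followed by [i2'], remove the same two labels
    in opposite orders. *)
Definition exchange k (i1 : 'I_k.+2) (i2 : 'I_k.+1) (i1' : 'I_k.+2) (i2' : 'I_k.+1) : Prop :=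
  [/\ lift i1 i2 = i1', lift i1' i2' = i1 &
     forall m, lift i1' (lift i2' m) = lift i1 (lift i2 m)].

Lemma exchange_lt k (i : 'I_k.+2) (i' : 'I_k.+1) : i' < i ->
  exchange i i' (inord i') (inord i.-1).
Proof.
move=> ii'; have i0 : 0 < i by apply: leq_ltn_trans ii'.
have i1 : i.-1 < k.+1 by rewrite -ltnS prednK.
have i2 : i' < k.+2 by apply: ltn_trans ii' _.
split=> [||m]; apply: val_inj; rewrite /= ?inordK // /bump.
- lia.
- lia.
- lia.
Qed.

Lemma exchange_ge k (i : 'I_k.+2) (i' : 'I_k.+1) : i <= i' ->
  exchange i i' (inord i'.+1) (inord i).
Proof.
move=> ii'; have i1 : i < k.+1 by apply: leq_ltn_trans ii' _.
have i2 : i'.+1 < k.+2 by rewrite ltnS.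
split=> [||m]; apply: val_inj; rewrite /= ?inordK // /bump; lia.
Qed.

(** The booleans tell whether the strands [x], [p], [q], starting at a point and
    at the two traced inputs, end at a point [y] or at the traced outputs [1] and
    [2].  Distinct strands have distinct ends, and both sides tell whether [x]
    leads to [y] through the two feedbacks. *)
Lemma booleans_exchange (xy x1 x2 py p1 p2 qy q1 q2 : bool) :
  ~~ (x1 && x2) -> ~~ (x1 && xy) -> ~~ (x2 && xy) ->
  ~~ (p1 && p2) -> ~~ (p1 && py) -> ~~ (p2 && py) ->
  ~~ (q1 && q2) -> ~~ (q1 && qy) -> ~~ (q2 && qy) ->
  ~~ (x1 && p1) -> ~~ (x1 && q1) -> ~~ (p1 && q1) ->
  ~~ (x2 && p2) -> ~~ (x2 && q2) -> ~~ (p2 && q2) ->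
  ~~ (xy && py) -> ~~ (xy && qy) -> ~~ (py && qy) ->
  xy || x1 && py || (x2 || x1 && p2) && (qy || q1 && py) =
  (xy || x2 && qy || (x1 || x2 && q1) && (py || p2 && qy)).
Proof. by move: xy x1 x2 py p1 p2 qy q1 q2; do 9 case. Qed.

Lemma booleans_exchange_loops (p1 p2 q1 q2 : bool) :
  ~~ (p1 && p2) -> ~~ (q1 && q2) -> ~~ (p1 && q1) -> ~~ (p2 && q2) ->
  p1 + (q2 || q1 && p2) = q2 + (p1 || p2 && q1).
Proof. by move: p1 p2 q1 q2; do 4 case. Qed.

Lemma sum_map_inr A A' B B' (f : A -> A') (g : B -> B') b : sum_map f g (inr b) = inr (g b).
Proof. by []. Qed.

Lemma wptr_wptr k l (G : graph X k.+2 l.+2) i j i' j' i1 j1 i1' j1' :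
  exchange i i' i1 i1' -> exchange j j' j1 j1' ->
  weq (wptr i' j' (wptr i j (wir G))) (wptr i1' j1' (wptr i1 j1 (wir G))).
Proof.
move=> [ei1 ei2 ei3] [ej1 ej2 ej3].
pose s := strand G.
have row a t t' : t != t' -> ~~ ((s a == t) && (s a == t')).
  by move=> tt; apply/negP => /andP[/eqP-> /eqP E]; rewrite E eqxx in tt.
have col a a' t : a != a' -> ~~ ((s a == t) && (s a' == t)).
  by move=> aa; apply/negP => /andP[/eqP <-]; rewrite (inj_eq (@strand_inj _ _ _ G)) eq_sym (negbTE aa).
have neq_inr (A : eqType) n (x y : 'I_n) : x != y -> inr x != inr y :> A + 'I_n by [].
have lift_neq (A : eqType) n (x : 'I_n.+1) (y : A + 'I_n) : inr x != sum_map id (lift x) y.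
  by case: y => // y; apply: neq_inr; apply: neq_lift.
pose up_a (a : (iedge G + outp G) + 'I_k) := sum_map id (lift i) (sum_map id (lift i') a).
have up_a' a : sum_map id (lift i1) (sum_map id (lift i1') a) = up_a a.
  by case: a => // m; rewrite /up_a /= ei3.
pose up_b (b : (iedge G + inp G) + 'I_l) := sum_map id (lift j) (sum_map id (lift j') b).
have up_b' b : sum_map id (lift j1) (sum_map id (lift j1') b) = up_b b.
  by case: b => // m; rewrite /up_b /= ej3.
have ii1 : inr i != inr i1 :> (iedge G + outp G) + 'I_k.+2.
  by apply: neq_inr; rewrite -ei1 neq_lift.
have jj1 : inr j != inr j1 :> (iedge G + inp G) + 'I_l.+2.
  by apply: neq_inr; rewrite -ej1 neq_lift.
have jb b : inr j != up_b b by apply: lift_neq.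
have j1b b : inr j1 != up_b b by rewrite -up_b'; apply: lift_neq.
have ai a : up_a a != inr i by rewrite eq_sym; apply: lift_neq.
have ai1 a : up_a a != inr i1 by rewrite eq_sym -up_a'; apply: lift_neq.
have key a b := @booleans_exchange
  (s (up_a a) == up_b b) (s (up_a a) == inr j) (s (up_a a) == inr j1)
  (s (inr i) == up_b b) (s (inr i) == inr j) (s (inr i) == inr j1)
  (s (inr i1) == up_b b) (s (inr i1) == inr j) (s (inr i1) == inr j1)
  (row _ _ _ jj1) (row _ _ _ (jb b)) (row _ _ _ (j1b b))
  (row _ _ _ jj1) (row _ _ _ (jb b)) (row _ _ _ (j1b b))
  (row _ _ _ jj1) (row _ _ _ (jb b)) (row _ _ _ (j1b b))
  (col _ _ _ (ai a)) (col _ _ _ (ai1 a)) (col _ _ _ ii1)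
  (col _ _ _ (ai a)) (col _ _ _ (ai1 a)) (col _ _ _ ii1)
  (col _ _ _ (ai a)) (col _ _ _ (ai1 a)) (col _ _ _ ii1).
apply: (@weq_rewire _ _ _ _ _ (wir G)) => [a b|].
  by rewrite !wR_ptr up_a' up_b' !sum_map_inr ei1 ei2 ej1 ej2 [LHS]key.
rewrite /= !ei1 !ei2 !ej1 !ej2 -!addnA; congr (_ + _).
exact: booleans_exchange_loops (row _ _ _ jj1) (row _ _ _ jj1) (col _ _ _ ii1) (col _ _ _ ii1).
Qed.

Lemma CGr_ptr_exchange k l (p : T k.+2 l.+2) i j i' j' i1 j1 i1' j1' :
  exchange i i' i1 i1' -> exchange j j' j1 j1' ->
  ptr i' j' (ptr i j p) = ptr i1' j1' (ptr i1 j1 p).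
Proof.
move=> ei ej; exact: wired_eq (wired_ptr _ _ (wired_ptr _ _ (wired_refl p)))
  (wired_ptr _ _ (wired_ptr _ _ (wired_refl p))) (wptr_wptr _ ei ej).
Qed.

Lemma lift_pdel n (s : 'S_n.+1) q m : lift q (pdel s q m) = s (lift (s^-1%g q) m).
Proof. by rewrite permE lift_relabel. Qed.

Lemma CGr_ptr_act k l (s : 'S_l.+1) (t : 'S_k.+1) (p : T k.+1 l.+1) i j :
  ptr i j (lact s (ract p t)) =
  lact (pdel s j) (ract (ptr (t i) (s^-1%g j) p) (pdel t (t i))).
Proof.
apply: wired_eq (wired_ptr _ _ (wired_lact _ (wired_ract _ (wired_refl p))))
  (wired_lact _ (wired_ract _ (wired_ptr _ _ (wired_refl p)))) _.
apply: (@weq_rewire _ _ _ _ _ (wir (repr_of p))) => // a b.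
have [b' ->] : exists b', b = sum_map id (pdel s j) b'.
  by exists (sum_map id (pdel s j)^-1%g b); case: b => //= m; rewrite permKV.
have -> : sum_map id (pdel s j)^-1%g (sum_map id (pdel s j) b') = b'.
  by case: b' => //= m; rewrite permK.
rewrite !(wR_lact, wR_ract, wR_ptr).
have -> : sum_map id s^-1%g (sum_map id (lift j) (sum_map id (pdel s j) b')) =
    sum_map id (lift (s^-1%g j)) b'.
  by case: b' => //= m; rewrite lift_pdel permK.
have -> : sum_map id (lift (t i)) (sum_map id (pdel t (t i)) a) =
    sum_map id t (sum_map id (lift i) a).
  by case: a => //= m; rewrite lift_pdel permK.
by [].
Qed.

Lemma CGr_ptr_hcatl k l k' l' (p : T k.+1 l.+1) (p' : T k' l') (i : 'I_k.+1) (j : 'I_l.+1) :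
  @ptr T (k + k') (l + l') (lshift k' i) (lshift l' j) (hcat p p') = hcat (ptr i j p) p'.
Proof.
apply: wired_eq (@wired_ptr (k + k') (l + l') _ _ _ _ (wired_hcat (wired_refl p) (wired_refl p')))
  (wired_hcat (wired_ptr _ _ (wired_refl p)) (wired_refl p')) _.
have E D D' m m' (i0 : 'I_m.+1) (a : (D + D') + 'I_(m + m')) :
    wsplit (sum_map id (lift (lshift m' i0 : 'I_(m + m').+1)) a : _ + 'I_(m.+1 + m')) =
    sum_map (sum_map id (lift i0)) id (wsplit a).
  case: a => [[d|d]|] //; apply: ord_sumP => i1; rewrite ?wsplitl ?wsplitr /=.
    by rewrite -[RHS](@wsplitl _ _ m.+1 m'); congr (wsplit (inr _)); apply: val_inj.
  rewrite -[RHS](@wsplitr _ _ m.+1 m'); congr (wsplit (inr _)); apply: val_inj.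
  by rewrite /= /bump; have := ltn_ord i0; lia.
apply: (@weq_rewire _ _ _ _ _ (whcat (wir (repr_of p)) (wir (repr_of p')))) => [a b|].
  rewrite !wR_hcat !E.
  rewrite [wsplit (inr (lshift l' j))](@wsplitl _ _ l.+1 l').
  rewrite [wsplit (inr (lshift k' i))](@wsplitl _ _ k.+1 k').
  by case: (wsplit a) => x; case: (wsplit b) => y; rewrite //= ?andbF ?orbF.
rewrite wR_hcat (@wsplitl _ _ l.+1 l') (@wsplitl _ _ k.+1 k') /=.
by rewrite addnAC.
Qed.

Lemma CGr_ptr_hcatr k l k' l' (p : T k l) (p' : T k'.+1 l'.+1) (i : 'I_k'.+1) (j : 'I_l'.+1) :
  @ptr T (k + k') (l + l') (cast_ord (addnS k k') (rshift k i)) (cast_ord (addnS l l') (rshift l j))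
    (castP (addnS k k') (addnS l l') (hcat p p')) = hcat p (ptr i j p').
Proof.
apply: wired_eq (@wired_ptr (k + k') (l + l') _ _ _ _
    (wired_cast _ _ (wired_hcat (wired_refl p) (wired_refl p'))))
  (wired_hcat (wired_refl p) (wired_ptr _ _ (wired_refl p'))) _.
have E D D' m m' (i0 : 'I_m'.+1) (a : (D + D') + 'I_(m + m')) :
    wsplit (sum_map id (cast_ord (esym (addnS m m')))
      (sum_map id (lift (cast_ord (addnS m m') (rshift m i0))) a)) =
    sum_map id (sum_map id (lift i0)) (wsplit a).
  case: a => [[d|d]|] //; apply: ord_sumP => i1; rewrite ?wsplitl ?wsplitr /=.
    rewrite -[RHS](@wsplitl _ _ m m'.+1); congr (wsplit (inr _)); apply: val_inj.
    by rewrite /= /bump; have := ltn_ord i1; lia.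
  rewrite -[RHS](@wsplitr _ _ m m'.+1); congr (wsplit (inr _)); apply: val_inj.
  by rewrite /= /bump; lia.
have E' D D' m m' (i0 : 'I_m'.+1) :
    wsplit (sum_map id (cast_ord (esym (addnS m m')))
      (inr (cast_ord (addnS m m') (rshift m i0)))) = inr (inr i0) :> (D + _) + (D' + _).
  by rewrite [sum_map _ _ _]/= cast_ordK wsplitr.
apply: (@weq_rewire _ _ _ _ _ (whcat (wir (repr_of p)) (wir (repr_of p')))) => [a b|].
  rewrite !wR_cast !wR_hcat !E !E'.
  by case: (wsplit a) => x; case: (wsplit b) => y; rewrite //= ?andbF ?orbF.
by rewrite wR_cast wR_hcat !E' /= addnA.
Qed.

(** * Units *)

Lemma val_segment n a b : b < n -> map val (segment n a b) = iota a (b.+1 - a).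
Proof.
move=> bn; rewrite /segment -(filter_map val (fun i => a <= i <= b)) val_enum_ord.
apply: (irr_sorted_eq ltn_trans ltnn).
- by apply: sorted_filter; [apply: ltn_trans | apply: iota_ltn_sorted].
- exact: iota_ltn_sorted.
- by move=> i; rewrite mem_filter !mem_iota; lia.
Qed.

(** The cycle in closed form, from the computation of [next] on an interval. *)
Lemma val_pcycle n a b (i : 'I_n) : a <= b < n ->
  val (pcycle n a b i) = if a <= i < b then i.+1 else if i == b :> nat then a else i.
Proof.
move=> /andP[ab bn]; rewrite permE.
rewrite -(next_map val_inj (filter_uniq _ (enum_uniq _))) [X in next X _](val_segment a bn) next_nth mem_iota.
rewrite (subnKC (leqW ab)) ltnS (subSn ab) [iota _ _]/=.
rewrite -[val i]/(nat_of_ord i); case: ifP => [/andP[ai ib]|H]; last first.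
  by case: ifP => [|_]; [lia | case: ifP => // /eqP; lia].
have -> : index (nat_of_ord i) (a :: iota a.+1 (b - a)) = i - a.
  have -> : a :: iota a.+1 (b - a) = iota a (b - a).+1 by [].
  rewrite -[X in index X _](_ : nth 0 (iota a (b - a).+1) (i - a) = i).
    by rewrite index_uniq ?iota_uniq ?size_iota //; lia.
  by rewrite nth_iota; lia.
case: (ltnP i b) => ib'.
  by rewrite ai /= nth_iota; lia.
rewrite andbF /= nth_default ?size_iota; last by lia.
by case: ifP => // /eqP; lia.
Qed.

Local Notation U := (wir (graph_unit X)).

Lemma wR_unit i j : wR U (inr i) (inr j) = true.
Proof. by rewrite /= [i]ord1 [j]ord1 -[ord0 in LHS]/(ilab (graph_unit X) (inr tt)) strand_inout. Qed.

Section LeftUnit.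
Variables (k l : nat) (W : wiring X k l).

Definition unitl_flag D (x : (void + void) + D) : D :=
  match x with inl v => from_void2 D v | inr a => a end.

Lemma unitl_weq R n R' n' :
  (forall a b, R' (sum_map (@unitl_flag _) id a) (sum_map (@unitl_flag _) id b) = R a b) ->
  n' = n -> weq (@rewire _ _ _ k l (whcat U W) R n) (@rewire _ _ _ k l W R' n').
Proof.
move=> RR nn; constructor; exists (Bij (@sum0_bij (wV W))) (Bij (void2_bij (from_void2 (wD W))))
  (Bij (void2_bij (from_void2 (wC W)))) => //=.
- by move=> [[[]|[]]|d].
- by move=> [[[]|[]]|d].
- by move=> [[[]|[]]|d] [[[]|[]]|d'].
- by move=> [[[]|[]]|d] [[[]|[]]|d'].
- by move=> [[]|v].
Qed.

(** Once the traced output is removed, the output of the unit takes the first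
    position and stands for [j]: this is the cycle that moves [j] to [0]. *)
Lemma lift_pcyclel n (j m : 'I_n) :
  lift (lift ord0 j) (pcycle n 0 j m) = if m == j then lshift n ord0 else rshift 1 m :> 'I_(1 + n).
Proof.
apply: val_inj; rewrite /= [nat_of_ord (pcycle _ _ _ _)]val_pcycle ?ltn_ord // -val_eqE /=.
by case: ifP => mj; case: ifP => mj' /=; rewrite /bump; lia.
Qed.

Lemma wsplit_lift0 D n (a : ((void + void) + D) + 'I_n) :
  wsplit (sum_map id (lift ord0) a : _ + 'I_(1 + n)) = inr (sum_map (@unitl_flag D) id a).
Proof.
case: a => [[[[]|[]]|d]|m] //; rewrite [sum_map _ _ _]/= -[RHS](@wsplitr _ _ 1 n).
by congr (wsplit (inr _)); apply: val_inj.
Qed.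

Lemma wsplit_pcyclel D n (j : 'I_n) (b : ((void + void) + D) + 'I_n) :
  wsplit (sum_map id (lift (lift ord0 j)) (sum_map id (pcycle n 0 j) b) : _ + 'I_(1 + n)) =
  if sum_map (@unitl_flag D) id b is inr m then
    if m == j then inl (inr ord0) else inr (inr m)
  else inr (sum_map (@unitl_flag D) id b).
Proof.
case: b => [[[[]|[]]|d]|m] //; rewrite [sum_map _ _ (sum_map _ _ _)]/= lift_pcyclel.
by rewrite [RHS]/=; case: (m == j); [exact: (@wsplitl _ _ 1 n) | exact: (@wsplitr _ _ 1 n)].
Qed.

Lemma wsplit_ord0 D n : wsplit (inr ord0 : _ + 'I_(1 + n)) = inl (inr ord0) :> ((void + void) + _) + (D + _).
Proof. by rewrite -(@wsplitl _ _ 1 n); congr (wsplit (inr _)); apply: val_inj. Qed.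

Lemma wsplit_liftj D n (j : 'I_n) :
  wsplit (inr (lift ord0 j) : _ + 'I_(1 + n)) = inr (inr j) :> ((void + void) + _) + (D + _).
Proof. by rewrite -(@wsplitr _ _ 1 n); congr (wsplit (inr _)); apply: val_inj. Qed.

Lemma permuted A n (s : 'S_n) (b : A + 'I_n) : exists b', b = sum_map id s b'.
Proof. by exists (sum_map id s^-1%g b); case: b => //= m; rewrite permKV. Qed.

Lemma sum_map_permK A n (s : 'S_n) (b : A + 'I_n) : sum_map id s^-1%g (sum_map id s b) = b.
Proof. by case: b => //= m; rewrite permK. Qed.

Lemma wunitl_out (j : 'I_l) :
  weq (@wptr _ k l ord0 (lift ord0 j) (whcat U W)) (wlact (pcycle l 0 j) W).
Proof.
apply: unitl_weq => [a b|]; last first.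
  by rewrite wR_hcat wsplit_ord0 wsplit_liftj /= card_void addn0.
have [b' ->] := permuted (pcycle l 0 j) b.
have -> : sum_map (@unitl_flag _) id (sum_map id (pcycle l 0 j) b') =
  sum_map id (pcycle l 0 j) (sum_map (@unitl_flag _) id b') by case: b'.
rewrite sum_map_permK !wR_hcat wsplit_lift0 wsplit_pcyclel wsplit_ord0 wsplit_liftj.
case: (sum_map _ _ b') => [c|m] /=; first by rewrite andbF orbF.
have /= u := wR_unit ord0 ord0; case: (m =P j) => [->|_] /=; by rewrite ?u ?andbT ?andbF ?orbF.
Qed.

Lemma wunitl_in (i : 'I_k) :
  weq (@wptr _ k l (lift ord0 i) ord0 (whcat U W)) (wract W (pcycle k 0 i)^-1%g).
Proof.
apply: unitl_weq => [a b|]; last first.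
  by rewrite wR_hcat wsplit_ord0 wsplit_liftj /= card_void addn0.
have [a' ->] := permuted (pcycle k 0 i) a.
have -> : sum_map (@unitl_flag _) id (sum_map id (pcycle k 0 i) a') =
  sum_map id (pcycle k 0 i) (sum_map (@unitl_flag _) id a') by case: a'.
rewrite sum_map_permK !wR_hcat wsplit_lift0 wsplit_pcyclel wsplit_ord0 wsplit_liftj.
case: (sum_map _ _ a') => [c|m] /=; first by rewrite orbF.
have /= u := wR_unit ord0 ord0; case: (m =P i) => [->|_] /=; by rewrite ?u ?andbT ?andbF ?orbF.
Qed.

End LeftUnit.

Section RightUnit.
Variables (k l : nat) (W : wiring X k l).

Definition unitr_flag D (x : D + (void + void)) : D :=
  match x with inl a => a | inr v => from_void2 D v end.

Lemma unitr_weq R n R' n' :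
  (forall a b, R' (sum_map (@unitr_flag _) id a) (sum_map (@unitr_flag _) id b) = R a b) ->
  n' = n -> weq (@rewire _ _ _ k l (whcat W U) R n) (@rewire _ _ _ k l W R' n').
Proof.
move=> RR nn; constructor; exists (Bij (voidr_bij (of_void (wV W)))) (Bij (void2r_bij (from_void2 (wD W))))
  (Bij (void2r_bij (from_void2 (wC W)))) => //=.
- by move=> [d|[[]|[]]].
- by move=> [d|[[]|[]]].
- by move=> [d|[[]|[]]] [d'|[[]|[]]].
- by move=> [d|[[]|[]]] [d'|[[]|[]]].
- by move=> [v|[]].
Qed.

Lemma cast_lift_max n (m : 'I_n) :
  cast_ord (esym (addn1 n)) (lift ord_max m) = lshift 1 m.
Proof. by apply: val_inj; rewrite /= /bump leqNgt ltn_ord. Qed.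

Lemma cast_max n : cast_ord (esym (addn1 n)) ord_max = rshift n ord0.
Proof. by apply: val_inj; rewrite /= addn0. Qed.

Lemma cast_widen n (j : 'I_n) :
  cast_ord (esym (addn1 n)) (widen_ord (leqnSn n) j) = lshift 1 j.
Proof. exact: val_inj. Qed.

(** Likewise, the output of the unit is now the last one, to which the cycle
    moves [j] back. *)
Lemma lift_pcycler n (j m : 'I_n) :
  cast_ord (esym (addn1 n)) (lift (widen_ord (leqnSn n) j) m) =
  if m == n.-1 :> nat then rshift n ord0 else lshift 1 (pcycle n j n.-1 m).
Proof.
have := ltn_ord j; have := ltn_ord m => mn jn.
apply: val_inj; rewrite /= /bump; case: ifP => /= mn1; first by lia.
by rewrite [nat_of_ord (pcycle _ _ _ _)]val_pcycle ?mn1; [case: ifP; lia | lia].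
Qed.

Lemma pcycle_last n (j m : 'I_n) : m = n.-1 :> nat -> pcycle n j n.-1 m = j.
Proof.
have := ltn_ord j; have := ltn_ord m => mn jn E.
by apply: val_inj; rewrite val_pcycle ?E ?ltnn ?andbF ?eqxx //; lia.
Qed.

Lemma wsplit_lift_max D n (a : (D + (void + void)) + 'I_n) :
  wsplit (sum_map id (cast_ord (esym (addn1 n))) (sum_map id (lift ord_max) a)) =
  inl (sum_map (@unitr_flag D) id a).
Proof.
by case: a => [[d|[[]|[]]]|m] //; rewrite [sum_map _ _ (sum_map _ _ _)]/= cast_lift_max wsplitl.
Qed.

Lemma wsplit_pcycler D n (j : 'I_n) (b : (D + (void + void)) + 'I_n) :
  wsplit (sum_map id (cast_ord (esym (addn1 n)))
    (sum_map id (lift (widen_ord (leqnSn n) j)) b)) =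
  if sum_map (@unitr_flag D) id b is inr m then
    if m == n.-1 :> nat then inr (inr ord0) else inl (inr (pcycle n j n.-1 m))
  else inl (sum_map (@unitr_flag D) id b).
Proof.
case: b => [[d|[[]|[]]]|m] //; rewrite [sum_map _ _ (sum_map _ _ _)]/= lift_pcycler /=.
by case: ifP => _; rewrite ?(unsplitK (inl _)) ?(unsplitK (inr _)).
Qed.

Lemma wsplit_max D n :
  wsplit (sum_map id (cast_ord (esym (addn1 n))) (inr ord_max)) =
  inr (inr ord0) :> (D + _) + ((void + void) + _).
Proof. by rewrite [sum_map _ _ _]/= cast_max wsplitr. Qed.

Lemma wsplit_widen D n (j : 'I_n) :
  wsplit (sum_map id (cast_ord (esym (addn1 n))) (inr (widen_ord (leqnSn n) j))) =
  inl (inr j) :> (D + _) + ((void + void) + _).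
Proof. by rewrite [sum_map _ _ _]/= cast_widen wsplitl. Qed.

Lemma wunitr_out (j : 'I_l) :
  weq (@wptr _ k l ord_max (widen_ord (leqnSn l) j) (wcast (addn1 k) (addn1 l) (whcat W U)))
    (wlact (pcycle l j l.-1)^-1%g W).
Proof.
apply: unitr_weq => [a b|]; last first.
  by rewrite wR_cast wR_hcat wsplit_max wsplit_widen /= card_void !addn0.
rewrite invgK !wR_cast !wR_hcat wsplit_lift_max wsplit_pcycler wsplit_max wsplit_widen.
case: (sum_map _ _ b) => [c|m] /=; first by rewrite andbF orbF.
have /= u := wR_unit ord0 ord0; case: ifP => [/eqP/pcycle_last->|_] /=.
  by rewrite u andbT.
by rewrite andbF orbF.
Qed.

Lemma wunitr_in (i : 'I_k) :
  weq (@wptr _ k l (widen_ord (leqnSn k) i) ord_max (wcast (addn1 k) (addn1 l) (whcat W U)))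
    (wract W (pcycle k i k.-1)).
Proof.
apply: unitr_weq => [a b|]; last first.
  by rewrite wR_cast wR_hcat wsplit_max wsplit_widen /= card_void !addn0.
rewrite !wR_cast !wR_hcat wsplit_lift_max wsplit_pcycler wsplit_max wsplit_widen.
case: (sum_map _ _ a) => [c|m] /=; first by rewrite orbF.
have /= u := wR_unit ord0 ord0; case: ifP => [/eqP/pcycle_last->|_] /=.
  by rewrite u.
by rewrite orbF.
Qed.

End RightUnit.

Lemma CGr_is_trap : is_trap T.
Proof.
split.
- exact: CGr_lact1.
- exact: CGr_lactM.
- exact: CGr_ract1.
- exact: CGr_ractM.
- exact: CGr_lract.
- exact: CGr_hcatA.
- exact: CGr_hcat0p.
- exact: CGr_hcatp0.
- exact: CGr_hcat_act.
- exact: CGr_hcatC.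
- by move=> *; apply: CGr_ptr_exchange; apply: exchange_lt.
- by move=> *; apply: CGr_ptr_exchange; [apply: exchange_ge | apply: exchange_lt].
- by move=> *; apply: CGr_ptr_exchange; [apply: exchange_lt | apply: exchange_ge].
- by move=> *; apply: CGr_ptr_exchange; apply: exchange_ge.
- exact: CGr_ptr_act.
- exact: CGr_ptr_hcatl.
- exact: CGr_ptr_hcatr.
Qed.

Lemma CGr_is_unit : is_trap_unit (P := T) (CGr_unit X).
Proof.
split=> k l p i.
- exact: wired_eq (@wired_ptr k l _ _ _ _ (wired_hcat wired_unit (wired_refl p)))
    (wired_lact _ (wired_refl p)) (wunitl_out _ _).
- exact: wired_eq (@wired_ptr k l _ _ _ _ (wired_hcat wired_unit (wired_refl p)))
    (wired_ract _ (wired_refl p)) (wunitl_in _ _).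
- exact: wired_eq (wired_ptr _ _ (wired_cast _ _ (wired_hcat (wired_refl p) wired_unit)))
    (wired_lact _ (wired_refl p)) (wunitr_out _ _).
- exact: wired_eq (wired_ptr _ _ (wired_cast _ _ (wired_hcat (wired_refl p) wired_unit)))
    (wired_ract _ (wired_refl p)) (wunitr_in _ _).
Qed.

End GraphTrap.

(** * Graphs are generated by corollas and the unit *)

Section FiberMatch.

Lemma fiber_order_index (A V : finType) (f : A -> V) (r : rel A) v a b :
  fiber_order f r -> f a = v -> f b = v ->
  r a b = (index a (fiber_seq f r v) <= index b (fiber_seq f r v)).
Proof.
move=> fr av bv; have [r1 r2 r3 r4] := fr v.
have mem c : c \in fiber_seq f r v -> c \in [pred a | f a == v] by rewrite mem_fiber_seq.
have sa : a \in fiber_seq f r v by rewrite mem_fiber_seq av.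
have sb : b \in fiber_seq f r v by rewrite mem_fiber_seq bv.
have le_r : {in fiber_seq f r v &, forall x y,
    index x (fiber_seq f r v) <= index y (fiber_seq f r v) -> r x y}.
  apply: sorted_leq_index_in; last exact: sorted_fiber_seq.
  - by move=> x y z /mem mx /mem my /mem mz; apply: r3.
  - by move=> x /mem; apply: r1.
apply/idP/idP => [rab|]; last exact: le_r.
rewrite leqNgt; apply/negP => ba; have rba := le_r _ _ sb sa (ltnW ba).
by move: ba; rewrite (r2 _ _ (mem _ sa) (mem _ sb)) ?ltnn // rab rba.
Qed.

Variables (A V A' V' : finType) (f : A -> V) (r : rel A) (f' : A' -> V') (r' : rel A').
Variable h : bij V V'.
Hypotheses (fr : fiber_order f r) (fr' : fiber_order f' r').
Hypothesis card_fib : forall v, #|[pred a | f a == v]| = #|[pred a | f' a == h v]|.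

Local Notation s := (fiber_seq f r).
Local Notation s' := (fiber_seq f' r').

Lemma fiber_match_ex a : exists a', f' a' = h (f a) /\ index a' (s' (h (f a))) = index a (s (f a)).
Proof.
have ia : index a (s (f a)) < size (s' (h (f a))).
  by rewrite size_fiber_seq -card_fib -(size_fiber_seq f r) index_mem mem_fiber_seq.
case E : (s' (h (f a))) ia => [//|a0 t]; rewrite -E => ia.
exists (nth a0 (s' (h (f a))) (index a (s (f a)))); split.
  by apply/eqP; rewrite -(mem_fiber_seq f' r') mem_nth.
by rewrite index_uniq ?uniq_fiber_seq.
Qed.

End FiberMatch.

Lemma fiber_match_inj (A V A' V' : finType) (f : A -> V) r (f' : A' -> V') r' (h : bij V V')
    (g : A -> A') :
  (forall a, f' (g a) = h (f a) /\
     index (g a) (fiber_seq f' r' (h (f a))) = index a (fiber_seq f r (f a))) ->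
  injective g.
Proof.
move=> gP a b gab; have [ga ia] := gP a; have [gb ib] := gP b.
have fab : f a = f b by apply: (@bij_injective _ _ h); rewrite -ga -gb gab.
have sa : a \in fiber_seq f r (f a) by rewrite mem_fiber_seq.
have sb : b \in fiber_seq f r (f a) by rewrite mem_fiber_seq fab.
by rewrite -(nth_index a sa) -(nth_index a sb) -ia fab -ib -fab gab.
Qed.

(** Two families of totally ordered fibers of the same sizes over sets of
    vertices in bijection match in a unique way. *)
Lemma fiber_match (A V A' V' : finType) (f : A -> V) r (f' : A' -> V') r' (h : bij V V') :
  fiber_order f r -> fiber_order f' r' ->
  (forall v, #|[pred a | f a == v]| = #|[pred a | f' a == h v]|) ->
  exists g : bij A A', (forall a, f' (g a) = h (f a)) /\
    (forall a b, f a = f b -> r' (g a) (g b) = r a b).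
Proof.
move=> fr fr' hcard; have [g gP] := choice (fiber_match_ex r r' hcard).
have hcard' v : #|[pred a | f' a == v]| = #|[pred a | f a == binv h v]|.
  by rewrite hcard /= bijVK.
have [g' g'P] := choice (fiber_match_ex r' r hcard').
have g_bij : bijective g.
  apply: inj_card_bij; first exact: fiber_match_inj gP.
  exact: leq_card (fiber_match_inj g'P).
exists (Bij g_bij); split=> [a|a b ab]; first exact: (gP a).1.
have [ga ia] := gP a; have [gb ib] := gP b.
rewrite (fiber_order_index fr (erefl (f a)) (esym ab)).
by rewrite (fiber_order_index fr' ga) ?ab ?gb // -ib -ab -ia ab.
Qed.

Section Generation.
Variable X : nat -> nat -> Type.
Local Notation T := (CGr_trap X).
Local Notation U := (wir (graph_unit X)).

Definition wtpt k l k' l' (f : bij 'I_k 'I_k') (g : bij 'I_l 'I_l') (W : wiring X k l) :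
    wiring X k' l' :=
  rewire (fun a b => wR W (sum_map id (binv f) a) (sum_map id (binv g) b)) (wL W).

Lemma wired_tpt k l k' l' (f : bij 'I_k 'I_k') (g : bij 'I_l 'I_l') (C : T k l) W :
  wired C W -> wired (tpt f g C : T k' l') (wtpt f g W).
Proof.
move=> CW; have ek := bij_ord f; have el := bij_ord g; subst k' l'; rewrite tptE.
apply: weq_trans (wired_lact _ (wired_ract _ CW)) _.
have permV n (h : bij 'I_n 'I_n) i : (bperm h)^-1%g i = binv h i.
  by apply: (canLR (permK _)); rewrite bpermE /= bijVK.
apply: (@weq_rewire _ _ _ _ _ W) => // a b.
by rewrite wR_ract; congr (wR _ _ _); [case: a | case: b] => //= m; rewrite permV.
Qed.

(** Without internal edges, the flags at the vertices are the inputs and the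
    outputs of the graph: up to the numbering of the latter, the graph is known
    from its decorated vertices and its numbers of input-output edges and of
    loops. *)
Lemma edgeless_tpt k l (G : graph X k l) k' l' (H : graph X k' l') (hV : bij (vert G) (vert H)) :
  #|iedge G| = 0 -> #|iedge H| = 0 -> (forall v, deco H (hV v) = deco G v) ->
  #|inout G| = #|inout H| -> #|loop G| = #|loop H| ->
  exists (f : bij 'I_k 'I_k') (g : bij 'I_l 'I_l'), class_of H = tpt f g (class_of G : T k l).
Proof.
move=> G0 H0 dec GHio GHL.
have noG (e : iedge G) : False by have := card0_eq G0 e.
have noH (e : iedge H) : False by have := card0_eq H0 e.
have [hC [hC1 hC2]] : exists g : bij (iedge G + inp G) (iedge H + inp H),
    (forall a, tgt H (g a) = hV (tgt G a)) /\
    (forall a b, tgt G a = tgt G b -> ile H (g a) (g b) = ile G a b).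
  apply: fiber_match; [exact: ile_order | exact: ile_order | move=> v].
  by have := deco_arity (hV v); rewrite dec deco_arity => -[].
have [hD [hD1 hD2]] : exists g : bij (iedge G + outp G) (iedge H + outp H),
    (forall a, src H (g a) = hV (src G a)) /\
    (forall a b, src G a = src G b -> ole H (g a) (g b) = ole G a b).
  apply: fiber_match; [exact: ole_order | exact: ole_order | move=> v].
  by have := deco_arity (hV v); rewrite dec deco_arity => -[].
have legs (A B : finType) (h : bij (iedge G + A) (iedge H + B)) :
    exists g : bij A B, forall a, h (inr a) = inr (g a).
  have hP a : exists b, h (inr a) = inr b.
    by case: (h (inr a)) => [e|b]; [case: (noH e) | exists b].
  have [g gP] := choice hP; have g_bij : bijective g.
    apply: inj_surj_bij => [a b E|b].
      by have := gP a; rewrite E -gP => /(bij_injective (f := h))[].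
    have := bijVK h (inr b); case: (binv_fun h (inr b)) => [e|a]; first by case: (noG e).
    by rewrite gP => -[<-]; exists a.
  by exists (Bij g_bij).
have [hI hIE] := legs _ _ hC; have [hO hOE] := legs _ _ hD.
have [fIO fIO_bij] := bij_of_card GHio; pose hIO := Bij fIO_bij.
have [f fE] : exists f : bij 'I_k 'I_k', forall x, f (ilab G x) = ilab H (sum_map hI hIO x).
  exists (bcomp (Bij (ilab_bij H)) (bcomp (bsum_map hI hIO) (binv (Bij (ilab_bij G))))) => x.
  by rewrite /= (bijK (Bij (ilab_bij G))).
have [g gE] : exists g : bij 'I_l 'I_l', forall x, g (olab G x) = olab H (sum_map hO hIO x).
  exists (bcomp (Bij (olab_bij H)) (bcomp (bsum_map hO hIO) (binv (Bij (olab_bij G))))) => x.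
  by rewrite /= (bijK (Bij (olab_bij G))).
have strandH a : strand H (sum_map hD f a) = sum_map hC g (strand G a).
  move: a; apply: (strandP (G := G)) => [e|o|a|c].
  - by case: (noG e).
  - by rewrite [sum_map _ _ _]/= hOE strandE /= (gE (inl o)).
  - by rewrite [sum_map _ _ _]/= (fE (inl a)) !strandE /= hIE.
  - by rewrite [sum_map _ _ _]/= (fE (inr c)) !strandE /= (gE (inr c)).
exists f, g; apply/esym/(wired_eq (wired_tpt f g (wired_class G)) (wired_class H)).
have weqGH : weq (wtpt f g (wir G)) (wir H).
  constructor; exists (hV : bij (wV (wtpt f g (wir G))) (wV (wir H)))
    (hD : bij (wD (wtpt f g (wir G))) (wD (wir H)))
    (hC : bij (wC (wtpt f g (wir G))) (wC (wir H))) => //.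
  move=> a b.
  have [a' ->] : exists a', a = sum_map id f a'.
    by exists (sum_map id (binv f) a); case: a => // m; rewrite /= bijVK.
  have [b' ->] : exists b', b = sum_map id g b'.
    by exists (sum_map id (binv g) b); case: b => // m; rewrite /= bijVK.
  have -> : sum_map hD id (sum_map id f a') = sum_map hD f a' by case: a'.
  have -> : sum_map hC id (sum_map id g b') = sum_map hC g b' by case: b'.
  have K A n n' (u : bij 'I_n 'I_n') (c : A + 'I_n) : sum_map id (binv u) (sum_map id u c) = c.
    by case: c => //= m; rewrite bijK.
  transitivity (strand H (sum_map hD f a') == sum_map hC g b') => //.
  by rewrite strandH (inj_eq (bij_injective (f := bsum_map hC g))) /= !K.
exact: weqGH.
Qed.

Section CutEdge.
Variables (k l : nat) (G : graph X k l) (e : iedge G).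

Definition cut_end A (x : but e + option A) : iedge G + A :=
  match x with
  | inl y => inl (val y) | inr (Some a) => inr a | inr None => inl e
  end.

Lemma cut_end_bij (A : finType) : bijective (@cut_end A).
Proof.
apply: inj_surj_bij => [[[x xe]|[a|]] [[y ye]|[b|]] //= []|[x|a]].
- by move=> E; congr inl; apply: val_inj.
- by move=> E; exfalso; move: xe; rewrite E eqxx.
- by move=> ->.
- by move=> E; exfalso; move: ye; rewrite -E eqxx.
- case: (eqVneq x e) => [->|xe]; first by exists (inr None).
  by exists (inl (exist _ x xe)).
- by exists (inr (Some a)).
Qed.

Definition cut_leg_lab A B n (lab : A + B -> 'I_n) (x : option A + B) : 'I_n.+1 :=
  match x with
  | inl None => ord0 | inl (Some a) => lift ord0 (lab (inl a))
  | inr b => lift ord0 (lab (inr b))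
  end.

Lemma cut_leg_lab_bij (A B : finType) n (lab : A + B -> 'I_n) :
  bijective lab -> bijective (cut_leg_lab lab).
Proof.
move=> lab_bij; have [g gK labK] := lab_bij.
apply: inj_surj_bij => [[[a|]|b] [[a'|]|b'] //= E|i].
- by have [->] := bij_inj lab_bij (lift_inj E).
- by have := bij_inj lab_bij (lift_inj E).
- by have := bij_inj lab_bij (lift_inj E).
- by have [->] := bij_inj lab_bij (lift_inj E).
- case: (unliftP ord0 i) => [m ->|->]; last by exists (inl None).
  case E: (g m) => [a|b]; first by exists (inl (Some a)); rewrite /= -E labK.
  by exists (inr b); rewrite /= -E labK.
Qed.

Lemma cut_edge_arity v : tag (deco G v) =
  (#|[pred a | tgt G (cut_end a) == v]|, #|[pred a | src G (cut_end a) == v]|).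
Proof. by rewrite !(card_fiber_comp _ _ (cut_end_bij _)) deco_arity. Qed.

(** The graph [G] with the edge [e] cut into a new first input and a new first
    output. *)
Definition cut_edge : graph X k.+1 l.+1 := {|
  vert := vert G; iedge := but e; inp := option (inp G); outp := option (outp G);
  inout := inout G; loop := loop G;
  src := src G \o @cut_end _; tgt := tgt G \o @cut_end _;
  ilab := cut_leg_lab (ilab G); olab := cut_leg_lab (olab G);
  ile := relpre (@cut_end _) (ile G); ole := relpre (@cut_end _) (ole G);
  deco := deco G;
  ilab_bij := cut_leg_lab_bij (ilab_bij G); olab_bij := cut_leg_lab_bij (olab_bij G);
  ile_order := fiber_order_pull (bij_inj (cut_end_bij _)) (@ile_order _ _ _ G);
  ole_order := fiber_order_pull (bij_inj (cut_end_bij _)) (@ole_order _ _ _ G);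
  deco_arity := cut_edge_arity |}.

Lemma wptr_cut_edge : weq (wptr ord0 ord0 (wir cut_edge)) (wir G).
Proof.
pose K := cut_edge.
have s0 : strand K (inr ord0) = inl (inr None) by exact: (strand_in (G := K) None).
constructor; exists (bid (vert G) : bij (wV (wptr ord0 ord0 (wir K))) (wV (wir G)))
  (Bij (cut_end_bij (outp G)) : bij (wD (wptr ord0 ord0 (wir K))) (wD (wir G)))
  (Bij (cut_end_bij (inp G)) : bij (wC (wptr ord0 ord0 (wir K))) (wC (wir G))) => //.
  pose up_in (b : (but e + option (inp G)) + 'I_l) := sum_map id (lift ord0) b.
  pose up_out (a : (but e + option (outp G)) + 'I_k) := sum_map id (lift ord0) a.
  pose dn_in (b : (but e + option (inp G)) + 'I_l) := sum_map (@cut_end _) id b.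
  pose dn_out (a : (but e + option (outp G)) + 'I_k) := sum_map (@cut_end _) id a.
  have up_inj : injective up_in.
    move=> [c|m] [c'|m'] //= [] E; first by rewrite E.
    by congr inr; apply: val_inj.
  have dn_inj : injective dn_in.
    move=> [c|m] [c'|m'] //= [] E; last by rewrite E.
    by congr inl; apply: (bij_inj (cut_end_bij _)).
  have key a : exists2 b, strand G (dn_out a) = dn_in b &
      (if strand K (up_out a) == inr ord0 then inl (inr None) else strand K (up_out a)) = up_in b.
    case: a => [[y|[o|]]|i].
    - by exists (inl (inl y)).
    - by exists (inr (olab G (inl o))).
    - by exists (inl (inr None)).
    - move: i; apply: (ilabP (G := G)) => -[a|c].
        have sI : strand K (up_out (inr (ilab G (inl a)))) = inl (inr (Some a)).
          exact: (strand_in (G := K) (Some a)).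
        by exists (inl (inr (Some a))); rewrite ?sI // [dn_out _]/= strandE.
      have sIO : strand K (up_out (inr (ilab G (inr c)))) = inr (lift ord0 (olab G (inr c))).
        exact: (strand_inout (G := K) c).
      by exists (inr (olab G (inr c))); rewrite ?sIO // [dn_out _]/= strandE.
  move=> a b; transitivity (strand G (dn_out a) == dn_in b) => //.
  have [b' -> Eb'] := key a; rewrite (inj_eq dn_inj) -(inj_eq up_inj) -Eb'.
  transitivity ((strand K (up_out a) == up_in b) ||
    (strand K (up_out a) == inr ord0) && (strand K (inr ord0) == up_in b)) => //.
  rewrite s0; case: (strand K (up_out a) =P inr ord0) => [->|_]; last by rewrite orbF.
  by rewrite /=; case: b => [c|m].
transitivity (#|loop G| + (strand K (inr ord0) == inr ord0)); first by rewrite s0 addn0.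
by [].
Qed.

Lemma class_of_cut_edge : class_of G = ptr ord0 ord0 (class_of cut_edge : T _ _) :> T k l.
Proof.
apply: (wired_eq (wired_class G) (wired_ptr _ _ (wired_class cut_edge))).
exact/weq_sym/wptr_cut_edge.
Qed.

Lemma card_but (A : finType) (a : A) : #|{: but a}| = #|A|.-1.
Proof. by rewrite card_sig -(cardC1 a); apply: eq_card. Qed.

Lemma card_cut_edge : #|iedge cut_edge| = #|iedge G|.-1.
Proof. exact: card_but. Qed.

End CutEdge.

Definition graph_loop : graph X 0 0 := {|
  vert := void; iedge := void; inp := void; outp := void; inout := void; loop := unit;
  src := from_void2 void; tgt := from_void2 void;
  ilab := from_void2 'I_0; olab := from_void2 'I_0;
  ile := fun _ _ => true; ole := fun _ _ => true; deco := of_void _;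
  ilab_bij := from_void2_bij; olab_bij := from_void2_bij;
  ile_order := void_fiber_order _ _; ole_order := void_fiber_order _ _;
  deco_arity := fun v => match v with end |}.

Lemma class_of_loop : class_of graph_loop = ptr ord0 ord0 (CGr_unit X : T 1 1) :> T 0 0.
Proof.
apply: (wired_eq (wired_class _) (wired_ptr _ _ (wired_unit X))).
constructor; exists (bid void : bij (wV (wir graph_loop)) (wV (wptr ord0 ord0 U)))
  (bid (void + void)%type : bij (wD (wir graph_loop)) (wD (wptr ord0 ord0 U)))
  (bid (void + void)%type : bij (wC (wir graph_loop)) (wC (wptr ord0 ord0 U))) => //.
- by move=> [[[]|[]]|[]].
- transitivity (#|{: void}| + wR U (inr ord0) (inr ord0)) => //.
  by rewrite wR_unit card_void [RHS]card_unit.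
Qed.

(** A predicate stable under the operations of a TRAP; [u] tells whether it also
    holds for the unit. *)
Record stable (u : bool) (Q : forall k l, T k l -> Prop) : Prop := Stable {
  stable_lact : forall k l s (C : T k l), Q k l C -> Q k l (lact s C);
  stable_ract : forall k l t (C : T k l), Q k l C -> Q k l (ract C t);
  stable_hunit : Q 0 0 (hunit T);
  stable_hcat : forall k l k' l' (C : T k l) (C' : T k' l'),
    Q k l C -> Q k' l' C' -> Q _ _ (hcat C C');
  stable_ptr : forall k l i j (C : T k.+1 l.+1), Q k.+1 l.+1 C -> Q k l (ptr i j C);
  stable_gen : forall k l (x : X k l), Q k l (CGr_gen x);
  stable_unit : u -> Q 1 1 (CGr_unit X) }.

Section Stable.
Variables (u : bool) (Q : forall k l, T k l -> Prop).
Hypothesis Qs : stable u Q.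

Lemma class_of_hcat k l k' l' (G : graph X k l) (H : graph X k' l') :
  class_of (graph_hcat G H) = hcat (class_of G : T k l) (class_of H : T k' l') :> T _ _.
Proof.
exact: (wired_eq (wired_class _) (wired_hcat (wired_class G) (wired_class H)) (wir_hcat G H)).
Qed.

Lemma stable_tpt k l k' l' (f : bij 'I_k 'I_k') (g : bij 'I_l 'I_l') (C : T k l) :
  Q C -> Q (tpt f g C : T k' l').
Proof.
have ek := bij_ord f; have el := bij_ord g; subst k' l'; rewrite tptE => QC.
by apply: (stable_lact Qs); apply: (stable_ract Qs).
Qed.

Lemma bouquet_edges n m : (u || (n == 0) && (m == 0)) ->
  exists k l (B : graph X k l), [/\ Q (class_of B : T k l), #|vert B| = 0, #|iedge B| = 0,
    #|inout B| = n & #|loop B| = m].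
Proof.
move=> u_nm; elim: n u_nm => [|n IHn] u_nm.
  elim: m u_nm => [|m IHm] u_nm.
    exists 0, 0, (graph_void X); rewrite /= !card_void; split=> //; exact: (stable_hunit Qs).
  have ut : u by rewrite andbF orbF in u_nm.
  have [|k [l [B [QB V0 E0 n0 mm]]]] := IHm; first by rewrite ut.
  exists (0 + k), (0 + l), (graph_hcat graph_loop B); split; rewrite ?card_sum ?V0 ?E0 ?n0 ?mm ?card_void ?card_unit //.
  rewrite (class_of_hcat graph_loop B) class_of_loop; apply: (stable_hcat Qs) => //.
  by apply: (stable_ptr Qs); apply: (stable_unit Qs).
have ut : u by rewrite orbF in u_nm.
have [|k [l [B [QB V0 E0 n0 mm]]]] := IHn; first by rewrite ut.
exists (1 + k), (1 + l), (graph_hcat (graph_unit X) B).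
split; rewrite ?card_sum ?V0 ?E0 ?n0 ?mm ?card_void ?card_unit //.
rewrite (class_of_hcat (graph_unit X) B); apply: (stable_hcat Qs) => //.
exact: (stable_unit Qs).
Qed.

(** Concatenating corollas, units and loops realizes all the data that determine
    an edgeless graph up to numbering. *)
Lemma bouquet r (d : 'I_r -> {kl : nat * nat & X kl.1 kl.2}) n m :
  (u || (n == 0) && (m == 0)) ->
  exists k l (B : graph X k l) (h : bij 'I_r (vert B)),
    [/\ Q (class_of B : T k l), #|iedge B| = 0, #|inout B| = n, #|loop B| = m &
        forall i, deco B (h i) = d i].
Proof.
move=> u_nm; elim: r d => [|r IHr] d.
  have [k [l [B [QB V0 E0 n0 m0]]]] := bouquet_edges u_nm.
  have [|h h_bij] := @bij_of_card 'I_0 (vert B); first by rewrite card_ord V0.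
  by exists k, l, B, (Bij h_bij); split=> // -[].
have [k [l [B [h [QB E0 n0 m0 dec]]]]] := IHr (d \o lift ord0).
case Ed : (d ord0) => [[k1 l1] x].
pose f (i : 'I_r.+1) : unit + vert B :=
  if unlift ord0 i is Some i' then inr (h i') else inl tt.
have f_bij : bijective f.
  exists (fun v => if v is inr w then lift ord0 (binv h w) else ord0).
    by rewrite /f => i; case: unliftP => [i' ->|->] //=; rewrite bijK.
  by rewrite /f => -[[]|w]; rewrite ?unlift_none // liftK /= bijVK.
exists (k1 + k), (l1 + l), (graph_hcat (corolla x) B), (Bij f_bij).
split; rewrite ?card_sum ?E0 ?n0 ?m0 ?card_void //.
  rewrite class_of_hcat; apply: (stable_hcat Qs) => //; exact: (stable_gen Qs).
move=> i; rewrite /= /f; case: unliftP => [i' ->|->] /=; first exact: dec.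
by rewrite Ed.
Qed.

(** Cutting the edges one after the other and listing the vertices presents a
    graph as traces of a concatenation of corollas, of units and of loops. *)
Lemma stable_all k l (G : graph X k l) : u || solar G -> Q (class_of G : T k l).
Proof.
move=> uG; have {uG} : u || (#|inout G| == 0) && (#|loop G| == 0) by [].
have [n leE] := ubnP #|iedge G|; elim: n k l G leE => // n IHn k l G.
case E0: #|iedge G| => [|n'] leE uG.
  pose d (i : 'I_#|vert G|) := deco G (enum_val i).
  have [k' [l' [B [h [QB B0 Bn Bm dec]]]]] := bouquet d uG.
  have hV_bij : bijective (h \o enum_rank) by exact: bij_comp (bijP h) (@enum_rank_bij _).
  have [|f [g ->]] := @edgeless_tpt _ _ B _ _ G (binv (Bij hV_bij)) B0 E0 _ Bn Bm.
    by move=> v; rewrite -[v in RHS](bijVK (Bij hV_bij)) [in RHS]/= dec /d enum_rankK.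
  exact: stable_tpt.
have /card_gt0P[e _] : 0 < #|iedge G| by rewrite E0.
rewrite (class_of_cut_edge e); apply: (stable_ptr Qs); apply: IHn => //.
by rewrite card_cut_edge E0.
Qed.

End Stable.

End Generation.

(** * The universal properties *)

Section SolarTrap.
Variable X : nat -> nat -> Type.
Local Notation T := (CGr_trap X).
Local Notation S := (solCGr_trap X).

Lemma sval_inj k l (C C' : S k l) : sval C = sval C' -> C = C'.
Proof. by case: C C' => [C Cs] [C' Cs'] /= CC; apply: eq_exist. Qed.

Lemma sval_castP k k' l l' (ek : k = k') (el : l = l') (C : S k l) :
  sval (castP ek el C : S k' l') = castP ek el (sval C : T k l) :> T k' l'.
Proof. by subst k' l'. Qed.

Lemma solCGr_is_trap : is_trap S.
Proof.
have HT := CGr_is_trap X.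
split; intros; apply: sval_inj; rewrite ?sval_castP /= ?sval_castP.
- exact: (lact1 HT).
- exact: (lactM HT).
- exact: (ract1 HT).
- exact: (ractM HT).
- exact: (lract HT).
- exact: (hcatA HT).
- exact: (hcat0p HT).
- exact: (hcatp0 HT).
- exact: (hcat_act HT).
- exact: (hcatC HT).
- exact: (ptr_ptr_ltlt HT).
- exact: (ptr_ptr_gelt HT).
- exact: (ptr_ptr_ltge HT).
- exact: (ptr_ptr_gege HT).
- exact: (ptr_act HT).
- exact: (ptr_hcatl HT).
- exact: (ptr_hcatr HT).
Qed.

End SolarTrap.

Section Uniqueness.
Variables (X : nat -> nat -> Type) (P : trap_ops).
Local Notation T := (CGr_trap X).
Local Notation S := (solCGr_trap X).

Lemma CGr_morphism_unique (Psi Psi' : forall k l, T k l -> P k l) :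
  trap_morphism Psi -> trap_morphism Psi' -> Psi 1 1 (CGr_unit X) = Psi' 1 1 (CGr_unit X) ->
  (forall k l (x : X k l), Psi k l (CGr_gen x) = Psi' k l (CGr_gen x)) -> Psi = Psi'.
Proof.
move=> H H' eq_unit eq_gen.
apply: functional_extensionality_dep => k; apply: functional_extensionality_dep => l.
apply: funext => C; rewrite -(class_ofK C).
apply: (@stable_all X true (fun k l C => Psi k l C = Psi' k l C)) => //.
split=> //.
- by move=> k0 l0 s D E; rewrite (morph_lact H) (morph_lact H') E.
- by move=> k0 l0 t D E; rewrite (morph_ract H) (morph_ract H') E.
- by rewrite (morph_hunit H) (morph_hunit H').
- by move=> k0 l0 k' l' D D' E E'; rewrite (morph_hcat H) (morph_hcat H') E E'.
- by move=> k0 l0 i j D E; rewrite (morph_ptr H) (morph_ptr H') E.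
Qed.

Lemma sol_morphism_unique (Phi Phi' : forall k l, S k l -> P k l) :
  trap_morphism Phi -> trap_morphism Phi' ->
  (forall k l (x : X k l), Phi k l (sol_gen x) = Phi' k l (sol_gen x)) -> Phi = Phi'.
Proof.
move=> H H' eq_gen.
apply: functional_extensionality_dep => k; apply: functional_extensionality_dep => l.
apply: funext => C.
pose Q k l (C : T k l) := exists2 D : S k l, sval D = C & Phi k l D = Phi' k l D.
suff [D DC E] : Q k l (sval C) by rewrite -(sval_inj DC).
rewrite -(class_ofK (sval C)); apply: (@stable_all X false Q); last exact: (svalP C).
split=> //.
- move=> k0 l0 s _ [D <- E]; exists (lact s D) => //.
  by rewrite (morph_lact H) (morph_lact H') E.
- move=> k0 l0 t _ [D <- E]; exists (ract D t) => //.
  by rewrite (morph_ract H) (morph_ract H') E.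
- by exists (hunit S); rewrite // (morph_hunit H) (morph_hunit H').
- move=> k0 l0 k' l' _ _ [D <- E] [D' <- E']; exists (hcat D D') => //.
  by rewrite (morph_hcat H) (morph_hcat H') E E'.
- move=> k0 l0 i j _ [D <- E]; exists (ptr i j D) => //.
  by rewrite (morph_ptr H) (morph_ptr H') E.
- by move=> k0 l0 x; exists (sol_gen x); last exact: eq_gen.
Qed.

End Uniqueness.

Section Existence.
Variables (X : nat -> nat -> Type) (P : trap).
Variables (phi : forall k l, X k l -> P k l) (oI : option (P 1 1)).
Hypothesis oI_unit : forall J, oI = Some J -> is_trap_unit J.
Local Notation T := (CGr_trap X).

Definition class_evable k l (C : T k l) : bool := evable oI (repr_of C).

Definition eval k l (C : T k l) (h : class_evable C) : P k l :=
  sval (cid (evals_exists phi h)).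

Lemma evals_eval k l (C : T k l) (h : class_evable C) : evals phi oI (repr_of C) (eval h).
Proof. by rewrite /eval; case: cid. Qed.

Lemma eval_class k l (G : graph X k l) (h : class_evable (class_of G)) p :
  evable oI G -> evals phi oI G p -> eval h = p.
Proof.
move=> Gev Gp; apply: (evals_fun (evals_eval h)).
apply: evals_iso Gev Gp; apply: weq_iso; apply: weq_sym; exact: wired_class.
Qed.

Lemma eval_lact k l s (C : T k l) (h : class_evable C) h' : eval (C := lact s C) h' = lact s (eval h).
Proof. by apply: eval_class; [exact: h | apply: evals_lact => //; apply: evals_eval]. Qed.

Lemma eval_ract k l t (C : T k l) (h : class_evable C) h' : eval (C := ract C t) h' = ract (eval h) t.
Proof. by apply: eval_class; [exact: h | apply: evals_ract => //; apply: evals_eval]. Qed.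

Lemma eval_hunit h : eval (C := hunit T) h = hunit P.
Proof.
apply: eval_class; last exact: evals_void.
by rewrite /evable /solar /= !card_void orbT.
Qed.

Lemma eval_hcat k l k' l' (C : T k l) (C' : T k' l') (h : class_evable C) (h' : class_evable C') h'' :
  eval (C := hcat C C') h'' = hcat (eval h) (eval h').
Proof.
apply: eval_class; first exact: evable_hcat.
by apply: evals_hcat => //; apply: evals_eval.
Qed.

Lemma eval_ptr k l i j (C : T k.+1 l.+1) (h : class_evable C) h' :
  eval (C := ptr i j C) h' = ptr i j (eval h).
Proof.
apply: eval_class; last by apply: evals_ptr => //; apply: evals_eval.
by move: (h); rewrite /class_evable /evable; case: oI => //= /solar_join; apply.
Qed.

Lemma eval_gen k l (x : X k l) h : eval (C := CGr_gen x) h = phi x.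
Proof.
apply: eval_class; last exact: evals_corolla.
by rewrite /evable /solar /= !card_void orbT.
Qed.

End Existence.

Lemma sol_morphism_exists X (P : trap_ops) (HP : is_trap P) (phi : forall k l, X k l -> P k l) :
  exists2 Phi : forall k l, solCGr_trap X k l -> P k l, trap_morphism Phi &
    forall k l (x : X k l), Phi k l (sol_gen x) = phi k l x.
Proof.
have none_unit (J : Trap HP 1 1) : None = Some J -> is_trap_unit J by [].
exists (fun k l C => eval (P := Trap HP) phi (oI := None) (svalP C)).
  split.
  - move=> k l s C; exact: (@eval_lact X (Trap HP) phi None k l s _ (svalP C)).
  - move=> k l t C; exact: (@eval_ract X (Trap HP) phi None k l t _ (svalP C)).
  - exact: (@eval_hunit X (Trap HP) phi None).
  - move=> k l k' l' C C'.
    exact: (@eval_hcat X (Trap HP) phi None k l k' l' _ _ (svalP C) (svalP C')).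
  - move=> k l i j C.
    exact: (@eval_ptr X (Trap HP) phi None none_unit k l i j _ (svalP C)).
by move=> k l x; exact: (@eval_gen X (Trap HP) phi None).
Qed.

Lemma CGr_morphism_exists X (P : trap_ops) (HP : is_trap P) (phi : forall k l, X k l -> P k l)
    (IP : P 1 1) : is_trap_unit IP ->
  exists2 Psi : forall k l, CGr_trap X k l -> P k l, utrap_morphism (CGr_unit X : CGr_trap X 1 1) IP Psi &
    forall k l (x : X k l), Psi k l (CGr_gen x) = phi k l x.
Proof.
move=> HI; pose oI : option (Trap HP 1 1) := Some IP.
have some_unit (J : Trap HP 1 1) : oI = Some J -> is_trap_unit J by case=> <-.
exists (fun k l C => eval (P := Trap HP) (C := C) phi (oI := oI) isT).
  split; last first.
    by apply: (@eval_class X (Trap HP) phi oI 1 1 (graph_unit X)) => //; apply: evals_unit.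
  split.
  - move=> k l s C; exact: (@eval_lact X (Trap HP) phi oI k l s C isT).
  - move=> k l t C; exact: (@eval_ract X (Trap HP) phi oI k l t C isT).
  - exact: (@eval_hunit X (Trap HP) phi oI).
  - move=> k l k' l' C C'; exact: (@eval_hcat X (Trap HP) phi oI k l k' l' C C' isT isT).
  - move=> k l i j C; exact: (@eval_ptr X (Trap HP) phi oI some_unit k l i j C isT).
by move=> k l x; exact: (@eval_gen X (Trap HP) phi oI).
Qed.

Theorem theorem3p3p1 (X : nat -> nat -> Type) (P : trap_ops) (HP : is_trap P)
    (phi : forall k l : nat, X k l -> P k l) :
  is_trap (solCGr_trap X)
  /\ (exists! Phi : forall k l : nat, solCGr_trap X k l -> P k l,
        trap_morphism Phi
        /\ (forall (k l : nat) (x : X k l), Phi k l (sol_gen x) = phi k l x))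
  /\ is_trap (CGr_trap X)
  /\ is_trap_unit (P := CGr_trap X) (CGr_unit X)
  /\ (forall IP : P 1 1, is_trap_unit IP ->
        (forall Phi : forall k l : nat, solCGr_trap X k l -> P k l,
           trap_morphism Phi ->
           (forall (k l : nat) (x : X k l), Phi k l (sol_gen x) = phi k l x) ->
           exists! Psi : forall k l : nat, CGr_trap X k l -> P k l,
             utrap_morphism (CGr_unit X : CGr_trap X 1 1) IP Psi
             /\ (forall (k l : nat) (G : solCGr X k l), Psi k l (sval G) = Phi k l G))
        /\ (exists! Psi : forall k l : nat, CGr_trap X k l -> P k l,
              utrap_morphism (CGr_unit X : CGr_trap X 1 1) IP Psi
              /\ (forall (k l : nat) (x : X k l), Psi k l (CGr_gen x) = phi k l x))).
Proof.
have CGr_unique (IP : P 1 1) Psi Psi' :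
    utrap_morphism (CGr_unit X : CGr_trap X 1 1) IP Psi ->
    utrap_morphism (CGr_unit X : CGr_trap X 1 1) IP Psi' ->
    (forall k l (x : X k l), Psi k l (CGr_gen x) = phi k l x) ->
    (forall k l (x : X k l), Psi' k l (CGr_gen x) = phi k l x) -> Psi = Psi'.
  move=> [H HI] [H' HI'] gen gen'; apply: CGr_morphism_unique => //; first by rewrite HI.
  by move=> k l x; rewrite gen gen'.
split; first exact: solCGr_is_trap.
split.
  have [Phi HPhi gen] := sol_morphism_exists HP phi.
  exists Phi; split=> // Phi' [HPhi' gen'].
  by apply: sol_morphism_unique => // k l x; rewrite gen gen'.
split; first exact: CGr_is_trap.
split; first exact: CGr_is_unit.
move=> IP HI; have [Psi HPsi gen] := CGr_morphism_exists HP phi HI.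
split=> [Phi HPhi genPhi|]; last first.
  by exists Psi; split=> // Psi' [HPsi' gen']; apply: (CGr_unique IP).
exists Psi; split.
  split=> // k l G; have HPsi1 := HPsi.1.
  have -> : Phi = fun k l (C : solCGr_trap X k l) => Psi k l (sval C).
    apply: sol_morphism_unique => //.
      split.
      - by move=> k0 l0 s C; apply: (morph_lact HPsi1 s (sval C)).
      - by move=> k0 l0 t C; apply: (morph_ract HPsi1 t (sval C)).
      - exact: (morph_hunit HPsi1).
      - by move=> k0 l0 k1 l1 C C'; apply: (morph_hcat HPsi1 (sval C) (sval C')).
      - by move=> k0 l0 i j C; apply: (morph_ptr HPsi1 i j (sval C)).
    by move=> k0 l0 x; rewrite genPhi; apply/esym/gen.
  by [].
move=> Psi' [HPsi' ext]; apply: (CGr_unique IP) => // k l x.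
by rewrite -genPhi -ext.
Qed.
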